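(* Let $\omega_i\subset\omega_i^*\subset\Omega$ be an interior subdomain and its oversampling domain, and assume that $\omega_i$ and $\omega_i^*$ are concentric cubes of side lengths $H_i$ and $H_i^*$, respectively, with $H_i^*>H_i$. Then there exist $n_0>0$ and $b>0$ such that for any integer $n>n_0$, $$d_n(\omega_i,\omega_i^* )\le C_1e^{-1}\,e^{-b\,n^{1/(d+1)}}\,e^{-h(\rho)\,b\,n^{1/(d+1)}},$$ where $h(s)=1+\dfrac{s\log(s)}{1-s}$, $\rho=H_i/H_i^*$, and $C_1$ is the constant in the gradient bound $\max_{x\in\Omega}|\nabla\chi_i(x)|\le C_1/\mathrm{diam}(\omega_i)$ of the partition of unity.
   Context: $\Omega\subset\mathbb R^d$ ($d=2,3$) is a bounded domain with Lipschitz boundary. $A\in(L^\infty(\Omega))^{d\times d}$ is symmetric and there are $0<\alpha<\beta<\infty$ with $\alpha|\xi|^2\le A(x)\xi\cdot\xi\le\beta|\xi|^2$ for all $\xi\in\mathbb R^d$, $x\in\Omega$. For a subdomain $\omega\subset\Omega$: $a_\omega(u,v)=\int_\omega A\nabla u\cdot\nabla v\,dx$, $\|u\|_{a,\omega}=\sqrt{a_\omega(u,u)}$. $\Omega$ is covered by finitely many open sets $\mathcal O_i$; $\omega_i=\mathcal O_i\cap\Omega$, and $\{\chi_i\}$ is a partition of unity subordinate to this cover: $0\le\chi_i\le1$, $\sum_i\chi_i=1$ on $\Omega$, $\chi_i=0$ on $\Omega\setminus\omega_i$, $\chi_i\in C^1(\omega_i)$, $\max_{x\in\Omega}|\nabla\chi_i(x)|\le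 C_1/\mathrm{diam}(\omega_i)$. Here $\omega_i=\mathcal O_i\subset\Omega$ is an interior subdomain. $H_A(\omega_i^* )=\{v\in H^1(\omega_i^* ): a_{\omega_i^*}(v,\varphi)=0\ \forall\varphi\in H_0^1(\omega_i^* )\}$ and $H_{A,0}(\omega_i^* )=\{v\in H_A(\omega_i^* ):\mathcal M_{\omega_i}(v)=0\}$, where $$\mathcal M_{\omega_i}(v)=\frac{\int_{\omega_i}A\nabla(\chi_i v)\cdot\nabla\chi_i\,dx}{\int_{\omega_i}A\nabla\chi_i\cdot\nabla\chi_i\,dx}$$ (the denominator is nonzero). The Kolmogorov $n$-width is $$d_n(\omega_i,\omega_i^* )=\inf_{Q(n)\subset H_0^1(\omega_i)}\ \sup_{u\in H_{A,0}(\omega_i^* )}\ \inf_{v\in Q(n)}\frac{\|\chi_i u-v\|_{a,\omega_i}}{\|u\|_{a,\omega_i^*}},$$ the outer infimum being over $n$-dimensional subspaces $Q(n)$ and the supremum over nonzero $u$. $\log$ is the natural logarithm. *)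

(* Defs.v *)
From HB Require Import structures.
From mathcomp Require Import all_boot all_order all_algebra.
From mathcomp Require Import all_classical all_reals all_analysis.

Set Implicit Arguments.
Unset Strict Implicit.
Unset Printing Implicit Defensive.

Import Order.TTheory GRing.Theory Num.Theory.
Import numFieldNormedType.Exports.

Local Open Scope classical_set_scope.
Local Open Scope ring_scope.

(* Points of R^d are row vectors 'rV[R]_d. The library norm on 'rV[R]_d is the
   sup norm; it only provides the topology (and differentiability). Lengths
   and diameters use the Euclidean norm enorm below. *)

(* The Borel sigma-algebra of R^n, generated by the coordinate maps (as the
   library does for n.-tuple). *)
Section rV_measurable.
Variables (R : realType) (n : nat).

Definition rV_display : measure_display.
Proof. exact: default_measure_display. Qed.

Definition rV_coord (i : 'I_n) (x : 'rV[R]_n) : measurableTypeR R := x ord0 i.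

Let rV_set0 : g_sigma_preimage rV_coord set0.
Proof. exact: sigma_algebra0. Qed.

Let rV_setC A : g_sigma_preimage rV_coord A -> g_sigma_preimage rV_coord (~` A).
Proof. exact: sigma_algebraC. Qed.

Let rV_bigcup (F : _^nat) : (forall i, g_sigma_preimage rV_coord (F i)) ->
  g_sigma_preimage rV_coord (\bigcup_i (F i)).
Proof. exact: sigma_algebra_bigcup. Qed.

HB.instance Definition _ := @isMeasurable.Build rV_display
  'rV[R]_n (g_sigma_preimage rV_coord) rV_set0 rV_setC rV_bigcup.

End rV_measurable.

Lemma measurable_rV_coord (R : realType) n (i : 'I_n) :
  measurable_fun [set: 'rV[R]_n] (@rV_coord R n i).
Proof.
move=> _ Y mY; rewrite setTI; apply: sub_sigma_algebra => /=.
rewrite -bigcup_seq/=; exists i => /=; first by rewrite mem_index_enum.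
by exists Y => //; rewrite setTI.
Qed.

Lemma measurable_fun_rVP (R : realType) d (T : measurableType d) n
    (f : T -> 'rV[R]_n) :
  (forall i, measurable_fun [set: T] (@rV_coord R n i \o f)) ->
  measurable_fun [set: T] f.
Proof.
move=> mf; suff prefS : g_sigma_preimage (fun i => @rV_coord R n i \o f)
    `<=` measurable.
  move=> _ A mA; rewrite setTI; apply: prefS.
  rewrite g_sigma_preimage_comp; exists A => //; by rewrite setTI.
apply: smallest_sub; first exact: sigma_algebra_measurable.
case: n => [|n] in f mf *; first by rewrite big_ord0.
rewrite -bigcup_mkord_ord; apply: bigcup_sub => i Ii.
by move=> A [B mB <-]; exact: mf.
Qed.

Definition rV_snoc (R : realType) n
    (p : 'rV[R]_n * measurableTypeR R) : 'rV[R]_n.+1 :=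
  \row_(k < n.+1) oapp (fun j => p.1 ord0 j) p.2 (unlift ord_max k).

Lemma measurable_rV_snoc (R : realType) n :
  measurable_fun [set: 'rV[R]_n * measurableTypeR R] (@rV_snoc R n).
Proof.
apply: measurable_fun_rVP => i.
apply: (eq_measurable_fun
    (fun p : 'rV[R]_n * measurableTypeR R =>
       oapp (fun j => rV_coord j p.1) p.2 (unlift ord_max i))).
  by move=> p _; rewrite /= /rV_coord mxE.
case: unliftP => [j _|_] /=; last exact: measurable_snd.
exact: (measurableT_comp (@measurable_rV_coord R n j) measurable_fst).
Qed.

Definition lebesgue_rV_succ (R : realType) n
    (m : {measure set 'rV[R]_n -> \bar R}) : set 'rV[R]_n.+1 -> \bar R :=
  pushforward (m \x @lebesgue_measure R)%E (@rV_snoc R n).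

HB.instance Definition _ (R : realType) n
    (m : {measure set 'rV[R]_n -> \bar R}) :=
  Measure.copy (lebesgue_rV_succ m)
    (measure_function_pushforward__canonical__measure_function_Measure
       (m \x @lebesgue_measure R)%E (@measurable_rV_snoc R n)).

(* The n-dimensional Lebesgue measure, i.e. the n-fold product of
   lebesgue_measure transported to row vectors. *)
Fixpoint lebesgue_rV (R : realType) n : {measure set 'rV[R]_n -> \bar R} :=
  match n with
  | 0 => dirac (0 : 'rV[R]_0)
  | n'.+1 => lebesgue_rV_succ (lebesgue_rV R n')
  end.

Section euclidean.
Context {R : realType} {d : nat}.
Local Notation E := 'rV[R]_d.

Definition dot (x y : E) : R := \sum_k x ord0 k * y ord0 k.

Definition enorm (x : E) : R := Num.sqrt (dot x x).

Definition diam (S : set E) : R :=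
  sup [set r | exists x y, [/\ S x, S y & r = enorm (x - y)]].

Definition orthogonal_mx (Q : 'M[R]_d) : Prop := Q *m Q^T = 1%:M.

(* The open cube with centre x0 and side length H; the rows of the
   orthogonal matrix Q are the directions of its edges. *)
Definition cube (x0 : E) (Q : 'M[R]_d) (H : R) : set E :=
  [set x | exists2 y : E, forall k, `|y ord0 k| < H / 2 & x = x0 + y *m Q].

End euclidean.

Section lipschitz_domain.
Context {R : realType} {d : nat}.
Local Notation E := 'rV[R]_d.

(* In coordinates y centred at a boundary point x0 and rotated by Q, the set
   Omega is locally the strict epigraph of a Lipschitz function gamma of the
   d - 1 coordinates other than the k-th. *)
Definition lipschitz_boundary (Omega : set E) : Prop :=
  forall x0, (closure Omega `\` interior Omega) x0 ->
  exists (Q : 'M[R]_d) (k : 'I_d) (r s L : R) (gamma : 'rV[R]_d.-1 -> R),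
  [/\ orthogonal_mx Q, 0 < r, 0 < s,
      forall y z, `|gamma y - gamma z| <= L * enorm (y - z)
    & forall y : E, enorm (col' k y) < r -> `|y ord0 k| < s ->
        (Omega (x0 + y *m Q) <-> gamma (col' k y) < y ord0 k)].

Definition bounded_lipschitz_domain (Omega : set E) : Prop :=
  [/\ Omega !=set0, open Omega, connected Omega, bounded_set Omega
    & lipschitz_boundary Omega].

End lipschitz_domain.

Section sobolev.
Context {R : realType} {d : nat}.
Local Notation E := 'rV[R]_d.
Local Notation leb := (lebesgue_rV R d).
Implicit Types (omega : set E) (u v phi : E -> R) (g : E -> E).

Definition partial (k : 'I_d) (f : E -> R) : E -> R :=
  fun x => 'D_(delta_mx ord0 k : E) f x.

Definition C1_on omega (f : E -> R) : Prop :=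
  (forall x, omega x -> differentiable f x) /\
  (forall k x, omega x -> {for x, continuous (partial k f)}).

(* C^infty: all iterated partial derivatives are differentiable. *)
Definition smooth (f : E -> R) : Prop :=
  forall (ks : seq 'I_d) x, differentiable (foldr partial f ks) x.

Definition test_fun omega phi : Prop :=
  [/\ smooth phi, compact (closure [set x | phi x != 0])
    & closure [set x | phi x != 0] `<=` omega].

Definition locally_integrable omega u : Prop :=
  measurable_fun omega u /\
  forall K, K `<=` omega -> compact K -> leb.-integrable K (EFin \o u).

Definition is_weak_grad omega u g : Prop :=
  [/\ locally_integrable omega u,
      forall k, locally_integrable omega (fun x => g x ord0 k)
    & forall phi k, test_fun omega phi ->
        \int[leb]_(x in omega) (u x * partial k phi x) =
        - \int[leb]_(x in omega) (g x ord0 k * phi x)].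

(* The weak gradient, unique up to a null set when it exists. *)
Definition grad omega u : E -> E :=
  xget (fun=> 0) [set g | is_weak_grad omega u g].

Definition L2 omega u : Prop :=
  measurable_fun omega u /\ leb.-integrable omega (EFin \o (fun x => u x ^+ 2)).

Definition H1 omega u : Prop :=
  L2 omega u /\
  exists2 g, is_weak_grad omega u g & forall k, L2 omega (fun x => g x ord0 k).

Definition H1norm omega u : R :=
  Num.sqrt (\int[leb]_(x in omega) (u x ^+ 2) +
            \int[leb]_(x in omega) (enorm (grad omega u x) ^+ 2)).

Definition H10 omega u : Prop :=
  H1 omega u /\
  exists2 phi : nat -> E -> R, forall n, test_fun omega (phi n) &
    H1norm omega (u \- phi n) @[n --> \oo] --> (0 : R).

Definition ae_zero omega u : Prop :=
  {ae leb, forall x, omega x -> u x = 0}.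

(* Elements of H^1 are represented by functions; linear independence is
   understood modulo equality almost everywhere in omega. *)
Definition subspace_of_dim omega (n : nat) (V : set (E -> R)) : Prop :=
  exists e : 'I_n -> E -> R,
  [/\ forall k, H10 omega (e k),
      forall c : 'I_n -> R,
        ae_zero omega (fun x => \sum_k c k * e k x) -> forall k, c k = 0
    & V = [set v | exists c : 'I_n -> R, v = fun x => \sum_k c k * e k x]].

End sobolev.

Section problem.
Context {R : realType} {d : nat}.
Local Notation E := 'rV[R]_d.
Local Notation leb := (lebesgue_rV R d).
Implicit Types (omega : set E) (u v chi : E -> R).

Definition elliptic_coefficient (Omega : set E) (A : E -> 'M[R]_d)
    (alpha beta : R) : Prop :=
  [/\ forall k l, measurable_fun Omega (fun x => A x k l),
      exists M : R, {ae leb, forall x, Omega x -> forall k l, `|A x k l| <= M},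
      forall x, Omega x -> (A x)^T = A x
    & forall (x xi : E), Omega x ->
        alpha * enorm xi ^+ 2 <= dot (xi *m (A x)^T) xi <= beta * enorm xi ^+ 2].

(* Gradients are row vectors: A grad u is written (grad u) *m A^T. *)
Definition aform (A : E -> 'M[R]_d) omega u v : R :=
  \int[leb]_(x in omega) dot (grad omega u x *m (A x)^T) (grad omega v x).

Definition anorm A omega u : R := Num.sqrt (aform A omega u u).

(* grad chi_j is the weak gradient on Omega, so that chi_j may have a kink on
   the boundary of omega_j (hat functions); the bound holds almost everywhere,
   hence everywhere in omega_j, where chi_j is C^1. *)
Definition partition_of_unity (Omega : set E) (I : finType)
    (O : I -> set E) (chi : I -> E -> R) (C1 : R) : Prop :=
  [/\ (forall j, open (O j)) /\ Omega `<=` \bigcup_j O j,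
      forall j x, Omega x -> 0 <= chi j x <= 1,
      forall x, Omega x -> \sum_j chi j x = 1,
      forall j x, Omega x -> ~ O j x -> chi j x = 0
    & forall j, C1_on (O j `&` Omega) (chi j) /\
        exists2 g, is_weak_grad Omega (chi j) g &
          {ae leb, forall x, Omega x -> enorm (g x) <= C1 / diam (O j `&` Omega)}].

Definition HA A omega v : Prop :=
  H1 omega v /\ forall phi, H10 omega phi -> aform A omega v phi = 0.

Definition Mfun A chi omega v : R :=
  aform A omega (chi \* v) chi / aform A omega chi chi.

Definition HA0 A chi omega omegas v : Prop :=
  HA A omegas v /\ Mfun A chi omega v = 0.

Definition nwidth A chi omega omegas (n : nat) : \bar R :=
  ereal_inf [set
    ereal_sup [set
      ereal_inf [set (anorm A omega (chi \* u \- v) / anorm A omegas u)%:E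
                | v in V]
      | u in [set u | HA0 A chi omega omegas u /\ ~ ae_zero omegas u]]
    | V in [set V | subspace_of_dim omega n V]].

End problem.

Definition hfun {R : realType} (s : R) : R := 1 + s * ln s / (1 - s).

(* Main.v *)
Require Import Defs.
From HB Require Import structures.
From mathcomp Require Import all_boot all_order all_algebra.
From mathcomp Require Import all_classical all_reals all_analysis.
From mathcomp Require Import measurable_realfun.
From mathcomp Require Import ring lra.

(** Functions that solve the equation on the large cube form an
    infinite-dimensional space, but inside the small cube they are determined,
    up to an exponentially small error, by their means over the cells of a
    grid. The proof makes this quantitative and turns vanishing means into an
    approximating subspace.

    Decay. Let u solve the equation and have mean zero over every cell of a
    grid of mesh s. The Poincare inequality on the cells (poincare_cells)
    bounds the L^2 norm of u on a region by C s times the norm of the gradient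
    on a slightly larger region, and the Caccioppoli inequality (caccioppoli)
    bounds the gradient on a region by C / delta times the L^2 norm of u on
    the delta-neighbourhood. If s / delta is a small constant, passing from
    one neighbourhood to the next divides the energy by e. The gap between the
    cubes has room for N+1 nested neighbourhoods with delta of order 1/N, so
    that the energy in the small cube is at most exp(-N) times the total
    energy (energy_decay). The price is (q (N+1))^d linear conditions on u.

    Linear algebra. Finitely many bounded functionals f_1, ..., f_m on a
    semi-inner product space leave an almost orthogonal complement: there are
    w_1, ..., w_m such that every u differs from some v with f_1 v = ... = f_m
    v = 0 and energy at most twice that of u by a combination of the w_j
    (gelfand_complement). The functionals are the cell means; they are bounded
    in the energy once u is normalised to have mean zero over an intermediate
    cube (mean_zero_poincare). This gives harmonic_approximation. Multiplying
    by the partition function chi, the span of chi and the chi w_j, enlarged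
    by bumps with disjoint supports to have dimension exactly n, approximates
    chi u with a relative error K exp(-N/2), for every n above (q (N+1))^d
    (approximating_subspace).

    Membership in H^1_0. The products chi w_j must lie in the closure of the
    test functions of the small cube. As the cube has a margin inside the
    domain on which chi vanishes, the bound on the weak gradient makes chi at
    most a multiple of the distance to the boundary of the cube
    (chi_boundary). Hence cutting off chi w in a layer of width t changes its
    gradient there by a bounded multiple of w, and the error tends to 0 with t
    (chi_H10).

    Constants. With N the integer part of n^(1/(d+1)), the condition (q
    (N+1))^d < n holds for large n, and since h <= 1 the right-hand side with
    b = 1/8 is at least C_1 exp(-1) exp(-n^(1/(d+1)) / 4). The error K
    exp(-N/2) decays faster, which absorbs K for large n (choice_of_level).
    The constant C_1 is positive: otherwise chi would have gradient zero, and
    the denominator in the weighted mean would vanish.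

    Throughout, a Sobolev function is represented by a pair (u, g) of a
    function and a gradient, both square integrable on the whole space, such
    that wg U u g holds, that is, g is a weak gradient of u when tested with
    test functions of U. Facts about such pairs are proved by mollification. *)

Set Implicit Arguments.
Unset Strict Implicit.
Unset Printing Implicit Defensive.

Import Order.TTheory GRing.Theory Num.Theory.
Import numFieldNormedType.Exports.

Local Open Scope classical_set_scope.
Local Open Scope ring_scope.

(** * Lebesgue measure on row vectors *)

Section rV_measure.
Context {R : realType}.

Lemma measurable_fun_rV_coordP n d (T : measurableType d) (f : T -> 'rV[R]_n) :
  (forall i, measurable_fun [set: T] (fun x => f x ord0 i : R)) ->
  measurable_fun [set: T] f.
Proof. by move=> mf; apply: measurable_fun_rVP => i; exact: mf. Qed.

Lemma measurable_rV_coord_comp n d (T : measurableType d) (f : T -> 'rV[R]_n) i :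
  measurable_fun [set: T] f -> measurable_fun [set: T] (fun x => f x ord0 i : R).
Proof. by move=> mf; exact: (measurableT_comp (@measurable_rV_coord R n i) mf). Qed.

Lemma measurable_rV_add n d (T : measurableType d) (f g : T -> 'rV[R]_n) :
  measurable_fun [set: T] f -> measurable_fun [set: T] g ->
  measurable_fun [set: T] (fun x => f x + g x).
Proof.
move=> mf mg; apply: measurable_fun_rV_coordP => i.
under eq_fun do rewrite mxE.
by apply: measurable_funD; exact: measurable_rV_coord_comp.
Qed.

Definition rbox n (B : 'I_n -> set R) : set 'rV[R]_n := [set x | forall k, B k (x ord0 k)].

Lemma measurable_rbox n (B : 'I_n -> set R) :
  (forall k, measurable (B k)) -> measurable (rbox B).
Proof.
move=> mB.
rewrite (_ : rbox B = \bigcap_(k in [set: 'I_n]) ((fun x : 'rV[R]_n => x ord0 k) @^-1` B k)).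
  apply: fin_bigcap_measurable => // k _; rewrite -[X in measurable X]setTI.
  by apply: (@measurable_rV_coord R n k) => //; exact: mB.
by apply/seteqP; split=> x /= h k; [move=> _; exact: h|exact: h k I].
Qed.

Lemma lebesgue_rV_rbox n (B : 'I_n -> set R) (l : 'I_n -> R) :
  (forall k, measurable (B k)) -> (forall k, lebesgue_measure (B k) = (l k)%:E) ->
  lebesgue_rV R n (rbox B) = (\prod_k l k)%:E.
Proof.
elim: n B l => [|n IH] B l mB lB.
  by rewrite big_ord0 /= diracE mem_set// => -[].
rewrite /= /lebesgue_rV_succ /pushforward.
rewrite (_ : _ @^-1` _ = rbox (fun k => B (lift ord_max k)) `*` B ord_max); last first.
  apply/seteqP; split=> [[x t]/= h|[x t]/= [h1 h2] k].
    split=> [k|]; first by have := h (lift ord_max k); rewrite mxE liftK.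
    by have := h ord_max; rewrite mxE unlift_none.
  rewrite mxE; case: unliftP => [j ->|->]//=; exact: h1.
rewrite product_measure1E//; last 2 first.
- by apply: measurable_rbox => k; exact: mB.
- exact: mB.
rewrite (IH _ (fun k => l (lift ord_max k))) ; last 2 first.
- by move=> k; exact: mB.
- by move=> k; exact: lB.
transitivity ((\prod_k l (lift ord_max k))%:E * (l ord_max)%:E)%E.
  by congr (_ * _)%E; exact: lB.
rewrite -EFinM; congr (_%:E); rewrite big_ord_recr/=; congr (_ * _).
by apply: eq_bigr => k _; congr (l _); apply/val_inj; rewrite /= /bump leqNgt ltn_ord.
Qed.

Lemma lebesgue_rV_sigma_finite n : sigma_finite [set: 'rV[R]_n] (lebesgue_rV R n).
Proof.
exists (fun m => rbox (fun=> `[(- m%:R), m%:R]%classic)).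
  apply/seteqP; split=> // x _.
  exists (Num.bound `|x|) => // k /=.
  rewrite in_itv/= -ler_norml; apply: le_trans (ltW (archi_boundP _)) => //.
  rewrite [leRHS]/Num.Def.normr /= mx_normrE.
  exact: (le_bigmax _ (fun ij => `|x ij.1 ij.2|) (ord0, k)).
move=> m; split; first by apply: measurable_rbox.
rewrite (@lebesgue_rV_rbox _ _ (fun=> (m%:R + m%:R)))//; first by rewrite ltry.
move=> k; rewrite lebesgue_measure_itv/= lte_fin.
case: ltP => [_|]; first by rewrite -EFinB opprK.
by case: m => [|m]; rewrite ?addr0// leNgt => /negP; case; rewrite (@lt_trans _ _ 0)// ?oppr_lt0 ltr0n.
Qed.

Local Notation pushm m mf := (measure_function_pushforward__canonical__measure_function_Measure m mf).

Lemma lebesgue_measure_shift (t : R) (A : set (measurableTypeR R)) :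
  measurable A -> lebesgue_measure ((fun x => x + t) @^-1` A) = lebesgue_measure A.
Proof.
move=> mA.
have mt : measurable_fun [set: measurableTypeR R] ((fun x => x + t) : measurableTypeR R -> measurableTypeR R).
  by apply: measurable_funD => //; exact: measurable_cst.
rewrite -[RHS](_ : pushforward (@lebesgue_measure R) (fun x : measurableTypeR R => (x + t : measurableTypeR R)) A = _)//.
apply/esym; apply: (@lebesgue_measure_unique _ (pushm (@lebesgue_measure R) mt)) => //= _ [[a b]] _ <- /=.
rewrite /pushforward.
have -> : (fun x : R => x + t) @^-1` `]a, b] = `](a - t), (b - t)]%classic.
  by apply/seteqP; split => x /=; rewrite !in_itv/= ltrBlDr lerBrDr.
rewrite !lebesgue_measure_itv/= !lte_fin ltrD2r.
by case: ifP => // _; rewrite -!EFinB; congr (_%:E); ring.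
Qed.

(** A copy of the measure that carries the sigma-finite structure, for which
    Tonelli and the product measure are available. *)
Definition lebS n : set 'rV[R]_n -> \bar R := lebesgue_rV R n.
Arguments lebS n : clear implicits.
HB.instance Definition _ n := Measure.copy (lebS n) (lebesgue_rV R n).
HB.instance Definition _ n := Measure_isSigmaFinite.Build _ _ _ (lebS n)
  (lebesgue_rV_sigma_finite n).

Lemma lebesgue_rV_tonelli2 n (f : 'rV[R]_n * 'rV[R]_n -> \bar R) :
  measurable_fun setT f -> (forall x, 0 <= f x)%E ->
  (\int[lebesgue_rV R n]_x \int[lebesgue_rV R n]_y f (x, y) =
   \int[lebesgue_rV R n]_y \int[lebesgue_rV R n]_x f (x, y))%E.
Proof. by move=> mf f0; exact: (@fubini_tonelli _ _ _ _ _ (lebS n) (lebS n)). Qed.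

Lemma measurable_rV_shift n (z : 'rV[R]_n) : measurable_fun [set: 'rV[R]_n] (fun x => x + z).
Proof. by apply: measurable_rV_add => //; exact: measurable_cst. Qed.

(** Separate from the invariance of the measure because the induction step of
    lebesgue_rV_shift integrates a shifted function in dimension n. *)
Lemma ge0_integral_rV_shift_of n (z : 'rV[R]_n) :
  (forall A, measurable A -> lebesgue_rV R n ((fun x => x + z) @^-1` A) = lebesgue_rV R n A) ->
  forall f, measurable_fun setT f -> (forall x, 0 <= f x)%E ->
  (\int[lebesgue_rV R n]_x f (x + z)%R = \int[lebesgue_rV R n]_x f x)%E.
Proof.
move=> h f mf f0.
have := @ge0_integral_pushforward _ _ _ _ R _ (measurable_rV_shift z) (lebesgue_rV R n) setT f measurableT mf (fun x _ => f0 x).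
rewrite preimage_setT /= => <-.
by apply: (@eq_measure_integral _ _ _ _ _ (pushm (lebesgue_rV R n) (measurable_rV_shift z))) => A mA _; exact: (h A mA).
Qed.

(** Induction on the dimension: the measure of the shifted set is the integral
    of the one-dimensional measures of its sections, each of which is a
    shifted section of the original set. *)
Lemma lebesgue_rV_shift n (z : 'rV[R]_n) A : measurable A ->
  lebesgue_rV R n ((fun x => x + z) @^-1` A) = lebesgue_rV R n A.
Proof.
elim: n z A => [|n IH] z A mA.
  by congr (lebesgue_rV R 0 _); apply/seteqP; split => x /=; rewrite [x + z]thinmx0 [x]thinmx0.
rewrite /= /lebesgue_rV_succ /pushforward.
set B := @rV_snoc R n @^-1` A.
pose z' := \row_(j < n) z ord0 (lift ord_max j).
pose s := z ord0 ord_max.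
have mB : measurable B.
  by rewrite -[B]setTI; exact: (@measurable_rV_snoc R n).
rewrite (_ : @rV_snoc R n @^-1` (_ @^-1` A) = [set p | B (p.1 + z', p.2 + s)]); last first.
  apply/seteqP; split => -[x t]/=; rewrite /B /=;
  (rewrite (_ : rV_snoc (x, t) + z = rV_snoc (x + z', t + s))//;
   apply/rowP => k; rewrite !mxE; case: unliftP => [j ->|->]//=; by rewrite !mxE).
rewrite /product_measure1 /=.
(* The last coordinate is shifted inside each section, the others move the
   section. *)
rewrite (_ : (fun x => _) = fun x => (lebesgue_measure \o xsection B) (x + z')); last first.
  apply/funext => x /=.
  rewrite -(@lebesgue_measure_shift s (xsection B (x + z'))); last exact: measurable_xsection.
  by congr lebesgue_measure; apply/seteqP; split=> t /=; rewrite /xsection/= !inE.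
apply: (@ge0_integral_rV_shift_of n z' (IH z') (lebesgue_measure \o xsection B)).
- exact: (measurable_fun_xsection (@lebesgue_measure R)).
- by move=> x; exact: measure_ge0.
Qed.

Lemma ge0_integral_rV_shift n (z : 'rV[R]_n) (f : 'rV[R]_n -> \bar R) :
  measurable_fun setT f -> (forall x, 0 <= f x)%E ->
  (\int[lebesgue_rV R n]_x f (x + z)%R = \int[lebesgue_rV R n]_x f x)%E.
Proof. by apply: ge0_integral_rV_shift_of => A; exact: lebesgue_rV_shift. Qed.

Lemma integral_rV_shift n (z : 'rV[R]_n) (f : 'rV[R]_n -> \bar R) :
  measurable_fun setT f ->
  (\int[lebesgue_rV R n]_x f (x + z)%R = \int[lebesgue_rV R n]_x f x)%E.
Proof.
move=> mf; rewrite [LHS]integralE [RHS]integralE; congr (_ - _)%E.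
- rewrite -[RHS](ge0_integral_rV_shift z); last 2 first.
  + exact: measurable_funepos.
  + exact: funepos_ge0.
  by apply: eq_integral => x _; rewrite !unlock.
- rewrite -[RHS](ge0_integral_rV_shift z); last 2 first.
  + exact: measurable_funeneg.
  + exact: funeneg_ge0.
  by apply: eq_integral => x _; rewrite !unlock.
Qed.

Lemma Rintegral_rV_shift n (z : 'rV[R]_n) (f : 'rV[R]_n -> R) :
  measurable_fun setT f ->
  \int[lebesgue_rV R n]_x f (x + z) = \int[lebesgue_rV R n]_x f x.
Proof.
move=> mf; rewrite /Rintegral; congr fine.
by apply: (integral_rV_shift z (f := EFin \o f)); exact/measurable_EFinP.
Qed.

Lemma rV_norm_coord n (x : 'rV[R]_n) k : `|x ord0 k| <= `|x|.
Proof.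
rewrite [leRHS]/Num.Def.normr /= mx_normrE.
exact: (le_bigmax _ (fun ij => `|x ij.1 ij.2|) (ord0, k)).
Qed.

Lemma rV_norm_ltP n (x : 'rV[R]_n) r : 0 < r -> (`|x| < r <-> forall k, `|x ord0 k| < r).
Proof.
move=> r0; split=> [h k|h]; first exact: le_lt_trans (rV_norm_coord x k) h.
rewrite [ltLHS]/Num.Def.normr /= mx_normrE; apply/bigmax_ltP; split => // -[i k] _ /=.
by rewrite (ord1 i).
Qed.

Lemma rV_norm_leP n (x : 'rV[R]_n) r : 0 <= r -> (`|x| <= r <-> forall k, `|x ord0 k| <= r).
Proof.
move=> r0; split=> [h k|h]; first exact: le_trans (rV_norm_coord x k) h.
rewrite [leLHS]/Num.Def.normr /= mx_normrE; apply/bigmax_leP; split => // -[i k] _ /=.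
by rewrite (ord1 i).
Qed.

Lemma rV_ball_rbox n (x : 'rV[R]_n) r : 0 < r ->
  ball x r = rbox (fun k => ball (x ord0 k : R) r).
Proof.
move=> r0; rewrite -!ball_normE; apply/seteqP; split => y; rewrite /ball_ /= => h.
  by move=> k; have := (rV_norm_ltP (x - y) r0).1 h k; rewrite !mxE.
by apply/rV_norm_ltP => // k; have := h k; rewrite /= !mxE.
Qed.

Lemma measurable_rV_ball n (x : 'rV[R]_n) r : measurable (ball x r).
Proof.
have [r0|r0] := ltP 0 r; last first.
  rewrite (_ : ball x r = set0)//; apply/seteqP; split => // y.
  by rewrite -ball_normE /ball_ /= => /(le_lt_trans (normr_ge0 _)); rewrite ltNge r0.
by rewrite rV_ball_rbox//; apply: measurable_rbox => k; exact: measurable_ball.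
Qed.

Lemma lebesgue_rV_ball n (x : 'rV[R]_n) r : 0 < r ->
  lebesgue_rV R n (ball x r) = ((r *+ 2) ^+ n)%:E.
Proof.
move=> r0; rewrite rV_ball_rbox// (@lebesgue_rV_rbox _ _ (fun=> r *+ 2)).
- by rewrite prodr_const card_ord.
- by move=> k; exact: measurable_ball.
- by move=> k; rewrite lebesgue_measure_ball// ltW.
Qed.

Lemma open_rV_measurable n (U : set 'rV[R]_n) : open U -> measurable U.
Proof.
move=> oU.
pose c (q : 'rV[rat]_n) : 'rV[R]_n := map_mx ratr q.
have -> : U = \bigcup_(p in [set p : 'rV[rat]_n * nat | ball (c p.1) (p.2.+1%:R^-1) `<=` U]) ball (c p.1) (p.2.+1%:R^-1).
  apply/seteqP; split=> [x Ux|x [p /= pU]]; last exact: pU.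
  have /nbhs_ballP[e /= e0 eU] := open_nbhs_nbhs (conj oU Ux).
  have [m me] : exists m : nat, m.+1%:R^-1 < e / 2.
    exists (Num.bound (e / 2)^-1).
    rewrite -[ltRHS]invrK ltf_pV2 ?posrE ?invr_gt0 ?divr_gt0//.
    apply: lt_trans (archi_boundP _) _; first by rewrite invr_ge0 divr_ge0// ltW.
    by rewrite ltr_nat.
  have m0 : 0 < (m.+1%:R^-1 : R) by rewrite invr_gt0.
  set r : R := m.+1%:R^-1 in me m0.
  have /choice [q hq] : forall k : 'I_n, exists q : rat, `|x ord0 k - ratr q| < r.
    move=> k; have lt2 : x ord0 k - r < x ord0 k + r by lra.
    have [q] := @rat_in_itvoo R _ _ lt2.
    by rewrite in_itv/= => h; exists q; rewrite ltr_norml; lra.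
  have xq : `|x - c (\row_k q k)| < r.
    by apply/rV_norm_ltP => // k; rewrite !mxE.
  exists (\row_k q k, m) => /=; last by rewrite -ball_normE /ball_ /= distrC.
  move=> y; rewrite -ball_normE /ball_ /= -/r => yq; apply: eU.
  rewrite -ball_normE /ball_ /= -(subrKA (c (\row_k q k))).
  by apply: le_lt_trans (ler_normD _ _) _; lra.
rewrite bigcup_mkcond; apply: countable_bigcupT_measurable => [|p]; first exact: countableP.
by case: ifP => // _; exact: measurable_rV_ball.
Qed.

Lemma continuous_rV_measurable n (f : 'rV[R]_n -> R) : continuous f ->
  measurable_fun [set: 'rV[R]_n] f.
Proof.
move=> /continuousP cf; apply: (measurability _ (RGenOpens.measurableE R)).
move=> _ [_ [a [b ->] <-]]; rewrite setTI; apply: open_rV_measurable.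
exact/cf/interval_open.
Qed.

End rV_measure.

(** * Smooth functions and bumps *)

Section smooth_theory.
Context {R : realType}.

(** The remainder is quadratic, hence little-o of the increment. Bounds of
    this form are easy to integrate, so this is how differentiability of
    convolutions is obtained. *)
Lemma quadratic_diff (V : normedModType R) (f : V -> R) (L : {linear V -> R}) x C :
  continuous L -> (forall h, `|f (x + h) - f x - L h| <= C * `|h| ^+ 2) ->
  differentiable f x /\ 'd f x = L :> (V -> R).
Proof.
move=> cL hC.
have eqL : f \o shift x = cst (f x) + L +o_ 0 id.
  apply/eqaddoP => e e0 /=.
  have C0 : 0 < `|C| + 1 by rewrite ltr_wpDl.
  near=> k.
  rewrite (_ : (f \o shift x - (cst (f x) + L)) k = f (x + k) - f x - L k); last first.
    by rewrite [x + k]addrC -addrA -opprD.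
  apply: le_trans (hC k) _.
  apply: (@le_trans _ _ ((`|C| + 1) * `|k| * `|k|)).
    rewrite expr2 mulrA ler_wpM2r// ler_wpM2r//.
    by rewrite (le_trans (ler_norm _))// lerDl.
  rewrite ler_wpM2r// -ler_pdivlMl// mulrC.
  near: k; apply/nbhs_ballP; exists (e / (`|C| + 1)); first by rewrite /= divr_gt0.
  by move=> y; rewrite -ball_normE /ball_ /= sub0r normrN => /ltW.
have dE := diff_unique cL eqL; split=> //.
by apply/diff_locallyP; rewrite dE; split.
Unshelve. all: by end_near.
Qed.

Section rV.
Context {d : nat}.
Local Notation E := 'rV[R]_d.
Implicit Types f g : E -> R.

Fact rV_lform_key (c : 'I_d -> R) : linear (fun h : E => \sum_k h ord0 k * c k).
Proof.
move=> a u v; rewrite scaler_sumr -big_split /=; apply: eq_bigr => k _.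
by rewrite !mxE mulrDl -mulrA.
Qed.

(** A named linear form, so that it can carry the linear structure that
    quadratic_diff expects. *)
Definition rV_lform (c : 'I_d -> R) (h : E) : R := \sum_k h ord0 k * c k.

HB.instance Definition _ (c : 'I_d -> R) := GRing.isLinear.Build R E R _ (rV_lform c) (rV_lform_key c).

Lemma continuous_rV_lform c : continuous (rV_lform c).
Proof.
apply: continuous_big => [|k _ x]; first exact: add_continuous.
apply: (@continuousM _ _ (fun y : E => y ord0 k : R) (fun=> c k)); last exact: cst_continuous.
exact: coord_continuous.
Qed.

Lemma rV_quadratic_partial f x (c : 'I_d -> R) C :
  (forall h, `|f (x + h) - f x - \sum_k h ord0 k * c k| <= C * `|h| ^+ 2) ->
  differentiable f x /\ forall k, partial k f x = c k.
Proof.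
move=> h; have [df dE] := quadratic_diff (L := rV_lform c) (@continuous_rV_lform c) h.
split=> // k; rewrite /partial deriveE// dE /= /rV_lform (bigD1 k)//= big1 => [|j jk].
  by rewrite addr0 !mxE !eqxx mul1r.
by rewrite !mxE (negbTE jk) andbF mul0r.
Qed.

Lemma rV_derive_partial f x (v : E) : differentiable f x ->
  'D_v f x = \sum_k v ord0 k * partial k f x.
Proof.
move=> df; rewrite deriveE//.
have {1}-> : v = \sum_k v ord0 k *: delta_mx ord0 k.
  exact: row_sum_delta.
rewrite linear_sum; apply: eq_bigr => k _.
by rewrite linearZ /= /partial deriveE.
Qed.

(** A recursion on the number of derivatives: smoothness of products,
    compositions and convolutions is proved by induction on n, with the
    function generalised. *)
Fixpoint Cn n f : Prop := match n with
  | 0 => True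
  | m.+1 => (forall x, differentiable f x) /\ forall k, Cn m (partial k f)
  end.

Lemma CnS n f : Cn n.+1 f -> Cn n f.
Proof. by elim: n f => //= n IH f [df h]; split=> // k; apply: IH. Qed.

Lemma smooth_partial f k : smooth f -> smooth (partial k f).
Proof. by move=> sf ks x; have := sf (rcons ks k) x; rewrite foldr_rcons. Qed.

Lemma smoothP f : smooth f <-> forall n, Cn n f.
Proof.
split=> [sf n|cf ks].
  elim: n f sf => //= n IH f sf; split=> [x|k]; first exact: (sf [::] x).
  by apply: IH; exact: smooth_partial.
elim/last_ind: ks f cf => [|ks k IH] f cf x /=; first by have [+ _] := cf 1%N; exact.
rewrite foldr_rcons; apply: IH => n; have [_] := cf n.+1; exact.
Qed.

Lemma smooth_diff f x : smooth f -> differentiable f x.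
Proof. by move=> /(_ [::] x). Qed.

Lemma smooth_cont f : smooth f -> continuous f.
Proof. by move=> sf x; apply: differentiable_continuous; exact: smooth_diff. Qed.

Lemma partial_cst k (a : R) : partial k (fun=> a) = (fun=> 0) :> (E -> R).
Proof. by apply/funext => x; rewrite /partial (derive_cst a). Qed.

Lemma partialD k f g : (forall x, differentiable f x) -> (forall x, differentiable g x) ->
  partial k (fun x => f x + g x) = fun x => partial k f x + partial k g x.
Proof.
move=> df dg; apply/funext => x.
by rewrite /partial [LHS](@deriveD _ _ _ f g)//; exact: diff_derivable.
Qed.

Lemma partialM k f g : (forall x, differentiable f x) -> (forall x, differentiable g x) ->
  partial k (fun x => f x * g x) = fun x => f x * partial k g x + partial k f x * g x.
Proof.
move=> df dg; apply/funext => x.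
rewrite /partial [LHS](@deriveM _ _ f g); try exact: diff_derivable.
by congr (_ + _); rewrite mulrC.
Qed.

Lemma Cn_cst n (a : R) : Cn n (fun=> a).
Proof.
elim: n a => //= n IH a; split=> [x|k]; first exact: differentiable_cst.
by rewrite partial_cst.
Qed.

Lemma CnD n f g : Cn n f -> Cn n g -> Cn n (fun x => f x + g x).
Proof.
elim: n f g => //= n IH f g [df cf] [dg cg]; split=> [x|k].
  exact: differentiableD.
by rewrite partialD//; apply: IH.
Qed.

Lemma CnM n f g : Cn n f -> Cn n g -> Cn n (fun x => f x * g x).
Proof.
elim: n f g => // n IH f g cf cg; have [df pf] := cf; have [dg pg] := cg.
split=> [x|k]; first exact: differentiableM.
by rewrite partialM//; apply: CnD; apply: IH; first [exact: pf|exact: pg|exact: (CnS cf)|exact: (CnS cg)].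
Qed.

Lemma smooth_cst (a : R) : smooth (fun _ : E => a).
Proof. by apply/smoothP => n; exact: Cn_cst. Qed.

Lemma smoothM f g : smooth f -> smooth g -> smooth (fun x => f x * g x).
Proof. by move=> /smoothP sf /smoothP sg; apply/smoothP => n; exact: CnM. Qed.

Lemma smoothZ a f : smooth f -> smooth (fun x => a * f x).
Proof. by move=> sf; apply: smoothM => //; exact: smooth_cst. Qed.

Lemma smooth_prod (I : Type) (s : seq I) (F : I -> E -> R) :
  (forall i, smooth (F i)) -> smooth (fun x => \prod_(i <- s) F i x).
Proof.
move=> sF; elim: s => [|i s IH].
  by under eq_fun do rewrite big_nil; exact: smooth_cst.
by under eq_fun do rewrite big_cons; apply: smoothM.
Qed.

Lemma differentiable_affine f a z x : (forall x, differentiable f x) ->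
  differentiable (fun x : E => f (a *: x + z)) x.
Proof.
move=> df; apply: (@differentiable_comp _ _ _ _ (fun x : E => a *: x + z) f) => //.
Qed.

Lemma partial_affine k f a z : (forall x, differentiable f x) ->
  partial k (fun x : E => f (a *: x + z)) = fun x => a * partial k f (a *: x + z).
Proof.
move=> df; apply/funext => x.
pose A := fun x : E => a *: x + z.
have dA : differentiable A x.
  by apply: differentiableD.
rewrite /partial deriveE; last exact: differentiable_affine.
rewrite [X in X _ = _](@diff_comp _ _ _ _ A f)// /=.
rewrite (_ : 'd A x (delta_mx ord0 k) = a *: delta_mx ord0 k); last first.
  rewrite -deriveE// /A deriveD//; try exact: diff_derivable.
  rewrite (derive_cst z) addr0 deriveZ//.
  by rewrite derive_id.
by rewrite linearZ /= deriveE.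
Qed.

Lemma Cn_affine n f a z : Cn n f -> Cn n (fun x => f (a *: x + z)).
Proof.
elim: n f => //= n IH f [df cf]; split=> [x|k]; first exact: differentiable_affine.
rewrite partial_affine//; apply: CnM; first exact: Cn_cst.
exact: IH.
Qed.

Lemma smooth_affine f a z : smooth f -> smooth (fun x => f (a *: x + z)).
Proof. by move=> /smoothP sf; apply/smoothP => n; exact: Cn_affine. Qed.

(** The derivative of b composed with a coordinate is again a function of this
    form; this propagates through all orders. *)
Lemma coord_comp_partial (b b' : R -> R) (s c : R) k :
  (forall t : R, is_derive t 1 b (b' t)) ->
  (forall x : E, differentiable (fun x : E => b (c + s * x ord0 k)) x) /\
  forall j, partial j (fun x : E => b (c + s * x ord0 k)) =
            fun x => ((j == k)%:R * s) * b' (c + s * x ord0 k).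
Proof.
move=> hb.
pose A (x : E) : R := c + s * x ord0 k.
have qA x : differentiable A x /\ forall j, partial j A x = (j == k)%:R * s.
  apply: (@rV_quadratic_partial _ _ _ 0) => h.
  rewrite mul0r (bigD1 k)//= big1 => [|j /negbTE ->]; last by rewrite mul0r mulr0.
  by rewrite /A mxE eqxx !mul1r addr0 normr_le0; apply/eqP; ring.
have dA x : differentiable A x by case: (qA x).
have db t : differentiable b t by apply/derivable1_diffP; case: (hb t).
have dbA x : differentiable (b \o A) x by apply: differentiable_comp.
split=> [//|j]; apply/funext => x.
rewrite /partial (_ : (fun x => _) = b \o A)// deriveE//.
rewrite [X in X _ = _](@diff_comp _ _ _ _ A b)//= deriv1E; last by case: (hb (A x)).
rewrite derive1E -deriveE// -/(partial j A x) (qA x).2.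
by have -> := @derive_val _ _ _ _ _ _ _ (hb (A x)).
Qed.

(** The functions p(1/t) exp(-1/t) for t > 0, extended by 0: a class closed
    under differentiation and containing the standard building block of bumps,
    p = 1. *)
Definition flat (p : {poly R}) (t : R) : R :=
  if 0 < t then p.[t^-1] * expR (- t^-1) else 0.

(** From exp x >= x^(i+2) / (i+2)! with x = 1/t, monomial by monomial. The
    quadratic bound gives the derivative 0 at the origin. *)
Lemma flat_quadratic p : exists2 C, 0 <= C & forall t, `|flat p t| <= C * t ^+ 2.
Proof.
exists (\sum_(i < size p) `|p`_i| * (i.+2)`!%:R).
  by apply: sumr_ge0 => i _; rewrite mulr_ge0.
move=> t; rewrite /flat; case: ltP => [t0|t0]; last first.
  by rewrite normr0 mulr_ge0 ?sqr_ge0//; apply: sumr_ge0 => i _; rewrite mulr_ge0.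
set x := t^-1; have x0 : 0 < x by rewrite invr_gt0.
rewrite horner_coef normrM (ger0_norm (expR_ge0 _)) mulr_suml.
apply: le_trans (ler_wpM2r (expR_ge0 _) (ler_norm_sum _ _ _)) _.
rewrite mulr_suml; apply: ler_sum => i _.
rewrite normrM normrX (ger0_norm (ltW x0)) -!mulrA ler_wpM2l//.
rewrite expRN ler_pdivrMr ?expR_gt0//.
have h : x ^+ i.+2 / (i.+2)`!%:R <= expR x.
  by apply: le_trans (expR_ge1Dxn i.+1 (ltW x0)); rewrite lerDr.
rewrite ler_pdivrMr ?ltr0n ?fact_gt0// in h.
have -> : x ^+ i = x ^+ i.+2 * t ^+ 2.
  by rewrite -addn2 exprD -mulrA -exprMn /x mulVf ?expr1n ?mulr1// gt_eqF.
by rewrite [leRHS]mulrAC ler_wpM2r ?sqr_ge0// [leRHS]mulrC.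
Qed.

(** With x = 1/t, the derivative of p(x) exp(-x) in t is x^2 (p(x) - p^`()(x))
    exp(-x). *)
Definition flatD (p : {poly R}) : {poly R} := 'X^2 * (p - p^`()).

Lemma flat_is_derive (p : {poly R}) (t : R) : is_derive t 1 (flat p) (flat (flatD p) t).
Proof.
have [t0|t0|->] := ltgtP t 0.
- have e : \forall x \near t, (fun=> 0 : R) x = flat p x.
    near=> x; rewrite /flat ifF//; apply/negbTE; rewrite -leNgt ltW//.
    by near: x; exact: lt_nbhsl.
  apply: (near_eq_is_derive e).
  by rewrite /flat ltNge (ltW t0)/=; exact: is_derive_cst.
- have e : \forall x \near t, (fun x : R => p.[x^-1] * expR (- x^-1)) x = flat p x.
    near=> x; rewrite /flat ifT//.
    by near: x; apply: open_nbhs_nbhs; split => //; exact: open_gt.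
  apply: (near_eq_is_derive e).
  rewrite /flat t0.
  have tn0 : t != 0 by rewrite gt_eqF.
  have dV : is_derive t 1 (fun x : R => x^-1) (- t ^- 2).
    have [d1 d2] : is_derive t 1 (id : R -> R) 1 by exact: is_derive_id.
    split; first exact: derivableV.
    by rewrite [LHS](@deriveV _ _ id)// d2 /GRing.scale/= mulr1.
  have hf (s : R) : is_derive s 1 (horner p * (expR \o -%R)) ((p^`() - p).[s] * expR (- s)).
    have h1 : is_derive s 1 (horner p) p^`().[s].
      by split; [exact: derivable_horner|rewrite -derive1E -derivE].
    have h2 : is_derive s 1 (-%R : R -> R) (-1).
      by have := @is_deriveN _ _ _ id s 1 1 (is_derive_id _ _).
    have h3 := is_derive1_comp (is_derive_expR (- s)) h2.
    apply: (is_derive_eq (is_deriveM h1 h3)).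
    by rewrite /GRing.scale/= hornerD hornerN; ring.
  apply: (is_derive_eq (is_derive1_comp (hf t^-1) dV)).
  rewrite /flatD hornerM hornerXn !hornerD !hornerN -exprVn; ring.
- have [C C0 hC] := flat_quadratic p.
  have cL : continuous (\0 : R -> R) by move=> x; exact: cvg_cst.
  have [||df dE] := @quadratic_diff R^o (flat p) (\0 : {linear R^o -> R}) 0 C.
  + exact: cst_continuous.
  + move=> h; rewrite add0r subr0 {2}/flat ltxx subr0.
    by apply: le_trans (hC h) _; rewrite real_normK// num_real.
  split; first exact/derivable1_diffP.
  by rewrite deriveE// dE /flat ltxx.
Unshelve. all: by end_near.
Qed.

Lemma smooth_flat_coord (p : {poly R}) (c s : R) k :
  smooth (fun x : E => flat p (c + s * x ord0 k)).
Proof.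
apply/smoothP => n; elim: n p => //= n IH p.
have [dF pF] := coord_comp_partial s c k (flat_is_derive p).
split=> [//|j]; rewrite pF; apply: CnM; first exact: Cn_cst.
exact: IH.
Qed.

(** Positive exactly on the open unit ball of the sup norm. *)
Definition bump0 (x : E) : R := \prod_k (flat 1 (1 + 1 * x ord0 k) * flat 1 (1 + (-1) * x ord0 k)).

Lemma smooth_bump0 : smooth bump0.
Proof. by apply: smooth_prod => k; apply: smoothM; exact: smooth_flat_coord. Qed.

Lemma flat1_ge0 t : 0 <= flat 1 t.
Proof. by rewrite /flat; case: ifP => // _; rewrite hornerC mul1r expR_ge0. Qed.

Lemma flat1_gt0 t : (0 < flat 1 t) = (0 < t).
Proof. by rewrite /flat; case: ifP => // t0; rewrite ?ltxx// hornerC mul1r expR_gt0. Qed.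

Lemma bump0_ge0 x : 0 <= bump0 x.
Proof. by apply: prodr_ge0 => k _; rewrite mulr_ge0// flat1_ge0. Qed.

Lemma bump0_gt0 x : `|x| < 1 -> 0 < bump0 x.
Proof.
move=> /rV_norm_ltP -/(_ ltr01) h; apply: prodr_gt0 => k _; have := h k.
by rewrite ltr_norml => /andP[h1 h2]; rewrite mulr_gt0// flat1_gt0; lra.
Qed.

Lemma bump0_out x : 1 <= `|x| -> bump0 x = 0.
Proof.
move=> h; apply/eqP; rewrite eq_le bump0_ge0 andbT leNgt; apply/negP => b0.
move: h; rewrite leNgt => /negP; apply.
apply/rV_norm_ltP => // k.
have : flat 1 (1 + 1 * x ord0 k) * flat 1 (1 + (-1) * x ord0 k) != 0.
  apply: contraTneq b0 => e.
  by rewrite /bump0 (bigD1 k)//= e mul0r ltxx.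
rewrite mulf_eq0 negb_or !neq_lt !ltNge !flat1_ge0/= -!ltNge !flat1_gt0.
by rewrite ltr_norml => /andP[h1 h2]; apply/andP; lra.
Qed.

(** Compact support, in the form of an explicit radius. *)
Definition vanish_out r f := forall x : E, r < `|x| -> f x = 0.

Lemma vanish_out_partial r f k : vanish_out r f -> vanish_out r (partial k f).
Proof.
move=> vf x rx; rewrite /partial (@near_eq_derive _ _ _ f (fun=> 0)) ?(derive_cst (0:R))//.
have : \forall y \near x, r < `|y|.
  apply: open_nbhs_nbhs; split; last exact: rx.
  apply: (@open_comp _ _ (fun x : E => `|x|) [set t | r < t]); last exact: open_gt.
  by move=> z _; exact: norm_continuous.
by apply: filterS => y; exact: vf.
Qed.

Lemma vanish_out_bounded r f : continuous f -> vanish_out r f ->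
  exists2 M, 0 <= M & forall x, `|f x| <= M.
Proof.
move=> cf vf.
have cB : compact [set x : E | `|x| <= `|r|].
  apply: bounded_closed_compact.
    exists `|r|; split; first exact: num_real.
    by move=> M rM x /= /le_trans; apply; exact: ltW.
  apply: (@closed_comp _ _ (fun x : E => `|x|) [set t | t <= `|r|]).
    by move=> x _; exact: norm_continuous.
  exact: closed_le.
have [c _ hc] : exists2 c, c \in [set x : E | `|x| <= `|r|] &
    forall t, t \in [set x : E | `|x| <= `|r|] -> `|f t| <= `|f c|.
  apply: (@compact_EVT_max _ R (fun x => `|f x|)) => //.
    by exists 0; rewrite /= normr0.
  apply: continuous_subspaceT => x.
  exact: (continuous_comp (cf x) (@norm_continuous _ _ _)).
exists `|f c| => // x.
have [h|h] := leP `|x| `|r|; first by apply: hc; rewrite inE.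
by rewrite vf ?normr0// (le_lt_trans (ler_norm _) h).
Qed.

Lemma is_derive_line f (x h : E) t : differentiable f (t *: h + x) ->
  is_derive t (1:R) (fun t : R => f (t *: h + x)) ('D_h f (t *: h + x)).
Proof.
move=> df; have dh : derivable f (t *: h + x) h by exact: diff_derivable.
have e : (fun s : R => s^-1 *: (f (s *: h + (t *: h + x)) - f (t *: h + x))) =
   (fun s : R => s^-1 *: ((fun t : R => f (t *: h + x)) (s *: 1 + t) - f (t *: h + x))).
  by apply/funext => s; rewrite /= /GRing.scale/= mulr1 addrA -scalerDl.
split; first by rewrite /derivable -e.
by rewrite /derive -e.
Qed.

Lemma rV_MVT f (x h : E) : (forall x, differentiable f x) ->
  exists2 t : R, 0 < t < 1 & f (x + h) - f x = \sum_k h ord0 k * partial k f (t *: h + x).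
Proof.
move=> df.
have dl t := is_derive_line (df (t *: h + x)).
have cl : {within `[0, 1], continuous (fun t : R => f (t *: h + x))}.
  apply: continuous_subspaceT => t.
  by apply/differentiable_continuous/derivable1_diffP; case: (dl t).
have [t] := @MVT R (fun t => f (t *: h + x)) _ 0 1 ltr01 (fun t _ => dl t) cl.
rewrite in_itv/= scale1r scale0r add0r subr0 mulr1 [h + x]addrC => t01 ->.
by exists t => //; rewrite rV_derive_partial.
Qed.

Lemma rV_lipschitz f (M : R) (x h : E) : (forall x, differentiable f x) ->
  (forall k x, `|partial k f x| <= M) -> `|f (x + h) - f x| <= d%:R * M * `|h|.
Proof.
move=> df hM; have [t _ ->] := rV_MVT x h df.
apply: le_trans (ler_norm_sum _ _ _) _.
apply: (@le_trans _ _ (\sum_(k < d) M * `|h|)).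
  by apply: ler_sum => k _; rewrite normrM mulrC ler_pM// rV_norm_coord.
by rewrite sumr_const card_ord -mulrA mulr_natl.
Qed.

Lemma rV_taylor f (M : R) (x h : E) : smooth f ->
  (forall k j x, `|partial j (partial k f) x| <= M) ->
  `|f (x + h) - f x - \sum_k h ord0 k * partial k f x| <= d%:R * (d%:R * M) * `|h| ^+ 2.
Proof.
move=> sf hM.
have [t /andP[t0 t1] ->] := rV_MVT x h (fun x => smooth_diff x sf).
rewrite -sumrB; apply: le_trans (ler_norm_sum _ _ _) _.
apply: (@le_trans _ _ (\sum_(k < d) `|h| * (d%:R * M * `|h|))).
  apply: ler_sum => k _; rewrite -mulrBr normrM ler_pM// ?rV_norm_coord//.
  rewrite [t *: h + x]addrC; apply: le_trans (rV_lipschitz _ _ _ (hM k)) _.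
    by move=> y; apply: smooth_diff; exact: smooth_partial.
  have dM : 0 <= d%:R * M.
    by rewrite mulr_ge0// (le_trans (normr_ge0 _) (hM k k x)).
  by rewrite normrZ ler_wpM2l// ler_piMl// gtr0_norm// ltW.
rewrite sumr_const card_ord -mulr_natl le_eqVlt; apply/orP; left; apply/eqP; ring.
Qed.

End rV.
End smooth_theory.

(** * Continuity of translations in L^p *)

Section dct.
Context dd (T : measurableType dd) (R : realType) (mu : {measure set T -> \bar R}).

(** Dominated convergence to 0, in the form in which it is used: some term is
    small. *)
Lemma dominated_small (D : set T) (f_ : nat -> T -> R) (g : T -> R) (e : R) : measurable D ->
  (forall n, measurable_fun D (f_ n)) -> measurable_fun D g -> 0 < e ->
  (forall x, D x -> f_ ^~ x @ \oo --> (0 : R)) ->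
  (forall n x, D x -> `|f_ n x| <= g x) ->
  (\int[mu]_(x in D) (g x)%:E < +oo)%E ->
  exists N, forall n, (N <= n)%N -> (\int[mu]_(x in D) (`|f_ n x|)%:E <= e%:E)%E.
Proof.
move=> mD mf mg e0 f0 fg ig.
have intg : mu.-integrable D (EFin \o g).
  apply/integrableP; split; first exact/measurable_EFinP.
  rewrite (eq_integral (EFin \o g)) => [//|x /[!inE] Dx /=].
  by rewrite ger0_norm// (le_trans _ (fg 0%N x Dx)).
have [] := @dominated_convergence _ T R mu D mD (fun n => EFin \o f_ n) (EFin \o cst 0) (EFin \o g).
- by move=> n; exact/measurable_EFinP.
- exact/measurable_EFinP/measurable_cst.
- by apply: aeW => x Dx /=; apply: (cvg_comp _ _ (f0 x Dx)); exact: cvg_refl.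
- exact: intg.
- by apply: aeW => x n Dx /=; rewrite lee_fin fg.
move=> _ + _ => /= h.
have {}h : (\int[mu]_(x in D) (`|f_ n x|)%:E)%E @[n --> \oo] --> 0%E.
  apply: cvg_trans h; apply: near_eq_cvg; near=> n.
  by apply: eq_integral => x _; rewrite subr0.
have /fine_cvgP[hf /cvgrPdist_le hc] := h.
have [N1 _ h1] := hf; have [N2 _ h2] := hc e e0.
exists (maxn N1 N2) => n; rewrite geq_max => /andP[n1 n2].
have := h2 n n2; rewrite /= sub0r normrN => {}h2.
rewrite -[leLHS]fineK; last exact: h1.
by rewrite lee_fin (le_trans (ler_norm _) h2).
Unshelve. all: by end_near.
Qed.

End dct.

Section translation.
Context {R : realType} {d : nat}.
Local Notation E := 'rV[R]_d.
Local Notation mu := (lebesgue_rV R d).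
Variable p : nat.

Definition Npow (f : E -> R) : \bar R := (\int[mu]_x (`|f x| ^+ p)%:E)%E.

Lemma Npow_ge0 f : (0 <= Npow f)%E.
Proof. by apply: integral_ge0 => x _; rewrite lee_fin exprn_ge0. Qed.

Lemma measurable_Npow (f : E -> R) : measurable_fun setT f ->
  measurable_fun setT (fun x => (`|f x| ^+ p)%:E).
Proof.
by move=> mf; apply/measurable_EFinP; apply: measurable_funX; exact: measurableT_comp.
Qed.

Lemma powD_le (a b : R) : `|a + b| ^+ p <= 2 ^+ p * (`|a| ^+ p + `|b| ^+ p).
Proof.
have h (u v : R) : 0 <= u -> u <= v -> (u + v) ^+ p <= 2 ^+ p * (u ^+ p + v ^+ p).
  move=> u0 uv; have v0 := le_trans u0 uv.
  apply: (@le_trans _ _ ((2 * v) ^+ p)).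
    by rewrite lerXn2r ?nnegrE ?addr_ge0 ?mulr_ge0//; lra.
  by rewrite exprMn ler_wpM2l ?exprn_ge0// lerDr exprn_ge0.
apply: (@le_trans _ _ ((`|a| + `|b|) ^+ p)).
  by rewrite lerXn2r ?nnegrE ?addr_ge0// ler_normD.
have [ab|/ltW ab] := leP `|a| `|b|; first exact: h.
by rewrite addrC [X in _ * X]addrC; exact: h.
Qed.

Lemma le_Npow (f g : E -> R) : measurable_fun setT f -> measurable_fun setT g ->
  (forall x, `|f x| <= `|g x|) -> (Npow f <= Npow g)%E.
Proof.
move=> mf mg fg; apply: ge0_le_integral => //; try exact: measurable_Npow.
by move=> x _; rewrite lee_fin lerXn2r ?nnegrE.
Qed.

Lemma NpowD (f g : E -> R) : measurable_fun setT f -> measurable_fun setT g ->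
  (Npow (f \+ g)%R <= (2 ^+ p)%:E * (Npow f + Npow g))%E.
Proof.
move=> mf mg; have mF := measurable_Npow mf; have mG := measurable_Npow mg.
rewrite -ge0_integralD// -ge0_integralZl_EFin ?exprn_ge0//; last 2 first.
- by move=> x _; rewrite adde_ge0// lee_fin exprn_ge0.
- exact: emeasurable_funD.
apply: ge0_le_integral => //.
- by apply: measurable_Npow; exact: measurable_funD.
- by apply: measurable_funeM; apply: emeasurable_funD.
- by move=> x _; rewrite -EFinD -EFinM lee_fin powD_le.
Qed.

Lemma NpowZ a (f : E -> R) : measurable_fun setT f ->
  (Npow (fun x => a * f x)%R = (`|a| ^+ p)%:E * Npow f)%E.
Proof.
move=> mf; have mF := measurable_Npow mf.
rewrite -ge0_integralZl_EFin ?exprn_ge0//.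
by apply: eq_integral => x _; rewrite -EFinM normrM exprMn.
Qed.

Lemma Npow_shift (f : E -> R) z : measurable_fun setT f -> Npow (fun x => f (x + z)) = Npow f.
Proof.
move=> mf; apply: (ge0_integral_rV_shift z (measurable_Npow mf)) => x.
by rewrite lee_fin exprn_ge0.
Qed.

Lemma measurable_shift (f : E -> R) (z : E) : measurable_fun setT f ->
  measurable_fun setT (fun x : E => f (x + z)).
Proof. by move=> mf; apply: (measurableT_comp mf); exact: measurable_rV_shift. Qed.

(** Continuity of translations at f in L^p; the p-th power of the norm avoids
    roots. *)
Definition tcont (f : E -> R) := forall e : R, 0 < e -> exists2 r : R, 0 < r &
  forall z : E, `|z| < r -> (Npow (fun x => f (x + z) - f x)%R <= e%:E)%E.

(** f lies in the L^p closure of the class P. *)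
Definition approxL (P : (E -> R) -> Prop) (f : E -> R) := forall e : R, 0 < e ->
  exists g, [/\ P g, measurable_fun setT g & (Npow (fun x => f x - g x)%R <= e%:E)%E].

(** Translation is an isometry, so f inherits the property from a good
    approximation g: compare f(x+z) with g(x+z), then g(x), then f(x). *)
Lemma tcont_approx (f : E -> R) : measurable_fun setT f -> approxL tcont f -> tcont f.
Proof.
move=> mf af e e0.
pose c : R := 2 ^+ p; have c1 : 1 <= c by rewrite exprn_ege1// ler1n.
have c0 : 0 < c by rewrite (lt_le_trans _ c1).
pose e' := e / (c * c * 3).
have e'0 : 0 < e' by rewrite divr_gt0// !mulr_gt0.
have [g [tg mg fg]] := af e' e'0.
have [r r0 hr] := tg e' e'0; exists r => // z zr.
pose F x := f x - g x.
have mF : measurable_fun setT F by exact: measurable_funB.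
have mN : measurable_fun setT (fun x => - F x) by exact: measurableT_comp.
have mFz := measurable_shift z mF; have mgz := measurable_shift z mg.
have -> : (fun x => f (x + z) - f x) = (fun x => F (x + z)) \+ ((fun x => g (x + z) - g x) \+ (fun x => - F x)).
  by apply/funext => x; rewrite /F /=; ring.
apply: le_trans (NpowD mFz _) _.
  by apply: measurable_funD => //; exact: measurable_funB.
rewrite Npow_shift//.
have h2 : (Npow ((fun x => g (x + z) - g x) \+ (fun x => - F x))%R <= (c * (e' + e'))%:E)%E.
  apply: le_trans (NpowD _ mN) _; first exact: measurable_funB.
  rewrite EFinM lee_wpmul2l ?lee_fin ?(ltW c0)// EFinD leeD//; first exact: hr.
  rewrite (_ : Npow _ = Npow F)//.
  by apply: eq_integral => x _; rewrite normrN.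
apply: (@le_trans _ _ (c%:E * (e'%:E + (c * (e' + e'))%:E))%E).
  by rewrite lee_wpmul2l ?lee_fin ?(ltW c0)// leeD.
have he : e = c * (e' * c + c * (e' + e')) by rewrite /e'; field; rewrite gt_eqF.
rewrite -EFinD -EFinM lee_fin [leRHS]he.
by rewrite ler_wpM2l ?(ltW c0)// lerD2r ler_peMr// ltW.
Qed.

Lemma tcontD (f g : E -> R) : measurable_fun setT f -> measurable_fun setT g ->
  tcont f -> tcont g -> tcont (fun x => f x + g x).
Proof.
move=> mf mg tf tg e e0; pose c : R := 2 ^+ p.
have c0 : 0 < c by rewrite exprn_gt0.
pose e' := e / (c * 2); have e'0 : 0 < e' by rewrite divr_gt0// !mulr_gt0.
have [r r0 hr] := tf e' e'0; have [s s0 hs] := tg e' e'0.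
exists (Num.min r s); first by rewrite lt_min r0.
move=> z; rewrite lt_min => /andP[zr zs].
have -> : (fun x => f (x + z) + g (x + z) - (f x + g x)) = (fun x => f (x + z) - f x) \+ (fun x => g (x + z) - g x).
  by apply/funext => x /=; ring.
have mfz := measurable_shift z mf; have mgz := measurable_shift z mg.
apply: le_trans (NpowD _ _) _; [exact: measurable_funB|exact: measurable_funB|].
apply: (@le_trans _ _ (c%:E * (e'%:E + e'%:E))%E).
  by rewrite lee_wpmul2l ?lee_fin ?(ltW c0)// leeD// ?hr ?hs.
rewrite -EFinD -EFinM lee_fin /e' le_eqVlt; apply/orP; left; apply/eqP.
by field; rewrite gt_eqF.
Qed.

Lemma tcontZ a (f : E -> R) : measurable_fun setT f -> tcont f -> tcont (fun x => a * f x).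
Proof.
move=> mf tf e e0; pose c : R := `|a| ^+ p + 1.
have c0 : 0 < c by rewrite ltr_wpDl// exprn_ge0.
have [r r0 hr] := tf (e / c) (divr_gt0 e0 c0).
exists r => // z zr.
under eq_fun do rewrite -mulrBr.
have mfz := measurable_shift z mf.
rewrite NpowZ; last exact: measurable_funB.
apply: (@le_trans _ _ (c%:E * (e / c)%:E)%E).
  by rewrite lee_pmul ?Npow_ge0 ?hr// lee_fin ?exprn_ge0// lerDl.
by rewrite -EFinM mulrC divfK// gt_eqF.
Qed.

Lemma tcont0 : (0 < p)%N -> tcont (fun=> 0).
Proof.
move=> p0 e e0; exists 1 => // z _; rewrite /Npow integral0_eq ?lee_fin ?ltW// => x _.
by rewrite subr0 normr0 expr0n gtn_eqF.
Qed.

Lemma tcont_sum (I : Type) (s : seq I) (F : I -> E -> R) : (0 < p)%N ->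
  (forall i, measurable_fun setT (F i)) -> (forall i, tcont (F i)) ->
  tcont (fun x => \sum_(i <- s) F i x).
Proof.
move=> p0 mF tF; elim: s => [|i s IH].
  by under eq_fun do rewrite big_nil; exact: tcont0.
under eq_fun do rewrite big_cons; apply: tcontD => //.
exact: measurable_sum.
Qed.

Hypothesis p_gt0 : (0 < p)%N.

(** If x is in U, so is x + z for small z; dominated convergence along a
    hypothetical sequence of bad translations. The symmetric difference of U
    and its translate consists of two parts that are translates of each other
    up to the sign of z. *)
Lemma tcont_open (U : set E) : open U -> (mu U < +oo)%E -> tcont (\1_U : E -> R).
Proof.
move=> oU fU.
have mU : measurable U by exact: open_rV_measurable.
have m1 : measurable_fun setT (\1_U : E -> R) by exact: measurable_indic.
(* The indicator function of the points of U that leave U when translated by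
   z. *)
pose G z x : R := \1_U x * (1 - \1_U (x + z)).
have mG z : measurable_fun setT (G z).
  apply: measurable_funM => //; apply: measurable_funB => //.
  exact: measurable_shift.
have G0 z x : 0 <= G z x.
  by rewrite /G !indicE; do 2 case: (_ \in _); rewrite ?subrr ?mul0r ?mulr0// subr0 mulr1.
have cG e : 0 < e -> exists2 r : R, 0 < r & forall z : E, `|z| < r -> (\int[mu]_x (G z x)%:E <= e%:E)%E.
  move=> e0; apply: contrapT => /forall2NP h.
  have /choice[z hz] m : exists z : E, `|z| < m.+1%:R^-1 /\ ~ (\int[mu]_x (G z x)%:E <= e%:E)%E.
    have [|] := h (m.+1%:R^-1); first by rewrite invr_gt0.
    by move=> /existsNP[z /not_implyP[zr hz]]; exists z.
  have [|||N hN] := @dominated_small _ _ R mu setT (fun m => G (z m)) (\1_U) e measurableT (fun m => mG (z m)) m1 e0.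
  - move=> x _; have [xU|xU] := pselect (U x); last first.
      apply: cvg_near_cst; apply: nearW => m.
      by rewrite /G indicE memNset// mul0r.
    have /nbhs_ballP[r /= r0 rU] := open_nbhs_nbhs (conj oU xU).
    apply: cvg_near_cst; near=> m.
    rewrite /G [X in 1 - X]indicE mem_set ?subrr ?mulr0//; apply: rU.
    rewrite -ball_normE /ball_ /= opprD addNKr normrN.
    apply: lt_trans (hz m).1 _.
    by near: m; exact: near_infty_natSinv_lt (PosNum r0).
  - move=> m x _; rewrite ger0_norm// /G indicE.
    by case: (x \in U); rewrite ?mul0r// mul1r gerBl indicE.
  - by rewrite integral_indic// setIT.
  - apply: (hz N).2; apply: le_trans (hN N (leqnn _)).
    by under [leRHS]eq_integral => x _ do rewrite ger0_norm//.
move=> e e0; have e2 : 0 < e / 2 by rewrite divr_gt0.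
have [r r0 hr] := cG (e / 2) e2.
exists r => // z zr.
have -> : Npow (fun x => \1_U (x + z) - \1_U x) = (\int[mu]_x ((G z x)%:E + (G (- z) (x + z))%:E))%E.
  apply: eq_integral => x _; rewrite -EFinD; congr (_%:E).
  (* |1_U(x+z) - 1_U(x)| is 1 when x leaves U, or when x + z leaves U under
     the translation by -z. *)
  rewrite /G addrK !indicE; case: (x \in U); case: (_ \in U);
  by rewrite ?subrr ?mul0r ?mulr0 ?sub0r ?subr0 ?normrN ?normr1 ?normr0 ?expr1n ?mulr1 ?addr0 ?add0r// expr0n gtn_eqF.
rewrite ge0_integralD//; last 4 first.
- by move=> x _; rewrite lee_fin.
- exact/measurable_EFinP.
- by move=> x _; rewrite lee_fin.
- by apply/measurable_EFinP; exact: (measurable_shift z (mG (- z))).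
rewrite (ge0_integral_rV_shift z (f := EFin \o G (- z))); last 2 first.
- exact/measurable_EFinP.
- by move=> x; rewrite lee_fin.
by rewrite [e]splitr EFinD leeD ?hr// normrN.
Unshelve. all: by end_near.
Qed.

(** The sigma-algebra is generated by the coordinates, which are continuous. *)
Lemma rV_measurable_open_gen (A : set E) : measurable A -> <<s open : set (set E) >> A.
Proof.
pose T := g_sigma_algebraType (open : set (set E)).
have mc i : measurable_fun [set: T] (fun x : T => (x : E) ord0 i : R).
  apply: (measurability _ (RGenOpens.measurableE R)).
  move=> _ [_ [a [b ->] <-]]; rewrite setTI; apply: sub_sigma_algebra.
  have /continuousP := @coord_continuous R 1 d ord0 i; apply.
  exact: interval_open.
suff : g_sigma_preimage (@rV_coord R d) `<=` <<s open : set (set E) >> by exact.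
apply: smallest_sub; first exact: smallest_sigma_algebra.
move=> B; rewrite -bigcup_seq/= => -[i _ [C mC <-]].
exact: (mc i measurableT C mC).
Qed.

Lemma mu_ball_lty (n : R) : (mu (ball (0 : E)%R n) < +oo)%E.
Proof.
have [n0|n0] := ltP 0 n; first by rewrite lebesgue_rV_ball// ltry.
rewrite (_ : ball _ _ = set0) ?measure0//; apply/seteqP; split => // y.
by rewrite -ball_normE /ball_ /= => /(le_lt_trans (normr_ge0 _)); rewrite ltNge n0.
Qed.

(** The sets with this property form a Dynkin system containing the open sets,
    which are stable under intersection. Intersecting with balls keeps all
    measures finite. *)
Lemma tcont_measurable (A : set E) (r : R) : measurable A ->
  tcont (\1_(A `&` ball 0 r) : E -> R).
Proof.
pose H := [set A : set E | measurable A /\ forall r : R, tcont (\1_(A `&` ball 0 r) : E -> R)].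
suff : <<s open : set (set E) >> `<=` H.
  by move=> h /rV_measurable_open_gen/h[_ /(_ r)].
have fin (B : set E) (s : R) : measurable B -> (mu (B `&` ball (0 : E)%R s) < +oo)%E.
  move=> mB; apply: le_lt_trans (mu_ball_lty s); apply: le_measure; rewrite ?inE//.
  - by apply: measurableI => //; exact: measurable_rV_ball.
  - exact: measurable_rV_ball.
have mI (B : set E) (s : R) : measurable B -> measurable_fun setT (\1_(B `&` ball (0 : E) s) : E -> R).
  by move=> mB; apply: measurable_indic; apply: measurableI => //; exact: measurable_rV_ball.
rewrite -setI_closed_g_dynkin_g_sigma_algebra; last by move=> B C oB oC; exact: openI.
apply: smallest_sub; last first.
  move=> U oU; split=> [|s]; first exact: open_rV_measurable.
  apply: tcont_open; first by apply: openI => //; exact: ball_open.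
  by apply: fin; exact: open_rV_measurable.
split.
- split=> // s; apply: tcont_open; rewrite setTI; last exact: mu_ball_lty.
  exact: ball_open.
- move=> B [mB tB]; split=> [|s]; first exact: measurableC.
  have -> : (\1_(~` B `&` ball 0 s) : E -> R) = fun x => \1_(setT `&` ball 0 s) x + (-1) * \1_(B `&` ball 0 s) x.
    apply/funext => x; move: (ball _ _) => K; rewrite !indicE setTI !in_setI in_setC.
    by case: (x \in B); case: (x \in _) => /=; rewrite ?mulr0 ?mulN1r ?addr0 ?subrr ?oppr0 ?addr0.
  apply: tcontD; [exact: mI| |  |].
  + by apply: measurable_funM => //; exact: mI.
  + apply: tcont_open; rewrite setTI; last exact: mu_ball_lty.
    exact: ball_open.
  + by apply: tcontZ => //; exact: mI.
- move=> F tF HF; split=> [|s]; first by apply: bigcup_measurable => k _; case: (HF k).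
  set A0 := \bigcup_k F k.
  have mA0 : measurable A0 by apply: bigcup_measurable => k _; case: (HF k).
  apply: tcont_approx; first exact: mI.
  move=> e e0.
  pose g N (x : E) : R := \sum_(k <- iota 0 N) \1_(F k `&` ball 0 s) x.
  have mg N : measurable_fun setT (g N).
    by apply: measurable_sum => k; apply: mI; case: (HF k).
  have gE N x k : F k x -> g N x = (k < N)%N%:R * \1_(ball 0 s) x.
    move=> Fkx; rewrite /g.
    have E0 j : j != k -> \1_(F j `&` ball 0 s) x = 0 :> R.
      move=> jk; rewrite indicE memNset// => -[Fjx _].
      by move/eqP: jk; apply; apply: tF => //; exists x.
    have [kN|kN] := ltnP k N.
      rewrite (bigD1_seq k) ?mem_iota ?iota_uniq//= big1 ?addr0 ?mul1r => [|j]; last exact: E0.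
      by move: (ball _ _) => K; rewrite !indicE in_setI (mem_set Fkx).
    rewrite mul0r big1_seq// => j; rewrite mem_iota add0n => /= jN.
    by apply: E0; rewrite ltn_eqF// (leq_trans jN).
  pose D N (x : E) : R := `|\1_(A0 `&` ball 0 s) x - g N x| ^+ p.
  have mD N : measurable_fun setT (D N).
    apply: measurable_funX; apply: measurableT_comp => //; apply: measurable_funB => //; exact: mI.
  have m1 : measurable_fun setT (\1_(ball 0 s) : E -> R) by rewrite -[ball _ _]setTI; exact: mI.
  have notA N x : ~ A0 x -> g N x = 0.
    move=> nA; rewrite /g big1// => k _; rewrite indicE memNset// => -[Fk _].
    by apply: nA; exists k.
  have [|||N hN] := @dominated_small _ _ R mu setT D (\1_(ball 0 s)) e measurableT mD m1 e0.
  + move=> x _; have [[k _ Fk]|nA] := pselect (A0 x).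
      apply: cvg_near_cst; near=> N.
      rewrite /D (gE N x k Fk).
      have -> : (k < N)%N by near: N; exact: nbhs_infty_gt.
      move: (ball _ _) => K; rewrite indicE in_setI mem_set/=; last by exists k.
      by rewrite indicE mul1r subrr normr0 expr0n gtn_eqF.
    apply: cvg_near_cst; apply: nearW => N.
    rewrite /D notA// indicE memNset ?subrr ?normr0 ?expr0n ?gtn_eqF//.
    by case.
  + move=> N x _; rewrite ger0_norm ?exprn_ge0// /D.
    have [[k _ Fk]|nA] := pselect (A0 x).
      rewrite (gE N x k Fk); move: (ball _ _) => K; rewrite !indicE in_setI mem_set/=; last by exists k.
      case: (x \in _); case: (k < N)%N;
      by rewrite ?mulr1 ?mulr0 ?subrr ?subr0 ?normr0 ?normr1 ?expr1n ?expr0n ?gtn_eqF.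
    rewrite notA// !indicE memNset/=; last by case.
    by rewrite subrr normr0 expr0n gtn_eqF.
  + by rewrite integral_indic ?setIT//; [exact: mu_ball_lty|exact: measurable_rV_ball].
  exists (g N); split=> //.
    apply: tcont_sum => // k; first by apply: mI; case: (HF k).
    by case: (HF k).
  apply: le_trans (hN N (leqnn N)).
  by under [leRHS]eq_integral => x _ do rewrite ger0_norm ?exprn_ge0//.
Unshelve. all: by end_near.
Qed.

Import HBNNSimple.

Lemma tcont_nnsfun (g : {nnsfun E >-> R}) (r : R) :
  tcont (fun x => g x * \1_(ball 0 r) x).
Proof.
have mB y : measurable (g @^-1` [set y]).
  by rewrite -[X in measurable X]setTI; exact: measurable_funP.
have mI y : measurable_fun setT (\1_(g @^-1` [set y] `&` ball 0 r) : E -> R).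
  by apply: measurable_indic; apply: measurableI => //; exact: measurable_rV_ball.
have -> : (fun x => g x * \1_(ball 0 r) x) =
    fun x => \sum_(y <- finmap.enum_fset (fset_set (range g))) y * \1_(g @^-1` [set y] `&` ball 0 r) x.
  apply/funext => x; rewrite {1}(fimfunE g) fsbig_finite/=; last exact: fimfunP.
  rewrite mulr_suml; apply: eq_bigr => y _.
  by move: (ball _ _) => K; rewrite -mulrA !indicE in_setI; case: (x \in _); case: (x \in _); rewrite /= ?mulr1 ?mulr0.
apply: tcont_sum => // y; first by apply: measurable_funM => //; exact: mI.
by apply: tcontZ => //; exact: tcont_measurable.
Qed.

Lemma tcont_ge0 (f : E -> R) : measurable_fun setT f -> (forall x, 0 <= f x) ->
  (Npow f < +oo)%E -> tcont f.
Proof.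
move=> mf f0 Nf.
have mf' : measurable_fun setT (EFin \o f) by exact/measurable_EFinP.
pose g := nnsfun_approx measurableT mf'.
have gc x : (fun n => g n x) @ \oo --> f x.
  have := cvg_nnsfun_approx measurableT mf' (fun x _ => f0 x) (I : setT x).
  by move=> /fine_cvgP[_]; exact.
have gle n x : g n x <= f x.
  have := @le_approx _ _ R setT (EFin \o f) n x (fun x _ => f0 x) I.
  by rewrite lee_fin /g nnsfun_approxE.
pose h n x := g n x * \1_(ball 0 n%:R) x.
have mh n : measurable_fun setT (h n).
  apply: measurable_funM; first exact: measurable_funP.
  by apply: measurable_indic; exact: measurable_rV_ball.
have hf n x : `|f x - h n x| <= f x.
  rewrite /h indicE; case: (_ \in _); rewrite ?mulr1 ?mulr0 ?subr0 ?ger0_norm// ?subr_ge0//.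
  by rewrite gerBl; exact: fun_ge0.
apply: tcont_approx => // e e0.
have [|||||N hN] := @dominated_small _ _ R mu setT (fun n x => `|f x - h n x| ^+ p) (fun x => `|f x| ^+ p) e measurableT _ _ e0.
- by move=> n; apply: measurable_funX; apply: measurableT_comp => //; exact: measurable_funB.
- by apply: measurable_funX; exact: measurableT_comp.
- move=> x _.
  have hx : (fun n => h n x) @ \oo --> f x.
    apply: cvg_trans (gc x); apply: near_eq_cvg; near=> n.
    rewrite /h indicE mem_set ?mulr1//.
    rewrite -ball_normE /ball_ /= sub0r normrN.
    by near: n; exact: nbhs_infty_gtr.
  have h1 : (fun n => `|f x - h n x|) @ \oo --> (0 : R).
    rewrite -(normr0 R) -(subrr (f x)).
    by apply: cvg_norm; apply: cvgB => //; exact: cvg_cst.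
  have -> : 0 = (0 : R) ^+ p by rewrite expr0n gtn_eqF.
  apply: (@cvg_comp _ _ _ (fun n => `|f x - h n x|) (fun t : R => t ^+ p) _ _ _ h1).
  exact: exprn_continuous.
- move=> n x _; rewrite ger0_norm ?exprn_ge0// lerXn2r ?nnegrE//.
  by rewrite (le_trans (hf n x))// ler_norm.
- exact: Nf.
exists (h N); split=> //; first exact: tcont_nnsfun.
apply: le_trans (hN N (leqnn N)).
by under [leRHS]eq_integral => x _ do rewrite ger0_norm ?exprn_ge0//.
Unshelve. all: by end_near.
Qed.

(** The last rung of the usual ladder: simple functions (tcont_nnsfun),
    nonnegative functions by monotone approximation on balls (tcont_ge0),
    positive and negative parts. *)
Lemma tcont_Lp (f : E -> R) : measurable_fun setT f -> (Npow f < +oo)%E -> tcont f.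
Proof.
move=> mf Nf.
pose fp x := Num.max (f x) 0; pose fn x := Num.max (- f x) 0.
have -> : f = fun x => fp x + (-1) * fn x.
  by apply/funext => x; rewrite mulN1r /fp /fn; case: (leP (f x) 0) => h; case: leP => h'; lra.
have mp : measurable_fun setT fp by exact: measurable_maxr.
have mn : measurable_fun setT fn by apply: measurable_maxr => //; exact: measurableT_comp.
apply: tcontD => //; first exact: measurable_funM.
  apply: tcont_ge0 => // [x|]; first by rewrite /fp le_max lexx orbT.
  apply: le_lt_trans Nf; apply: le_Npow => // x.
  by rewrite /fp ger0_norm ?le_max ?lexx ?orbT// ge_max ler_norm normr_ge0.
apply: tcontZ => //; apply: tcont_ge0 => // [x|]; first by rewrite /fn le_max lexx orbT.
apply: le_lt_trans Nf; apply: le_Npow => // x.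
by rewrite /fn ger0_norm ?le_max ?lexx ?orbT// ge_max -normrN ler_norm normr_ge0.
Qed.

End translation.

(** * Convolution and mollifiers *)

Section convolution.
Context {R : realType} {d : nat}.
Local Notation E := 'rV[R]_d.
Local Notation mu := (lebesgue_rV R d).
Implicit Types f g h w : E -> R.

Definition intg f := mu.-integrable setT (EFin \o f).

Lemma intg_meas f : intg f -> measurable_fun setT f.
Proof. by move=> /integrableP[/measurable_EFinP]. Qed.

Lemma intg_lty f : measurable_fun setT f -> (\int[mu]_x `|f x|%:E < +oo)%E -> intg f.
Proof. by move=> mf fi; apply/integrableP; split; [exact/measurable_EFinP|exact: fi]. Qed.

Lemma intgD f g : intg f -> intg g -> intg (fun x => f x + g x).
Proof. by move=> If Ig; exact: (integrableD measurableT If Ig). Qed.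

Lemma intgZ a f : intg f -> intg (fun x => a * f x).
Proof. by move=> If; exact: (integrableZl measurableT a If). Qed.

Lemma intgN f : intg f -> intg (fun x => - f x).
Proof. by move=> If; exact: (integrableN If). Qed.

Lemma intgB f g : intg f -> intg g -> intg (fun x => f x - g x).
Proof. by move=> If Ig; apply: intgD => //; exact: intgN. Qed.

Lemma intg0 : intg (fun=> 0).
Proof. by rewrite /intg (_ : _ \o _ = cst 0%E)//; exact: integrable0. Qed.

Lemma intg_sum (I : Type) (s : seq I) (F : I -> E -> R) :
  (forall i, intg (F i)) -> intg (fun x => \sum_(i <- s) F i x).
Proof.
move=> IF; elim: s => [|i s IH].
  by under eq_fun do rewrite big_nil; exact: intg0.
by under eq_fun do rewrite big_cons; apply: intgD.
Qed.

Lemma le_intg f g : measurable_fun setT f -> (forall x, `|f x| <= g x) -> intg g -> intg f.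
Proof.
move=> mf fg Ig; apply: (le_integrable measurableT _ _ Ig); first exact/measurable_EFinP.
by move=> x _ /=; rewrite lee_fin (le_trans (fg x))// ler_norm.
Qed.

Lemma intg_norm f : intg f -> intg (fun x => `|f x|).
Proof. by move=> If; exact: (integrable_norm If). Qed.

Lemma intgM_bounded f g (M : R) : intg f -> measurable_fun setT g ->
  (forall x, `|g x| <= M) -> intg (fun x => f x * g x).
Proof.
move=> If mg gM; apply: (@le_intg _ (fun x => M * `|f x|)).
- by apply: measurable_funM => //; exact: intg_meas.
- by move=> x; rewrite normrM mulrC ler_wpM2r.
- by apply: intgZ; exact: intg_norm.
Qed.

Lemma RintD f g : intg f -> intg g ->
  \int[mu]_x (f x + g x) = \int[mu]_x f x + \int[mu]_x g x.
Proof. by move=> If Ig; exact: RintegralD. Qed.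

Lemma RintB f g : intg f -> intg g ->
  \int[mu]_x (f x - g x) = \int[mu]_x f x - \int[mu]_x g x.
Proof. by move=> If Ig; exact: RintegralB. Qed.

Lemma RintZ a f : intg f -> \int[mu]_x (a * f x) = a * \int[mu]_x f x.
Proof. by move=> If; exact: RintegralZl. Qed.

Lemma RintN f : intg f -> \int[mu]_x (- f x) = - \int[mu]_x f x.
Proof.
move=> If; rewrite -mulN1r -RintZ//; apply: eq_Rintegral => x _.
by rewrite mulN1r.
Qed.

Lemma Rint0 : \int[mu]_x (0 : R) = 0.
Proof. by rewrite /Rintegral integral0. Qed.

Lemma Rint_sum (I : Type) (s : seq I) (F : I -> E -> R) : (forall i, intg (F i)) ->
  \int[mu]_x (\sum_(i <- s) F i x) = \sum_(i <- s) \int[mu]_x F i x.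
Proof.
move=> IF; elim: s => [|i s IH].
  by rewrite big_nil -[RHS]Rint0; apply: eq_Rintegral => x _; rewrite big_nil.
rewrite big_cons -IH -RintD//; last exact: intg_sum.
by apply: eq_Rintegral => x _; rewrite big_cons.
Qed.

Lemma le_Rint f g : intg f -> intg g -> (forall x, f x <= g x) ->
  \int[mu]_x f x <= \int[mu]_x g x.
Proof. by move=> If Ig fg; apply: le_Rintegral. Qed.

Lemma le_norm_Rint f g : measurable_fun setT f -> intg g -> (forall x, `|f x| <= g x) ->
  `|\int[mu]_x f x| <= \int[mu]_x g x.
Proof.
move=> mf Ig fg; have If := le_intg mf fg Ig.
apply: le_trans (le_normr_Rintegral measurableT If) _.
by apply: le_Rint => //; exact: intg_norm.
Qed.

Lemma intg_bounded f (M r : R) : measurable_fun setT f -> vanish_out r f ->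
  (forall x, `|f x| <= M) -> intg f.
Proof.
move=> mf vf fM; apply: (@le_intg _ (fun x => M * \1_(ball 0 (`|r| + 1)) x)) => //.
  move=> x; rewrite indicE; have [h|h] := boolP (x \in _); first by rewrite mulr1.
  rewrite mulr0 vf ?normr0//; move: h; rewrite notin_setE -ball_normE /ball_ /= sub0r normrN.
  by move=> /negP; rewrite -leNgt; apply: lt_le_trans; rewrite (le_lt_trans (ler_norm r))// ltrDl.
apply: intgZ; apply: intg_lty.
  by apply: measurable_indic; exact: measurable_rV_ball.
under eq_integral => x _ do rewrite ger0_norm//.
rewrite integral_indic//; last exact: measurable_rV_ball.
by rewrite setIT; exact: mu_ball_lty.
Qed.

Lemma intg_EFin f : intg f -> (forall x, 0 <= f x) ->
  ((\int[mu]_x f x)%R%:E = \int[mu]_x (f x)%:E)%E.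
Proof.
move=> If f0; rewrite /Rintegral fineK//; exact: (integrable_fin_num measurableT If).
Qed.

Lemma intg_shift f z : intg f -> intg (fun x => f (x + z)).
Proof.
move=> If; have mf := intg_meas If; apply: intg_lty; first exact: measurable_shift.
rewrite (ge0_integral_rV_shift z (f := fun x => `|f x|%:E)).
- by move/integrableP : If => [].
- by apply/measurable_EFinP; exact: measurableT_comp.
- by move=> x; rewrite lee_fin.
Qed.

(** The kernel is evaluated at y - x instead of x - y: no reflection is
    needed, only invariance under translation. The price is the sign in
    partial_conv. *)
Definition conv f w (x : E) : R := \int[mu]_y (f y * w (y - x)).

(** Smooth functions with bounded support, the kernels and cutoffs of this
    development. *)
Definition cutoffable w := smooth w /\ exists r, vanish_out r w.

Lemma cutoffable_partial k w : cutoffable w -> cutoffable (partial k w).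
Proof.
by move=> [sw [r vw]]; split; [exact: smooth_partial|exists r; exact: vanish_out_partial].
Qed.

Lemma cutoffable_bounded w : cutoffable w -> exists2 M, 0 <= M & forall x, `|w x| <= M.
Proof. by move=> [sw [r vw]]; apply: vanish_out_bounded vw; exact: smooth_cont. Qed.

Lemma smooth_meas w : smooth w -> measurable_fun setT w.
Proof. by move=> sw; apply: continuous_rV_measurable; exact: smooth_cont. Qed.

Lemma cutoffable_intg w : cutoffable w -> intg w.
Proof.
move=> cw; have [M _ hM] := cutoffable_bounded cw; case: cw => sw [r vw].
exact: (intg_bounded (smooth_meas sw) vw hM).
Qed.

Lemma conv_intg f w x : intg f -> cutoffable w -> intg (fun y => f y * w (y - x)).
Proof.
move=> If cw; have [M _ hM] := cutoffable_bounded cw.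
apply: (intgM_bounded (M := M)) => //.
by apply: measurable_shift; apply: smooth_meas; case: cw.
Qed.

(** The Taylor bound on the kernel, uniform because its second derivatives are
    bounded, is integrated against f. *)
Lemma conv_diff f w x : intg f -> cutoffable w ->
  differentiable (conv f w) x /\ forall k, partial k (conv f w) x = - conv f (partial k w) x.
Proof.
move=> If cw.
have [M hM] : exists M : R, forall k j x, `|partial j (partial k w) x| <= M.
  have /choice[B hB] : forall kj : 'I_d * 'I_d, exists M, 0 <= M /\ forall x, `|partial kj.2 (partial kj.1 w) x| <= M.
    move=> [k j]; have [M M0 hM] := cutoffable_bounded (cutoffable_partial j (cutoffable_partial k cw)).
    by exists M.
  exists (\sum_kj B kj) => k j y; apply: (le_trans ((hB (k, j)).2 y)).
  by rewrite (bigD1 (k, j))//= lerDl sumr_ge0// => kj _; case: (hB kj).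
apply: (@rV_quadratic_partial _ _ _ _ _ (\int[mu]_y `|f y| * (d%:R * (d%:R * M)))) => h.
have Iw z : intg (fun y => f y * w (y - z)) by exact: conv_intg.
have Ip k : intg (fun y => f y * partial k w (y - x)) by apply: conv_intg => //; exact: cutoffable_partial.
rewrite /conv -RintB//.
rewrite (_ : \sum_k _ = \int[mu]_y (\sum_k h ord0 k * - (f y * partial k w (y - x)))); last first.
  rewrite Rint_sum => [|k]; last by apply: intgZ; exact: intgN.
  by apply: eq_bigr => k _; rewrite RintZ ?RintN//; exact: intgN.
have Is : intg (fun y => \sum_k h ord0 k * - (f y * partial k w (y - x))).
  by apply: intg_sum => k; apply: intgZ; exact: intgN.
rewrite -RintB//; last exact: intgB.
apply: (@le_trans _ _ (\int[mu]_y ((d%:R * (d%:R * M) * `|h| ^+ 2) * `|f y|))).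
  apply: le_norm_Rint.
  - by apply: intg_meas; apply: intgB => //; exact: intgB.
  - by apply: intgZ; exact: intg_norm.
  move=> y.
  have -> : f y * w (y - (x + h)) - f y * w (y - x) - \sum_k h ord0 k * - (f y * partial k w (y - x)) =
     f y * (w ((y - x) + (- h)) - w (y - x) - \sum_k (- h) ord0 k * partial k w (y - x)).
    rewrite opprD addrA !mulrBr; congr (_ - _); rewrite mulr_sumr; apply: eq_bigr => k _.
    by rewrite !mxE; ring.
  rewrite normrM mulrC ler_wpM2r//.
  by have := rV_taylor (y - x) (- h) cw.1 hM; rewrite normrN.
rewrite RintZ; last exact: intg_norm.
by rewrite le_eqVlt; apply/orP; left; apply/eqP; ring.
Qed.

Lemma partial_conv f w k : intg f -> cutoffable w ->
  partial k (conv f w) = fun x => - conv f (partial k w) x.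
Proof. by move=> If cw; apply/funext => x; have [_ ->] := conv_diff x If cw. Qed.

Lemma smooth_conv f w : intg f -> cutoffable w -> smooth (conv f w).
Proof.
move=> If cw; apply/smoothP => n; elim: n w cw => //= n IH w cw.
split=> [x|k]; first by case: (conv_diff x If cw).
rewrite partial_conv//.
under eq_fun do rewrite -mulN1r.
apply: CnM; first exact: Cn_cst.
by apply: IH; exact: cutoffable_partial.
Qed.

Lemma convE f w x : intg f -> cutoffable w -> conv f w x = \int[mu]_z (f (x + z) * w z).
Proof.
move=> If cw; rewrite /conv -(Rintegral_rV_shift x).
  by apply: eq_Rintegral => z _; rewrite addrK [z + x]addrC.
by apply: intg_meas; exact: conv_intg.
Qed.

End convolution.

Section mollifier.
Context {R : realType} {d : nat}.
Local Notation E := 'rV[R]_d.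
Local Notation mu := (lebesgue_rV R d).
Implicit Types f g h w : E -> R.

Definition bumpe (e : R) (x : E) : R := bump0 (e^-1 *: x).

Lemma cutoffable_bumpe e : 0 < e -> cutoffable (bumpe e).
Proof.
move=> e0; split.
  have := @smooth_affine R d bump0 e^-1 0 (@smooth_bump0 R d).
  by rewrite /bumpe; under eq_fun do rewrite addr0.
exists e => x ex; apply: bump0_out.
by rewrite normrZ gtr0_norm ?invr_gt0// mulrC ler_pdivlMr// mul1r ltW.
Qed.

Lemma bumpe_ge0 e x : 0 <= bumpe e x. Proof. exact: bump0_ge0. Qed.

(** A lower bound for the bump on the half ball: each factor flat 1 (1 +- x_k)
    is at least flat 1 (1/2) = exp(-2). *)
Definition bump_low : R := (expR (-2) * expR (-2)) ^+ d.

Lemma bump_low_gt0 : 0 < bump_low.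
Proof. by rewrite exprn_gt0// mulr_gt0// expR_gt0. Qed.

Lemma flat1_low (t : R) : 2^-1 <= t -> expR (-2) <= flat 1 t.
Proof.
move=> t2; have t0 : 0 < t by rewrite (lt_le_trans _ t2).
rewrite /flat t0 hornerC mul1r ler_expR lerN2 -[leRHS]invrK lef_pV2 ?posrE ?invr_gt0//.
Qed.

Lemma bump0_low (x : E) : `|x| <= 2^-1 -> bump_low <= bump0 x.
Proof.
move=> /rV_norm_leP; rewrite invr_ge0 => /(_ (ltW (ltr0n _ 2))) h.
rewrite /bump_low -[X in _ ^+ X](card_ord d) -prodr_const; apply: ler_prod => k _.
have := h k; rewrite ler_norml => /andP[h1 h2].
rewrite mulr_ge0 ?expR_ge0//=.
by rewrite ler_pM ?expR_ge0// flat1_low//; lra.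
Qed.

Definition bumpI (e : R) : R := \int[mu]_x bumpe e x.

(** A lower bound for the integral suffices to control the normalised bump, so
    its exact scaling in e need not be computed. *)
Lemma bumpI_low e : 0 < e -> bump_low * e ^+ d <= bumpI e.
Proof.
move=> e0; have e20 : 0 < e / 2 by rewrite divr_gt0.
have mB : measurable (ball (0:E) (e / 2)) by exact: measurable_rV_ball.
have IB : intg (\1_(ball (0:E) (e / 2))).
  apply: (@intg_bounded _ _ _ 1 e); first exact: measurable_indic.
    move=> x ex; rewrite indicE memNset// -ball_normE /ball_ /= sub0r normrN => h; lra.
  by move=> x; rewrite indicE; case: (_ \in _); rewrite ?normr1 ?normr0.
have -> : bump_low * e ^+ d = \int[mu]_x (bump_low * \1_(ball (0:E) (e/2)) x).
  rewrite RintZ//; congr (_ * _).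
  rewrite /Rintegral integral_indic// setIT lebesgue_rV_ball//=.
  by congr (_ ^+ _); rewrite mulr2n -splitr.
apply: le_Rint.
- exact: intgZ.
- by apply: cutoffable_intg; exact: cutoffable_bumpe.
move=> x; rewrite indicE; have [h|h] := boolP (_ \in _); last by rewrite mulr0 bumpe_ge0.
rewrite mulr1; apply: bump0_low.
move: h; rewrite inE -ball_normE /ball_ /= sub0r normrN => h.
rewrite normrZ gtr0_norm ?invr_gt0// mulrC ler_pdivrMr//; lra.
Qed.

Lemma bumpI_gt0 e : 0 < e -> 0 < bumpI e.
Proof.
by move=> e0; apply: lt_le_trans (bumpI_low e0); rewrite mulr_gt0 ?bump_low_gt0 ?exprn_gt0.
Qed.

Definition moll e (x : E) : R := (bumpI e)^-1 * bumpe e x.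

Lemma moll_ge0 e x : 0 < e -> 0 <= moll e x.
Proof. by move=> e0; rewrite mulr_ge0 ?bumpe_ge0// invr_ge0 ltW// bumpI_gt0. Qed.

Lemma moll_out e x : 0 < e -> e <= `|x| -> moll e x = 0.
Proof.
move=> e0 ex; rewrite /moll /bumpe bump0_out ?mulr0//.
by rewrite normrZ gtr0_norm ?invr_gt0// mulrC ler_pdivlMr// mul1r.
Qed.

Lemma cutoffable_moll e : 0 < e -> cutoffable (moll e).
Proof.
move=> e0; have [sb _] := cutoffable_bumpe e0; split; first exact: smoothZ.
by exists e => x ex; rewrite moll_out// ltW.
Qed.

Lemma moll_int e : 0 < e -> \int[mu]_x moll e x = 1.
Proof.
move=> e0; rewrite RintZ; last by apply: cutoffable_intg; exact: cutoffable_bumpe.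
by rewrite -/(bumpI e) mulVf// gt_eqF// bumpI_gt0.
Qed.

(** The gradient of a kernel of width e is of order e^(-1) times its height
    e^(-d). *)
Lemma partial_moll_bound : exists2 C : R, 0 < C & forall e x k, 0 < e ->
  `|partial k (moll e) x| <= C / (e * e ^+ d).
Proof.
have [C0 C00 hC0] : exists2 M : R, 0 <= M & forall k (x : E), `|partial k (@bump0 R d) x| <= M.
  have c0 : cutoffable (@bump0 R d).
    by split; [exact: smooth_bump0|exists 1 => x /ltW; exact: bump0_out].
  have /choice[B hB] : forall k : 'I_d, exists M, 0 <= M /\ forall x : E, `|partial k (@bump0 R d) x| <= M.
    by move=> k; have [M M0 hM] := cutoffable_bounded (cutoffable_partial k c0); exists M.
  exists (\sum_k B k) => [|k x]; first by apply: sumr_ge0 => k _; case: (hB k).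
  apply: (le_trans ((hB k).2 x)).
  by rewrite (bigD1 k)//= lerDl sumr_ge0// => j _; case: (hB j).
exists ((C0 + 1) / bump_low); first by rewrite divr_gt0 ?bump_low_gt0// ltr_wpDl.
move=> e x k e0.
have db : forall x : E, differentiable (@bump0 R d) x by move=> y; apply: smooth_diff; exact: smooth_bump0.
have -> : partial k (moll e) x = (bumpI e)^-1 * (e^-1 * partial k (@bump0 R d) (e^-1 *: x)).
  have sb := (cutoffable_bumpe e0).1.
  rewrite /moll (partialM k (f := fun=> (bumpI e)^-1) (g := bumpe e)).
  - rewrite partial_cst mul0r addr0; congr (_ * _).
    have := partial_affine k e^-1 0 db; rewrite /bumpe.
    by under eq_fun do rewrite addr0; move=> ->; rewrite addr0.
  - by move=> y; exact: differentiable_cst.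
  - by move=> y; exact: smooth_diff.
have b0 := bump_low_gt0; have I0 := bumpI_gt0 e0.
have ed0 : 0 < e ^+ d by rewrite exprn_gt0.
rewrite !normrM (gtr0_norm (x := (bumpI e)^-1)) ?invr_gt0// (gtr0_norm (x := e^-1)) ?invr_gt0//.
apply: (@le_trans _ _ ((bump_low * e ^+ d)^-1 * (e^-1 * (C0 + 1)))).
  apply: ler_pM; rewrite ?invr_ge0 ?mulr_ge0 ?invr_ge0//; try exact: ltW.
  - by rewrite lef_pV2 ?posrE// ?mulr_gt0// bumpI_low.
  - by rewrite ler_wpM2l ?invr_ge0 ?(ltW e0)// (le_trans (hC0 _ _))// lerDl.
rewrite le_eqVlt; apply/orP; left; apply/eqP.
by field; rewrite !gt_eqF.
Qed.

(** The mollification averages the values of f at distance less than e. With c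
    = 0 this is a sup bound, with f continuous at x it gives convergence at x. *)
Lemma conv_moll_near f e x (c r : R) : intg f -> 0 < e ->
  (forall z, `|z| < e -> `|f (x + z) - c| <= r) -> `|conv f (moll e) x - c| <= r.
Proof.
move=> If e0 h; have cm := cutoffable_moll e0.
have Im := cutoffable_intg cm.
have -> : c = \int[mu]_z (c * moll e z) by rewrite RintZ// moll_int// mulr1.
have -> : r = \int[mu]_z (r * moll e z) by rewrite RintZ// moll_int// mulr1.
have Ifm : intg (fun z => f (x + z) * moll e z).
  have := intg_shift x (conv_intg x If cm).
  rewrite /intg (_ : _ \o _ = EFin \o (fun z => f (x + z) * moll e z))//.
  by apply/funext => z /=; rewrite addrK [z + x]addrC.
rewrite convE// -RintB//; last exact: intgZ.
apply: le_norm_Rint; [|exact: intgZ|].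
  by apply: intg_meas; apply: intgB => //; exact: intgZ.
move=> z; rewrite -mulrBl normrM (ger0_norm (moll_ge0 _ e0)).
have [ze|ze] := ltP `|z| e; first by rewrite ler_wpM2r ?moll_ge0// h.
by rewrite moll_out// !mulr0.
Qed.

(** For p = 2: the mean m satisfies h^2 >= 2 m h - m^2 pointwise, and the
    weight has integral 1. *)
Lemma jensen_moll (p : nat) (h : E -> R) e : p = 1%N \/ p = 2%N -> 0 < e ->
  measurable_fun setT h -> intg (fun z => h z * moll e z) ->
  ((`|\int[mu]_z (h z * moll e z)| ^+ p)%:E <= \int[mu]_z (`|h z| ^+ p * moll e z)%:E)%E.
Proof.
move=> pE e0 mh Ih; have cm := cutoffable_moll e0.
have Im := cutoffable_intg cm; have mm := intg_meas Im.
have m0 z : 0 <= moll e z by exact: moll_ge0.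
case: pE => ->.
  rewrite expr1; under eq_integral => z _ do rewrite expr1.
  rewrite -intg_EFin; last 2 first.
  - have := intg_norm Ih; rewrite /intg (_ : _ \o _ = EFin \o (fun z => `|h z| * moll e z))//.
    by apply/funext => z /=; rewrite normrM (ger0_norm (m0 z)).
  - by move=> z; rewrite mulr_ge0.
  rewrite lee_fin; apply: le_norm_Rint.
  - exact: intg_meas.
  - have := intg_norm Ih; rewrite /intg (_ : _ \o _ = EFin \o (fun z => `|h z| * moll e z))//.
    by apply/funext => z /=; rewrite normrM (ger0_norm (m0 z)).
  - by move=> z; rewrite normrM (ger0_norm (m0 z)).
have m2 : measurable_fun setT (fun z => `|h z| ^+ 2 * moll e z).
  by apply: measurable_funM => //; apply: measurable_funX; exact: measurableT_comp.
(* If the right-hand side is infinite, there is nothing to show. *)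
have [fin|] := ltP (\int[mu]_z (`|h z| ^+ 2 * moll e z)%:E)%E +oo%E; last first.
  by rewrite leye_eq => /eqP ->; rewrite leey.
have I2 : intg (fun z => `|h z| ^+ 2 * moll e z).
  apply: intg_lty => //.
  rewrite (eq_integral (fun z => (`|h z| ^+ 2 * moll e z)%:E))// => z _.
  by rewrite ger0_norm// mulr_ge0// exprn_ge0.
rewrite -intg_EFin//; last by move=> z; rewrite mulr_ge0 ?exprn_ge0.
rewrite lee_fin; set m := \int[mu]_z (h z * moll e z).
(* As the weight has integral 1, m^2 = 2 m m - m^2. *)
have -> : `|m| ^+ 2 = \int[mu]_z ((2 * m) * (h z * moll e z) - m ^+ 2 * moll e z).
  have J1 := intgZ (2 * m) Ih; have J2 := intgZ (m ^+ 2) Im.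
  rewrite RintB// (RintZ _ Ih) (RintZ _ Im).
  rewrite moll_int// -/m real_normK ?num_real//; ring.
apply: le_Rint => //; first by apply: intgB; exact: intgZ.
move=> z; rewrite real_normK ?num_real// -subr_ge0.
have -> : h z ^+ 2 * moll e z - (2 * m * (h z * moll e z) - m ^+ 2 * moll e z) = (h z - m) ^+ 2 * moll e z by ring.
by rewrite mulr_ge0 ?sqr_ge0.
Qed.

(** By Jensen and Tonelli, the error is at most an average over |z| < eps of
    the L^p distance between f and its translate by z. *)
Lemma conv_moll_cvg (p : nat) f : p = 1%N \/ p = 2%N -> intg f -> (Npow p f < +oo)%E ->
  forall e : R, 0 < e -> exists2 r : R, 0 < r & forall eps, 0 < eps < r ->
    (Npow p (fun x => conv f (moll eps) x - f x)%R <= e%:E)%E.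
Proof.
move=> pE If Nf e e0; have mf := intg_meas If.
have p0 : (0 < p)%N by case: pE => ->.
have [r r0 hr] := tcont_Lp p0 mf Nf e0.
exists r => // eps /andP[eps0 epsr].
have cm := cutoffable_moll eps0; have Im := cutoffable_intg cm.
have mm := intg_meas Im.
have m0 z : 0 <= moll eps z by exact: moll_ge0.
have mfz : measurable_fun setT (fun xz : E * E => f (xz.1 + xz.2) - f xz.1).
  apply: measurable_funB; apply: (measurableT_comp mf) => //.
  exact: measurable_rV_add.
(* The integrand of the Tonelli argument: |f(x+z) - f(x)|^p weighted by the
   kernel at z. *)
pose F (xz : E * E) : \bar R := (`|f (xz.1 + xz.2) - f xz.1| ^+ p * moll eps xz.2)%:E.
have F0 xz : (0 <= F xz)%E by rewrite lee_fin mulr_ge0// exprn_ge0.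
have mF : measurable_fun setT F.
  apply/measurable_EFinP; apply: measurable_funM.
    by apply: measurable_funX; exact: measurableT_comp.
  exact: (measurableT_comp mm).
apply: (@le_trans _ _ (\int[mu]_x \int[mu]_z F (x, z))%E).
  apply: ge0_le_integral => //.
  - by apply: measurable_Npow; apply: measurable_funB => //; apply: smooth_meas; exact: smooth_conv.
  - exact: (measurable_fun_fubini_tonelli_F (m2 := @lebS R d) F mF F0).
  move=> x _.
  have Ixm : intg (fun z => f (x + z) * moll eps z).
    have := intg_shift x (conv_intg x If cm).
    rewrite /intg (_ : _ \o _ = EFin \o (fun z => f (x + z) * moll eps z))//.
    by apply/funext => z /=; rewrite addrK [z + x]addrC.
  have E1 : (fun z => (f (x + z) - f x) * moll eps z) = (fun z => f (x + z) * moll eps z - f x * moll eps z).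
    by apply/funext => z; rewrite mulrBl.
  have Id : intg (fun z => (f (x + z) - f x) * moll eps z).
    by rewrite E1; apply: intgB => //; exact: intgZ.
  have -> : conv f (moll eps) x - f x = \int[mu]_z ((f (x + z) - f x) * moll eps z).
    rewrite E1 RintB//; last exact: intgZ.
    by rewrite RintZ// moll_int// mulr1 convE.
  apply: jensen_moll => //.
  apply: measurable_funB => //.
  have := measurable_shift x mf.
  by under eq_fun do rewrite addrC.
rewrite lebesgue_rV_tonelli2//.
apply: (@le_trans _ _ (\int[mu]_z (e%:E * (moll eps z)%:E))%E).
  apply: ge0_le_integral => //.
  - by move=> z _; apply: integral_ge0.
  - exact: (measurable_fun_fubini_tonelli_G (m1 := @lebS R d) F mF F0).
  - by apply: measurable_funeM; exact/measurable_EFinP.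
  move=> z _; have [ze|ze] := ltP `|z| eps; last first.
    rewrite moll_out// mule0 integral0_eq// => x _.
    by rewrite /F /= moll_out// mulr0.
  rewrite /F /=; under eq_integral => x _ do rewrite EFinM.
  have mz : measurable_fun setT (fun x : E => f (x + z) - f x) by apply: measurable_funB => //; exact: measurable_shift.
  have mN := measurable_Npow p mz.
  rewrite ge0_integralZr ?lee_fin//.
  by rewrite lee_wpmul2r ?lee_fin//; apply: hr; exact: lt_trans epsr.
have mm' : measurable_fun setT (fun z => (moll eps z)%:E) by exact/measurable_EFinP.
rewrite ge0_integralZl_EFin ?(ltW e0)// => [|z _]; last by rewrite lee_fin.
by rewrite -intg_EFin// moll_int// mule1.
Qed.

End mollifier.

(** * Square-integrable functions *)

Section L2_theory.
Context {R : realType} {d : nat}.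
Local Notation E := 'rV[R]_d.
Local Notation mu := (lebesgue_rV R d).
Implicit Types f g h w u v phi : E -> R.

(** Square integrable and integrable. All functions considered here live on
    sets of finite measure, where the second follows from the first; having
    both makes them admissible in convolutions. *)
Definition L12 f := intg f /\ intg (fun x => f x ^+ 2).

Definition sqnorm f : R := \int[mu]_x (f x ^+ 2).

Lemma L12_meas f : L12 f -> measurable_fun setT f.
Proof. by case=> /intg_meas. Qed.

Lemma sqnorm_ge0 f : 0 <= sqnorm f.
Proof. by apply: Rintegral_ge0 => x _; exact: sqr_ge0. Qed.

Lemma le_L12 f g : measurable_fun setT f -> (forall x, `|f x| <= g x) -> L12 g -> L12 f.
Proof.
move=> mf fg [I1 I2]; split; first exact: le_intg fg I1.
apply: le_intg I2; first exact: measurable_funX.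
move=> x; rewrite normrX lerXn2r ?nnegrE// ?(le_trans _ (fg x))//.
Qed.

Lemma L12_norm f : L12 f -> L12 (fun x => `|f x|).
Proof.
move=> [I1 I2]; split; first exact: intg_norm.
by under eq_fun do rewrite real_normK ?num_real//.
Qed.

Lemma sqrD_le (a b : R) : (a + b) ^+ 2 <= 2 * a ^+ 2 + 2 * b ^+ 2.
Proof. rewrite -subr_ge0 (_ : _ - _ = (a - b) ^+ 2) ?sqr_ge0//; ring. Qed.

Lemma L12D f g : L12 f -> L12 g -> L12 (fun x => f x + g x).
Proof.
move=> [I1 I2] [J1 J2]; split; first exact: intgD.
have h : intg (fun x => 2 * f x ^+ 2 + 2 * g x ^+ 2) by apply: intgD; exact: intgZ.
apply: le_intg h => [|x].
  by apply: measurable_funX; apply: measurable_funD; exact: intg_meas.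
by rewrite ger0_norm ?sqr_ge0// sqrD_le.
Qed.

Lemma L12Z a f : L12 f -> L12 (fun x => a * f x).
Proof.
move=> [I1 I2]; split; first exact: intgZ.
by under eq_fun do rewrite exprMn; exact: intgZ.
Qed.

Lemma L12N f : L12 f -> L12 (fun x => - f x).
Proof. by move=> /(L12Z (-1)); under eq_fun do rewrite mulN1r. Qed.

Lemma L12B f g : L12 f -> L12 g -> L12 (fun x => f x - g x).
Proof. by move=> Lf Lg; apply: L12D => //; exact: L12N. Qed.

Lemma L120 : L12 (fun=> 0).
Proof.
by split; [exact: intg0|under eq_fun do rewrite expr0n/=; exact: intg0].
Qed.

Lemma L12_sum (I : Type) (s : seq I) (F : I -> E -> R) :
  (forall i, L12 (F i)) -> L12 (fun x => \sum_(i <- s) F i x).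
Proof.
move=> IF; elim: s => [|i s IH].
  by under eq_fun do rewrite big_nil; exact: L120.
by under eq_fun do rewrite big_cons; apply: L12D.
Qed.

Lemma L12_intgM f g : L12 f -> L12 g -> intg (fun x => f x * g x).
Proof.
move=> Lf Lg; have [_ I2] := Lf; have [_ J2] := Lg.
apply: le_intg (intgD I2 J2) => [|x].
  by apply: measurable_funM; exact: L12_meas.
rewrite normrM -subr_ge0.
have -> : f x ^+ 2 + g x ^+ 2 - `|f x| * `|g x| = `|f x| ^+ 2 + `|g x| ^+ 2 - `|f x| * `|g x|.
  by rewrite !real_normK ?num_real.
have := sqr_ge0 (`|f x| - `|g x|); have := normr_ge0 (f x); have := normr_ge0 (g x); nra.
Qed.

Lemma L12M_bounded f g (M : R) : L12 f -> measurable_fun setT g ->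
  (forall x, `|g x| <= M) -> L12 (fun x => f x * g x).
Proof.
move=> Lf mg gM; apply: (@le_L12 _ (fun x => M * `|f x|)).
- by apply: measurable_funM => //; exact: L12_meas.
- by move=> x; rewrite normrM mulrC ler_wpM2r.
- by apply: L12Z; exact: L12_norm.
Qed.

Lemma cutoffable_L12 w : cutoffable w -> L12 w.
Proof.
move=> cw; have Iw := cutoffable_intg cw; split => //.
have [M _ hM] := cutoffable_bounded cw.
by under eq_fun do rewrite expr2; exact: intgM_bounded (intg_meas Iw) hM.
Qed.

Lemma L12_Npow f p : p = 1%N \/ p = 2%N -> L12 f -> (Npow p f < +oo)%E.
Proof.
move=> [->|->] [I1 I2].
  move/integrableP : I1 => [_]; rewrite /Npow.
  by rewrite (eq_integral (fun x => `|f x|%:E))// => x _; rewrite expr1.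
move/integrableP : I2 => [_]; rewrite /Npow.
rewrite (eq_integral (fun x => (`|f x| ^+ 2)%:E))// => x _ /=.
by rewrite normrX.
Qed.

Lemma Npow2E f : L12 f -> Npow 2 f = (sqnorm f)%:E.
Proof.
move=> [_ I2]; rewrite /sqnorm intg_EFin//; last by move=> x; exact: sqr_ge0.
by apply: eq_integral => x _; rewrite real_normK ?num_real.
Qed.

Lemma sqnormD_le f g : L12 f -> L12 g -> sqnorm (fun x => f x + g x) <= 2 * sqnorm f + 2 * sqnorm g.
Proof.
move=> Lf Lg; have [_ I2] := Lf; have [_ J2] := Lg.
rewrite /sqnorm -!RintZ// -RintD//; [|exact: intgZ|exact: intgZ].
apply: le_Rint; [by case: (L12D Lf Lg)|by apply: intgD; exact: intgZ|].
by move=> x; exact: sqrD_le.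
Qed.

Lemma sqnormN f : sqnorm (fun x => - f x) = sqnorm f.
Proof. by apply: eq_Rintegral => x _; rewrite sqrrN. Qed.

Lemma le_sqnorm f g : L12 f -> L12 g -> (forall x, `|f x| <= `|g x|) -> sqnorm f <= sqnorm g.
Proof.
move=> [_ I2] [_ J2] fg; apply: le_Rint => // x.
by rewrite -(real_normK (num_real (f x))) -(real_normK (num_real (g x))) lerXn2r ?nnegrE.
Qed.

(** Nonnegativity of the integral of (f - t g)^2 at the optimal t. *)
Lemma cauchy_schwarz f g : L12 f -> L12 g ->
  (\int[mu]_x (f x * g x)) ^+ 2 <= sqnorm f * sqnorm g.
Proof.
move=> Lf Lg; have [_ I2] := Lf; have [_ J2] := Lg.
have K := L12_intgM Lf Lg.
set c := \int[mu]_x (f x * g x).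
have q t : 0 <= sqnorm f - 2 * t * c + t ^+ 2 * sqnorm g.
  have -> : sqnorm f - 2 * t * c + t ^+ 2 * sqnorm g = \int[mu]_x ((f x - t * g x) ^+ 2).
    rewrite /sqnorm /c -!RintZ// -RintB//; last exact: intgZ.
    rewrite -RintD//; [|by apply: intgB => //; exact: intgZ|exact: intgZ].
    by apply: eq_Rintegral => x _; ring.
  by apply: Rintegral_ge0 => x _; exact: sqr_ge0.
have [g0|g0] := eqVneq (sqnorm g) 0.
  rewrite g0 mulr0; suff -> : c = 0 by rewrite expr0n.
  apply/eqP; apply: contraT => c0.
  have := q ((sqnorm f + 1) / (2 * c)).
  rewrite g0 mulr0 addr0 (_ : 2 * _ * c = sqnorm f + 1); last by field.
  by rewrite opprD addNKr oppr_ge0 ler10.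
have gp : 0 < sqnorm g by rewrite lt_def g0 sqnorm_ge0.
have := q (c / sqnorm g).
rewrite (_ : _ + _ = sqnorm f - c ^+ 2 / sqnorm g); last by field.
by rewrite subr_ge0 ler_pdivrMr.
Qed.

Lemma conv_moll_L2 f : L12 f -> forall e : R, 0 < e -> exists2 r : R, 0 < r &
  forall eps, 0 < eps < r -> L12 (conv f (moll eps)) /\
    sqnorm (fun x => conv f (moll eps) x - f x) <= e.
Proof.
move=> Lf e e0; have If := Lf.1.
have p2 : (2 = 1 \/ 2 = 2)%N by right.
have p1 : (1 = 1 \/ 1 = 2)%N by left.
have [r r0 hr] := conv_moll_cvg p2 If (L12_Npow p2 Lf) e0.
have [s s0 hs] := conv_moll_cvg p1 If (L12_Npow p1 Lf) e0.
exists (Num.min r s); first by rewrite lt_min r0.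
move=> eps /andP[eps0]; rewrite lt_min => /andP[er es].
have cm := cutoffable_moll (d := d) eps0.
have mc : measurable_fun setT (conv f (moll eps)) by apply: smooth_meas; exact: smooth_conv.
have md : measurable_fun setT (fun x => conv f (moll eps) x - f x) by apply: measurable_funB => //; exact: L12_meas.
have hr' := hr eps; rewrite eps0 er in hr'; have {}hr := hr' isT.
have hs' := hs eps; rewrite eps0 es in hs'; have {}hs := hs' isT.
have Ld : L12 (fun x => conv f (moll eps) x - f x).
  split; apply: intg_lty => //; last 2 first.
  - exact: measurable_funX.
  - apply: le_lt_trans (ltry e); apply: le_trans hr; rewrite le_eqVlt; apply/orP; left; apply/eqP.
    by apply: eq_integral => x _; rewrite normrX.
  apply: le_lt_trans (ltry e); apply: le_trans hs; rewrite le_eqVlt; apply/orP; left; apply/eqP.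
  by apply: eq_integral => x _; rewrite expr1.
split; last by rewrite -lee_fin -Npow2E.
by have := L12D Ld Lf; under eq_fun do rewrite subrK.
Qed.

End L2_theory.

(** * Test functions and weak gradients *)

Section test_functions.
Context {R : realType} {d : nat}.
Local Notation E := 'rV[R]_d.
Local Notation mu := (lebesgue_rV R d).
Implicit Types (f g h w u v phi : E -> R) (U K : set E).

Lemma test_funI U K phi : smooth phi -> compact K -> (forall x, ~ K x -> phi x = 0) ->
  K `<=` U -> test_fun U phi.
Proof.
move=> sp cK pK KU.
have clK : closed K by apply: compact_closed => //; exact: norm_hausdorff.
have sK : closure [set x | phi x != 0] `<=` K.
  rewrite [X in _ `<=` X]((closure_id K).1 clK); apply: closure_subset => x /= px.
  by apply: contrapT => /pK/eqP; apply/negP.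
split=> //; last exact: subset_trans KU.
by apply: (subclosed_compact _ cK sK); exact: closed_closure.
Qed.

Lemma closed_rV_ball_compact (x : E) r : compact [set y | `|y - x| <= r].
Proof.
apply: bounded_closed_compact.
  exists (r + `|x|); split; first exact: num_real.
  move=> M rM y /= h; apply: le_trans (ltW rM).
  by rewrite -[y](subrK x); apply: le_trans (ler_normD _ _) _; rewrite lerD2r.
apply: (@closed_comp _ _ (fun y : E => `|y - x|) [set t | t <= r]); last exact: closed_le.
move=> y _; apply: (@continuous_comp _ _ _ (fun y : E => y - x) (fun z => `|z|)).
  by apply: continuousB; [exact: cvg_id|exact: cst_continuous].
exact: norm_continuous.
Qed.

Lemma test_fun_out U phi x : test_fun U phi -> ~ U x -> phi x = 0.
Proof.
move=> [_ _ sU] nU; apply/eqP; apply: contra_notT nU => px.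
by apply: sU; exact: subset_closure.
Qed.

Lemma test_fun_cutoffable U phi : test_fun U phi -> cutoffable phi.
Proof.
move=> [sp cp _]; split => //.
have /compact_bounded[M [_ hM]] := cp.
exists (M + 1) => x Mx; apply/eqP; apply: contraT => px.
have M1 : M < M + 1 by rewrite ltrDl.
have cx : closure [set x | phi x != 0] x by apply: subset_closure.
have /= := hM (M + 1) M1 x cx.
by rewrite leNgt Mx.
Qed.

Lemma test_funS U V phi : U `<=` V -> test_fun U phi -> test_fun V phi.
Proof. by move=> UV [? ? h]; split => //; exact: subset_trans UV. Qed.

Lemma compact_margin K U : compact K -> open U -> K `<=` U ->
  exists2 r : R, 0 < r & forall x y, K x -> `|y - x| <= r -> U y.
Proof.
move=> /compact_near_coveringP cK oU KU.
have h : \forall r \near (0 : R)^'+, forall x, K x -> forall y, `|y - x| <= r -> U y.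
  apply: cK => x Kx; have /nbhs_ballP[e /= e0 eU] := open_nbhs_nbhs (conj oU (KU x Kx)).
  have e2 : 0 < e / 2 by rewrite divr_gt0.
  exists (ball x (e / 2), [set r | r < e / 2]) => /=.
    split; first exact: nbhsx_ballx.
    exact: nbhs_right_lt.
  move=> [x' r] /= [xx' re] y yx'; apply: eU.
  move: xx'; rewrite -!ball_normE /ball_ /= => xx'.
  rewrite -(subrKA x') (le_lt_trans (ler_normD _ _))// [e]splitr ltrD//.
  by rewrite distrC (le_lt_trans yx').
have [r [r0 hr]] : exists r : R, 0 < r /\ forall x, K x -> forall y, `|y - x| <= r -> U y.
  near (0 : R)^'+ => r; exists r; split => //.
  by near: r.
by exists r => // x y Kx; exact: hr.
Unshelve. all: by end_near. Qed.

End test_functions.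

Section weak_gradient.
Context {R : realType} {d : nat}.
Local Notation E := 'rV[R]_d.
Local Notation mu := (lebesgue_rV R d).
Implicit Types (f h w u v phi psi chi : E -> R) (U K : set E) (g gam : 'I_d -> E -> R).

Lemma cutoffableM w psi : smooth psi -> cutoffable w -> cutoffable (fun x => psi x * w x).
Proof.
move=> sp [sw [r vw]]; split; first exact: smoothM.
by exists r => x rx; rewrite vw ?mulr0.
Qed.

(** The difference quotients in direction k integrate to 0 by translation
    invariance, and they converge uniformly, with common bounded support, by
    the Taylor bound. This replaces integration by parts in one variable. *)
Lemma int_partial psi k : cutoffable psi -> \int[mu]_x partial k psi x = 0.
Proof.
move=> cp; have [sp [r vp]] := cp.
have [M hM] : exists M : R, forall k j x, `|partial j (partial k psi) x| <= M.
  have /choice[B hB] : forall kj : 'I_d * 'I_d, exists M, 0 <= M /\ forall x, `|partial kj.2 (partial kj.1 psi) x| <= M.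
    move=> [i j]; have [M M0 hM] := cutoffable_bounded (cutoffable_partial j (cutoffable_partial i cp)).
    by exists M.
  exists (\sum_kj B kj) => i j y; apply: (le_trans ((hB (i, j)).2 y)).
  by rewrite (bigD1 (i, j))//= lerDl sumr_ge0// => kj _; case: (hB kj).
pose e : E := delta_mx ord0 k.
have ne : `|e| <= 1.
  by apply/rV_norm_leP => // j; rewrite mxE eqxx/=; case: (j == k); rewrite ?normr1 ?normr0.
pose C := d%:R * (d%:R * M).
have C0 : 0 <= C.
  by rewrite !mulr_ge0// (le_trans (normr_ge0 _) (hM k k 0)).
(* The radius exceeds that of the support by 2 so that, for t < 1, the
   difference quotients also vanish outside B. *)
pose B : set E := ball (0 : E) (`|r| + 2).
have IB : intg (\1_B : E -> R).
  apply: (@intg_bounded _ _ _ 1 (`|r| + 2)).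
  - by apply: measurable_indic; exact: measurable_rV_ball.
  - move=> x rx; rewrite indicE memNset// /B -ball_normE /ball_ /= sub0r normrN => h; lra.
  - by move=> x; rewrite indicE; case: (_ \in _); rewrite ?normr1 ?normr0.
have Ip := cutoffable_intg cp.
have Idp := cutoffable_intg (cutoffable_partial k cp).
have key (t : R) : 0 < t < 1 -> `|\int[mu]_x partial k psi x| <= t * (C * \int[mu]_x \1_B x).
  move=> /andP[t0 t1].
  have Is := intg_shift (t *: e) Ip.
  have Id : intg (fun x => t^-1 * (psi (x + t *: e) - psi x)) by apply: intgZ; exact: intgB.
  have z0 : \int[mu]_x (t^-1 * (psi (x + t *: e) - psi x)) = 0.
    rewrite RintZ ?RintB//; last exact: intgB.
    by rewrite Rintegral_rV_shift ?subrr ?mulr0//; exact: intg_meas.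
  rewrite -[X in `|X|](subr0) -z0 -RintB// mulrA -RintZ//.
  apply: le_norm_Rint; [|exact: intgZ|].
    by apply: intg_meas; exact: intgB.
  move=> x; rewrite indicE; have [xB|xB] := boolP (x \in B); last first.
    have xr : `|r| + 2 <= `|x|.
      by move: xB; rewrite notin_setE /B -ball_normE /ball_ /= sub0r normrN => /negP; rewrite -leNgt.
    have rr := ler_norm r.
    rewrite (vanish_out_partial k vp); last lra.
    rewrite !vp ?subrr ?mulr0 ?subrr ?normr0//; first lra.
    have : `|x| <= `|x + t *: e| + t.
      rewrite -{1}(addrK (t *: e) x); apply: le_trans (ler_normB _ _) _.
      by rewrite lerD2l normrZ gtr0_norm// ler_piMr// ltW.
    lra.
  rewrite mulr1.
  have := rV_taylor x (t *: e) sp hM.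
  rewrite (bigD1 k)//= big1 => [|j jk]; last first.
    by rewrite !mxE (negbTE jk) andbF mulr0 mul0r.
  rewrite addr0 !mxE !eqxx mulr1 => h.
  have -> : partial k psi x - t^-1 * (psi (x + t *: e) - psi x) =
     - t^-1 * (psi (x + t *: e) - psi x - t * partial k psi x) by field; rewrite gt_eqF.
  have ti : `|- t^-1| = t^-1 by rewrite normrN gtr0_norm// invr_gt0.
  rewrite normrM ti ler_pdivrMl//.
  apply: le_trans h _; rewrite normrZ gtr0_norm// exprMn -/C.
  rewrite (_ : t * (t * C) = C * (t ^+ 2 * 1)); last by ring.
  rewrite ler_wpM2l// ler_wpM2l ?sqr_ge0// expr2; have := normr_ge0 e; nra.
apply/eqP; rewrite -normr_le0; apply/ler_addgt0Pr => a a0; rewrite add0r.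
set D := C * _ in key.
have D0 : 0 <= D by rewrite mulr_ge0//; apply: Rintegral_ge0 => x _; rewrite indicE.
pose t := Num.min 2^-1 (a / (D + 1)).
have D1 : 0 < D + 1 by lra.
have t0 : 0 < t by rewrite lt_min invr_gt0 ltr0n divr_gt0.
apply: le_trans (key t _) _.
  by rewrite t0 (@le_lt_trans _ _ 2^-1) ?ge_min ?lexx// invf_lt1 ?ltr1n.
apply: (@le_trans _ _ (a / (D + 1) * (D + 1))); last by rewrite divfK ?gt_eqF.
by apply: ler_pM => //; [exact: ltW|rewrite ge_min lexx orbT|rewrite lerDl].
Qed.

(** A weak gradient on U with integrals over the whole space: test functions
    vanish outside U, so that the values of u and g outside U do not matter.
    This avoids integrals over subdomains and lets convolutions act directly. *)
Definition wg U u g := forall phi k, test_fun U phi ->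
  \int[mu]_x (u x * partial k phi x) = - \int[mu]_x (g k x * phi x).

Lemma wgS U V u g : U `<=` V -> wg V u g -> wg U u g.
Proof. by move=> UV h phi k tp; apply: h; exact: test_funS tp. Qed.

(** The product of psi and a test function has compact support, so int_partial
    applies to it. *)
Lemma wg_smooth U psi : smooth psi -> wg U psi (fun k => partial k psi).
Proof.
move=> sp phi k tp; have cp := test_fun_cutoffable tp.
have c1 := cutoffableM sp (cutoffable_partial k cp).
have c2 := cutoffableM (smooth_partial k sp) cp.
apply/eqP; rewrite -addr_eq0 -RintD; [|exact: cutoffable_intg|exact: cutoffable_intg].
rewrite -(int_partial k (cutoffableM sp cp)); apply/eqP; apply: eq_Rintegral => x _.
rewrite (partialM k (f := psi) (g := phi))// => y; apply: smooth_diff => //.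
by case: cp.
Qed.

Lemma wgD U u v g (h : 'I_d -> E -> R) : L12 u -> L12 v -> (forall k, L12 (g k)) -> (forall k, L12 (h k)) ->
  wg U u g -> wg U v h -> wg U (fun x => u x + v x) (fun k x => g k x + h k x).
Proof.
move=> Lu Lv Lg Lh wu wv phi k tp; have cp := test_fun_cutoffable tp.
have Lp := cutoffable_L12 cp; have Ldp := cutoffable_L12 (cutoffable_partial k cp).
under eq_Rintegral do rewrite mulrDl.
rewrite RintD ?wu ?wv//; [|exact: L12_intgM|exact: L12_intgM].
rewrite -opprD -RintD; [|exact: L12_intgM|exact: L12_intgM].
by congr (- _); apply: eq_Rintegral => x _; rewrite mulrDl.
Qed.

Lemma wgZ U a u g : L12 u -> (forall k, L12 (g k)) ->
  wg U u g -> wg U (fun x => a * u x) (fun k x => a * g k x).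
Proof.
move=> Lu Lg wu phi k tp; have cp := test_fun_cutoffable tp.
have Lp := cutoffable_L12 cp; have Ldp := cutoffable_L12 (cutoffable_partial k cp).
under eq_Rintegral do rewrite -mulrA.
under [in RHS]eq_Rintegral do rewrite -mulrA.
by rewrite !RintZ ?wu ?mulrN//; exact: L12_intgM.
Qed.

Lemma wg0 U : wg U (fun=> 0) (fun _ _ => 0).
Proof.
move=> phi k _.
have z (f : E -> R) : \int[mu]_x (0 * f x) = 0.
  by rewrite -[RHS](@Rint0 R d); apply: eq_Rintegral => x _; rewrite mul0r.
by rewrite !z oppr0.
Qed.

(** The translated kernel is a test function of U. *)
Lemma partial_conv_wg U u g k e x : intg u -> wg U u g -> 0 < e ->
  (forall y, `|y - x| <= e -> U y) ->
  partial k (conv u (moll e)) x = conv (g k) (moll e) x.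
Proof.
move=> Iu wu e0 xU; have cm := cutoffable_moll (d := d) e0.
rewrite partial_conv//.
pose phi y := moll e (y - x).
have phiE : phi = fun y => moll e (1 *: y + (- x)) by apply/funext => y; rewrite scale1r.
have sp : smooth phi by rewrite phiE; apply: smooth_affine; case: cm.
have tp : test_fun U phi.
  apply: (@test_funI _ _ _ [set y | `|y - x| <= e]) => //.
    exact: closed_rV_ball_compact.
  by move=> y /= /negP; rewrite -ltNge => h; rewrite /phi moll_out// ltW.
have := wu phi k tp.
have -> : partial k phi = fun y => partial k (moll e) (y - x).
  rewrite phiE partial_affine => [|y]; last by apply: smooth_diff; case: cm.
  by apply/funext => y; rewrite mul1r scale1r.
by move=> /(congr1 -%R); rewrite opprK.
Qed.

Lemma conv_zero f w x e : vanish_out e w -> (forall y, `|y - x| <= e -> f y = 0) -> conv f w x = 0.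
Proof.
move=> vw f0; rewrite /conv -(@Rint0 R d); apply: eq_Rintegral => y _.
have [h|h] := leP `|y - x| e; first by rewrite f0 ?mul0r.
by rewrite vw ?mulr0.
Qed.

Lemma moll_vanish e : 0 < e -> vanish_out e (@moll R d e).
Proof. by move=> e0 x ex; rewrite moll_out// ltW. Qed.

Lemma conv_moll_L2_fam (F : 'I_d -> E -> R) u : L12 u -> (forall k, L12 (F k)) ->
  forall e : R, 0 < e -> exists2 r : R, 0 < r & forall eps, 0 < eps < r ->
   [/\ L12 (conv u (moll eps)), sqnorm (fun x => conv u (moll eps) x - u x) <= e &
       forall k, L12 (conv (F k) (moll eps)) /\ sqnorm (fun x => conv (F k) (moll eps) x - F k x) <= e].
Proof.
move=> Lu LF e e0; have [r r0 hr] := conv_moll_L2 Lu e0.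
have /choice[s hs] : forall k, exists s : R, 0 < s /\ forall eps, 0 < eps < s ->
   L12 (conv (F k) (moll eps)) /\ sqnorm (fun x => conv (F k) (moll eps) x - F k x) <= e.
  by move=> k; have [s s0 hs] := conv_moll_L2 (LF k) e0; exists s.
exists (\big[Num.min/r]_k s k).
  by elim/big_ind : _ => // [a b a0 b0|k _]; rewrite ?lt_min ?a0//; case: (hs k).
move=> eps /andP[eps0 epss].
have er : eps < r by apply: lt_le_trans epss _; exact: bigmin_le_id.
have es k : eps < s k by apply: lt_le_trans epss _; exact: bigmin_le_cond.
have [] := hr eps; first by rewrite eps0.
by move=> h1 h2; split=> // k; apply: (hs k).2; rewrite eps0 es.
Qed.

Lemma small_eq0 (A C : R) : (forall e, 0 < e -> A ^+ 2 <= e * C) -> A = 0.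
Proof.
move=> h; apply/eqP; rewrite -sqrf_eq0 eq_le sqr_ge0 andbT.
apply/ler_addgt0Pr => a a0; rewrite add0r.
have C1 : 0 < `|C| + 1 by rewrite ltr_wpDl.
apply: le_trans (h (a / (`|C| + 1)) (divr_gt0 a0 C1)) _.
rewrite mulrAC ler_pdivrMr// ler_wpM2l ?(ltW a0)// (le_trans (ler_norm C))// lerDl//.
Qed.

(** The product rule for a bounded factor with bounded gradient. The weak
    gradient of chi is tested with the product of phi and a mollification of
    u; then the mollification is removed, in L^2. *)
Lemma wg_mul U chi gam u g (M : R) : open U ->
  measurable_fun setT chi -> (forall x, `|chi x| <= M) ->
  (forall k, measurable_fun setT (gam k)) -> (forall k x, `|gam k x| <= M) ->
  wg U chi gam -> L12 u -> (forall k, L12 (g k)) -> wg U u g ->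
  wg U (fun x => chi x * u x) (fun k x => chi x * g k x + gam k x * u x).
Proof.
move=> oU mc cM mg gM wc Lu Lg wu phi k tp.
have cp := test_fun_cutoffable tp.
have Lp := cutoffable_L12 cp; have Ldp := cutoffable_L12 (cutoffable_partial k cp).
have [r r0 hr] : exists2 r : R, 0 < r & forall x y, phi x != 0 -> `|y - x| <= r -> U y.
  case: tp => _ cK KU; have [r r0 hr] := compact_margin cK oU KU.
  by exists r => // x y px; apply: hr; exact: (@subset_closure _ [set x | phi x != 0]).
have Lcd : L12 (fun x => chi x * partial k phi x).
  by under eq_fun do rewrite mulrC; exact: L12M_bounded cM.
have Lcp : L12 (fun x => chi x * phi x).
  by under eq_fun do rewrite mulrC; exact: L12M_bounded cM.
have Lgp : L12 (fun x => gam k x * phi x).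
  by under eq_fun do rewrite mulrC; exact: (L12M_bounded Lp (mg k) (gM k)).
have L1 := L12D Lcd Lgp.
have I0 f h : L12 f -> L12 h -> intg (fun x => f x * h x) by exact: L12_intgM.
(* The identity holds exactly for the mollified functions: phi times the
   mollification of u is a test function. *)
have key eps : 0 < eps < r -> L12 (conv u (moll eps)) -> L12 (conv (g k) (moll eps)) ->
  \int[mu]_x (conv u (moll eps) x * (chi x * partial k phi x + gam k x * phi x)) +
  \int[mu]_x (conv (g k) (moll eps) x * (chi x * phi x)) = 0.
  move=> /andP[eps0 epsr] Lcu Lcg.
  have cm := cutoffable_moll (d := d) eps0.
  have su : smooth (conv u (moll eps)) by apply: smooth_conv => //; case: Lu.
  pose psi x := conv u (moll eps) x * phi x.
  have tpsi : test_fun U psi.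
    case: (tp) => sp cK KU; apply: (@test_funI _ _ _ (closure [set x | phi x != 0])) => //.
    - exact: smoothM.
    - move=> x nx; rewrite /psi; have [->|px] := eqVneq (phi x) 0; first by rewrite mulr0.
      by exfalso; apply: nx; apply: (@subset_closure _ [set x | phi x != 0]).
  have dpsi x : partial k psi x = conv u (moll eps) x * partial k phi x + conv (g k) (moll eps) x * phi x.
    rewrite /psi (partialM k (f := conv u (moll eps)) (g := phi)); last 2 first.
    - by move=> y; exact: smooth_diff.
    - by move=> y; apply: smooth_diff; case: cp.
    congr (_ + _); have [->|px] := eqVneq (phi x) 0; first by rewrite !mulr0.
    rewrite (@partial_conv_wg U u g)//; first by case: Lu.
    by move=> y yx; apply: (hr x) => //; rewrite (le_trans yx)// ltW.
  have := wc psi k tpsi.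
  move=> /eqP; rewrite -addr_eq0 => /eqP <-.
  rewrite -RintD; [|exact: I0|exact: I0].
  rewrite -RintD.
  - by apply: eq_Rintegral => x _; rewrite dpsi /psi; ring.
  - have := intgD (I0 _ _ Lcu Lcd) (I0 _ _ Lcg Lcp).
    rewrite /intg (_ : _ \o _ = EFin \o (fun x => chi x * partial k psi x))//.
    by apply/funext => x /=; rewrite dpsi; congr (_%:E); ring.
  - have := I0 _ _ Lcu Lgp.
    rewrite /intg (_ : _ \o _ = EFin \o (fun x => gam k x * psi x))//.
    by apply/funext => x /=; rewrite /psi; congr (_%:E); ring.
apply/eqP; rewrite -addr_eq0; apply/eqP.
set A := _ + _.
pose N1 := sqnorm (fun x => chi x * partial k phi x + gam k x * phi x).
pose N2 := sqnorm (fun x => chi x * phi x).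
apply: (@small_eq0 _ (2 * N1 + 2 * N2)) => e e0.
have [s s0 hs] := conv_moll_L2_fam Lu Lg e0.
pose eps := Num.min r s / 2.
have m0 : 0 < Num.min r s by rewrite lt_min r0.
have eps0 : 0 < eps by rewrite divr_gt0.
have epsm : eps < Num.min r s by rewrite /eps; lra.
move: (epsm); rewrite lt_min => /andP[epsr epss].
have [|Lcu hu hg] := hs eps; first by rewrite eps0.
have [Lcg {}hg] := hg k.
have {}key := key eps; rewrite eps0 epsr in key; have {}key := key isT Lcu Lcg.
have Ldu := L12B Lcu Lu; have Ldg := L12B Lcg (Lg k).
(* The identity for u minus that for the mollification; by Cauchy-Schwarz its
   square is of order e. *)
have AE : A = - (\int[mu]_x ((conv u (moll eps) x - u x) * (chi x * partial k phi x + gam k x * phi x)) +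
  \int[mu]_x ((conv (g k) (moll eps) x - g k x) * (chi x * phi x))).
  have e1 : A = \int[mu]_x (u x * (chi x * partial k phi x + gam k x * phi x)) +
     \int[mu]_x (g k x * (chi x * phi x)).
    rewrite /A -!RintD.
    - by apply: eq_Rintegral => x _; ring.
    - exact: I0.
    - exact: I0.
    - have := I0 _ _ Lu Lcd; rewrite /intg (_ : _ \o _ = EFin \o (fun x => chi x * u x * partial k phi x))//.
      by apply/funext => x /=; congr (_%:E); ring.
    - have := intgD (I0 _ _ (Lg k) Lcp) (I0 _ _ Lu Lgp).
      rewrite /intg (_ : _ \o _ = EFin \o (fun x => (chi x * g k x + gam k x * u x) * phi x))//.
      by apply/funext => x /=; congr (_%:E); ring.
  rewrite e1 -[LHS]subr0 -key.
  under [X in _ = - (X + _)]eq_Rintegral do rewrite mulrBl.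
  under [X in _ = - (_ + X)]eq_Rintegral do rewrite mulrBl.
  by rewrite !RintB; [ring|exact: I0|exact: I0|exact: I0|exact: I0].
rewrite AE sqrrN; apply: le_trans (sqrD_le _ _) _.
rewrite (_ : e * _ = 2 * (e * N1) + 2 * (e * N2)); last by ring.
apply: lerD; rewrite ler_wpM2l//.
  by apply: le_trans (cauchy_schwarz Ldu L1) _; rewrite ler_wpM2r// sqnorm_ge0.
by apply: le_trans (cauchy_schwarz Ldg Lcp) _; rewrite ler_wpM2r// sqnorm_ge0.
Qed.

End weak_gradient.

(** * Sobolev functions on a domain and their extensions by zero *)

Section sobolev_bridge.
Context {R : realType} {d : nat}.
Local Notation E := 'rV[R]_d.
Local Notation mu := (lebesgue_rV R d).
Implicit Types (f h w u v phi psi chi : E -> R) (U K om : set E) (g gam : 'I_d -> E -> R).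

(** A mollification at a scale below the distance from K to the complement of
    U is a test function of U. *)
Lemma compact_support_approx U K v g : open U -> compact K -> K `<=` U ->
  (forall x, ~ K x -> v x = 0) -> (forall k x, ~ K x -> g k x = 0) ->
  L12 v -> (forall k, L12 (g k)) -> wg U v g ->
  forall e : R, 0 < e -> exists phi, [/\ test_fun U phi,
    sqnorm (fun x => phi x - v x) <= e & forall k, sqnorm (fun x => partial k phi x - g k x) <= e].
Proof.
move=> oU cK KU v0 g0 Lv Lg wv e e0.
have [r r0 hr] := compact_margin cK oU KU.
have [s s0 hs] := conv_moll_L2_fam Lv Lg e0.
pose eps := Num.min (r / 2) s / 2.
have m0 : 0 < Num.min (r / 2) s by rewrite lt_min s0 divr_gt0.
have eps0 : 0 < eps by rewrite divr_gt0.
have : eps < Num.min (r / 2) s by rewrite /eps; lra.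
rewrite lt_min => /andP[epsr epss].
have [|Lcv hv hg] := hs eps; first by rewrite eps0.
have cm := cutoffable_moll (d := d) eps0.
have Iv := Lv.1.
have far x (w : E -> R) f : vanish_out eps w -> (forall x, ~ K x -> f x = 0) ->
    (forall y, K y -> eps < `|y - x|) -> conv f w x = 0.
  move=> vw f0 xK; apply: (conv_zero vw) => y yx; apply: f0 => Ky.
  by have := xK y Ky; rewrite ltNge yx.
(* Points far from K see only zeros of v and g through the kernel. *)
have out x : (exists2 y, K y & `|y - x| <= eps) \/ (forall y, K y -> eps < `|y - x|).
  have [h|h] := pselect (exists2 y, K y & `|y - x| <= eps); [by left|right=> y Ky].
  by rewrite ltNge; apply/negP => yx; apply: h; exists y.
exists (conv v (moll eps)); split=> //; last first.
  move=> k; rewrite (_ : (fun x => _) = (fun x => conv (g k) (moll eps) x - g k x)); first by case: (hg k).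
  apply/funext => x; congr (_ - _).
  case: (out x) => [[y Ky yx]|xK].
    apply: (@partial_conv_wg _ _ U) => // z zx; apply: (hr y) => //.
    by rewrite -(subrKA x) (le_trans (ler_normD _ _))// [`|x - y|]distrC; lra.
  rewrite partial_conv// (far _ _ _ _ v0)// ?oppr0; last first.
    by apply: vanish_out_partial; exact: moll_vanish.
  by rewrite (far _ _ _ _ (g0 k))//; exact: moll_vanish.
have supp x : conv v (moll eps) x != 0 -> exists2 y, K y & `|y - x| <= eps.
  by case: (out x) => // xK; rewrite (far _ _ _ _ v0) ?eqxx//; exact: moll_vanish.
have clsupp x : closure [set x | conv v (moll eps) x != 0] x -> exists2 y, K y & `|y - x| <= 2 * eps.
  move=> /(_ _ (nbhsx_ballx x eps eps0))[z [/supp[y Ky yz]]].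
  rewrite -ball_normE /ball_ /= => xz; exists y => //.
  rewrite -(subrKA z) (le_trans (ler_normD _ _))// [`|z - x|]distrC; lra.
split.
- exact: smooth_conv.
- have /compact_bounded[M [_ hM]] := cK.
  apply: bounded_closed_compact; last exact: closed_closure.
  exists (M + 1 + 2 * eps); split; first exact: num_real.
  move=> N hN x /clsupp[y Ky yx].
  have M1 : M < M + 1 by rewrite ltrDl.
  have /= yM := hM _ M1 y Ky.
  rewrite /= -[x](subrK y) (le_trans (ler_normD _ _))// distrC; lra.
- move=> x /clsupp[y Ky yx]; apply: (hr y) => //; rewrite distrC; lra.
Qed.

Lemma test_fun_partial U phi k : test_fun U phi -> test_fun U (partial k phi).
Proof.
move=> [sp cK KU]; apply: (test_funI (smooth_partial k sp) cK) => // x nx.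
rewrite /partial (@near_eq_derive _ _ _ phi (fun=> 0)) ?(derive_cst (0:R))//.
have : \forall y \near x, ~ closure [set x | phi x != 0] y.
  apply: open_nbhs_nbhs; split => //.
  by apply: closed_openC; exact: closed_closure.
by apply: filterS => y ny; apply/eqP; apply: contra_notT ny => py; exact: subset_closure.
Qed.

Lemma RintI om f phi : (forall x, ~ om x -> phi x = 0) ->
  \int[mu]_(x in om) (f x * phi x) = \int[mu]_x (f x * phi x).
Proof.
move=> p0; rewrite Rintegral_mkcond; apply: eq_Rintegral => x _.
by rewrite patchE; case: ifPn => //; rewrite notin_setE => /p0 ->; rewrite mulr0.
Qed.

Lemma RintP om f phi :
  \int[mu]_(x in om) (f x * phi x) = \int[mu]_x ((f \_ om) x * phi x).
Proof.
rewrite Rintegral_mkcond; apply: eq_Rintegral => x _.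
by rewrite !patchE; case: ifPn => // _; rewrite mul0r.
Qed.

Lemma intg_restrict om f : measurable om -> mu.-integrable om (EFin \o f) -> intg (f \_ om).
Proof.
move=> mom; rewrite (integrable_mkcond _ mom) => h.
rewrite /intg (_ : _ \o _ = (EFin \o f) \_ om)//.
by apply/funext => x /=; rewrite !patchE; case: ifP.
Qed.

Lemma intg_int om f : measurable om -> intg f -> mu.-integrable om (EFin \o f).
Proof. by move=> mom If; apply: (integrableS measurableT). Qed.

Lemma intg_restrictT om f : measurable om -> intg f -> intg (f \_ om).
Proof. by move=> mom If; apply: intg_restrict => //; exact: intg_int. Qed.

Lemma sq_patch om f : (fun x => (f \_ om) x ^+ 2) = (fun x => f x ^+ 2) \_ om.
Proof. by apply/funext => x; rewrite !patchE; case: ifP => // _; rewrite expr0n. Qed.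

Lemma L12_restrict om f : measurable om -> L12 f -> L12 (f \_ om).
Proof.
move=> mom [I1 I2]; split; first exact: intg_restrictT.
by rewrite sq_patch; exact: intg_restrictT.
Qed.

Lemma intg_indic om : measurable om -> (mu om < +oo)%E -> intg (\1_om : E -> R).
Proof.
move=> mom fom; apply: intg_lty; first exact: measurable_indic.
under eq_integral => x _ do rewrite ger0_norm//.
by rewrite integral_indic// setIT.
Qed.

Lemma L2_L12 om u : measurable om -> (mu om < +oo)%E -> L2 om u -> L12 (u \_ om).
Proof.
move=> mom fom [mu_ i2].
have mr : measurable_fun setT (u \_ om) by exact: ((measurable_restrictT u mom).1 mu_).
have I2 : intg (fun x => (u \_ om) x ^+ 2) by rewrite sq_patch; exact: intg_restrict.
split=> //; apply: le_intg (intgD (intg_indic mom fom) I2) => // x.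
rewrite indicE patchE; case: (x \in om) => /=; last by rewrite normr0 expr0n add0r.
rewrite -(real_normK (num_real (u x))); have := sqr_ge0 (`|u x| - 1); have := normr_ge0 (u x).
move: (`|u x|) => a a0 h.
rewrite -subr_ge0 (_ : _ - _ = (a - 1) ^+ 2 + a) ?addr_ge0//; ring.
Qed.

Lemma L12_L2 om u : measurable om -> L12 u -> L2 om u.
Proof.
move=> mom [I1 I2]; split; first by apply: measurable_funTS; exact: intg_meas.
exact: (intg_int mom I2).
Qed.

Lemma L12_loc om u : measurable om -> L12 u -> Defs.locally_integrable om u.
Proof.
move=> mom [I1 I2]; split; first by apply: measurable_funTS; exact: intg_meas.
move=> K KO cK; apply: intg_int => //.
rewrite -[K]setCK; apply: measurableC; apply: open_rV_measurable.
by apply: closed_openC; apply: compact_closed => //; exact: norm_hausdorff.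
Qed.

(** The passage from functions on om to pairs. Extension by zero may create
    jumps at the boundary of om, but test functions of om do not see them. *)
Lemma weak_grad_wg om u G : is_weak_grad om u G ->
  wg om (u \_ om) (fun k => (fun x => G x ord0 k) \_ om).
Proof.
by move=> [_ _ h] phi k tp; have := h phi k tp; rewrite (RintP om u) (RintP om (fun x => G x ord0 k)).
Qed.

Definition vec g : E -> E := fun x => \row_k g k x.

Lemma wg_weak_grad om U u g : open om -> om `<=` U -> L12 u -> (forall k, L12 (g k)) ->
  wg U u g -> is_weak_grad om u (vec g).
Proof.
move=> oom omU Lu Lg wu; have mom := open_rV_measurable oom; split.
- exact: L12_loc.
- move=> k; rewrite (_ : (fun x => _) = g k); first exact: L12_loc.
  by apply/funext => x; rewrite mxE.
move=> phi k tp; rewrite RintI; last by move=> x; exact: (test_fun_out (test_fun_partial k tp)).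
rewrite RintI; last by move=> x; exact: (test_fun_out tp).
rewrite wu; last exact: test_funS tp.
by congr (- _); apply: eq_Rintegral => x _; rewrite mxE.
Qed.

Lemma wg_H1 om U u g : open om -> om `<=` U -> L12 u -> (forall k, L12 (g k)) ->
  wg U u g -> H1 om u.
Proof.
move=> oom omU Lu Lg wu; have mom := open_rV_measurable oom.
split; first exact: L12_L2.
exists (vec g); first exact: (wg_weak_grad oom omU).
move=> k; rewrite (_ : (fun x => _) = g k); first exact: L12_L2.
by apply/funext => x; rewrite mxE.
Qed.

(** The mollifications of h converge to h in L^1 and vanish on the ball. *)
Lemma vanish_ball h c r : 0 < r -> intg h ->
  (forall x eps, 0 < eps < r -> `|x - c| < r -> conv h (moll eps) x = 0) ->
  {ae mu, forall x, ball c r x -> h x = 0}.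
Proof.
move=> r0 Ih h0.
have mB : measurable (ball c r) by exact: measurable_rV_ball.
have p1 : (1 = 1 \/ 1 = 2)%N by left.
have N1 : (Npow 1 h < +oo)%E.
  move/integrableP : Ih => [_]; rewrite /Npow.
  by rewrite (eq_integral (fun x => `|h x|%:E))// => x _; rewrite expr1.
have mh := intg_meas Ih.
have I0 : (\int[mu]_(x in ball c r) `|(h x)%:E| = 0)%E.
  apply/eqP; rewrite eq_le; apply/andP; split; last by apply: integral_ge0.
  apply/lee_addgt0Pr => e e0; rewrite add0e.
  have [s s0 hs] := conv_moll_cvg p1 Ih N1 e0.
  pose eps := Num.min r s / 2.
  have m0 : 0 < Num.min r s by rewrite lt_min s0 r0.
  have eps0 : 0 < eps by rewrite divr_gt0.
  have : eps < Num.min r s by rewrite /eps; lra.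
  rewrite lt_min => /andP[epsr epss].
  have {}hs := hs eps; rewrite eps0 epss in hs; apply: le_trans (hs isT).
  have cm := cutoffable_moll (d := d) eps0.
  have md : measurable_fun setT (fun x => conv h (moll eps) x - h x).
    by apply: measurable_funB => //; apply: smooth_meas; exact: smooth_conv.
  apply: (@le_trans _ _ (\int[mu]_(x in ball c r) (`|conv h (moll eps) x - h x| ^+ 1)%:E)%E).
    apply: ge0_le_integral => //.
    - by apply/measurable_funTS/measurableT_comp => //; exact/measurable_EFinP.
    - by apply/measurable_funTS; exact: measurable_Npow.
    move=> x; rewrite -ball_normE /ball_ /= distrC => xc.
    by rewrite h0// ?eps0// sub0r normrN.
  apply: ge0_subset_integral => //; exact: measurable_Npow.
have mhB : measurable_fun (ball c r) (EFin \o h) by apply/measurable_EFinP; exact: measurable_funTS.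
have := (ae_eq_integral_abs mu mB mhB).1 I0.
by apply: filterS => x hx Bx; have := hx Bx => /= -[].
Qed.

(** The fundamental lemma of the calculus of variations. Translated kernels
    are test functions, so mollifications of h vanish locally; countably many
    balls with rational centres and radii 1/(m+1) cover U. *)
Lemma ae_eq0_test U h : open U -> measurable_fun U h ->
  (forall K, K `<=` U -> compact K -> mu.-integrable K (EFin \o h)) ->
  (forall phi, test_fun U phi -> \int[mu]_(x in U) (h x * phi x) = 0) ->
  {ae mu, forall x, U x -> h x = 0}.
Proof.
move=> oU mh ih h0.
have ballP c r : 0 < r -> [set y | `|y - c| <= 2 * r] `<=` U ->
    mu.-negligible [set x | ball c r x /\ h x <> 0].
  move=> r0 cU; set K := [set y | _] in cU.
  have cK : compact K by exact: closed_rV_ball_compact.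
  have mK : measurable K.
    rewrite -[K]setCK; apply: measurableC; apply: open_rV_measurable.
    by apply: closed_openC; apply: compact_closed => //; exact: norm_hausdorff.
  have Ih : intg (h \_ K) by apply: intg_restrict => //; exact: ih.
  have := @vanish_ball (h \_ K) c r r0 Ih.
  have hc x eps : 0 < eps < r -> `|x - c| < r -> conv (h \_ K) (moll eps) x = 0.
    move=> /andP[eps0 epsr] xc.
    have cm := cutoffable_moll (d := d) eps0.
    have tp : test_fun U (fun y => moll eps (y - x)).
      apply: (@test_funI _ _ _ [set y | `|y - x| <= eps]).
      - have := @smooth_affine R d (moll eps) 1 (- x) cm.1.
        by under eq_fun do rewrite scale1r.
      - exact: closed_rV_ball_compact.
      - by move=> y /= /negP; rewrite -ltNge => yx; rewrite moll_out// ltW.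
      move=> y /= yx; apply: cU; rewrite /K /= -(subrKA x) (le_trans (ler_normD _ _))//; lra.
    have := h0 _ tp; rewrite RintP => <-; apply: eq_Rintegral => y _.
    rewrite !patchE; have [yx|yx] := leP `|y - x| eps; last by rewrite moll_out ?mulr0// ltW.
    have Ky : K y by rewrite /K /= -(subrKA x) (le_trans (ler_normD _ _))//; lra.
    by rewrite !mem_set//; exact: cU.
  move=> /(_ hc) [N [mN N0 hN]]; exists N; split => //.
  apply: subset_trans hN => x [Bx hx] /= /(_ Bx).
  rewrite patchE mem_set//.
  move: Bx; rewrite -ball_normE /ball_ /= /K /= distrC => xc; lra.
pose c (q : 'rV[rat]_d) : E := map_mx ratr q.
(* F n is the exceptional set in the n-th ball of the countable family, if its
   double lies in U. *)
pose F (n : nat) : set E := if @unpickle ('rV[rat]_d * nat)%type n is Some p then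
   if `[< [set y | `|y - c p.1| <= 2 * p.2.+1%:R^-1] `<=` U >] then
     [set x | ball (c p.1) (p.2.+1%:R^-1) x /\ h x <> 0] else set0 else set0.
have negF n : mu.-negligible (F n).
  rewrite /F; case: unpickle => [p|]; last exact: negligible_set0.
  case: asboolP => pU; last exact: negligible_set0.
  by apply: ballP => //; rewrite invr_gt0.
apply: (negligibleS _ (negligible_bigcup negF)) => x /= /not_implyP[Ux hx].
have /nbhs_ballP[e /= e0 eU] := open_nbhs_nbhs (conj oU Ux).
have [m me] : exists m : nat, m.+1%:R^-1 < e / 3.
  exists (Num.bound (e / 3)^-1).
  rewrite -[ltRHS]invrK ltf_pV2 ?posrE ?invr_gt0 ?divr_gt0//.
  apply: lt_trans (archi_boundP _) _; first by rewrite invr_ge0 divr_ge0// ltW.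
  by rewrite ltr_nat.
set r : R := m.+1%:R^-1 in me.
have r0 : 0 < r by rewrite invr_gt0.
have /choice [q hq] : forall k : 'I_d, exists q : rat, `|x ord0 k - ratr q| < r.
  move=> k; have lt2 : x ord0 k - r < x ord0 k + r by lra.
  have [q] := @rat_in_itvoo R _ _ lt2.
  by rewrite in_itv/= => hq; exists q; rewrite ltr_norml; lra.
have xq : `|x - c (\row_k q k)| < r.
  by apply/rV_norm_ltP => // k; rewrite !mxE.
exists (pickle ((\row_k q k), m)) => //; rewrite /F pickleK /=.
rewrite asboolT; first by split => //; rewrite -ball_normE /ball_ /= distrC.
move=> y /=; rewrite -/r => yq; apply: eU; rewrite -ball_normE /ball_ /=.
by rewrite -(subrKA (c (\row_k q k))) (le_lt_trans (ler_normD _ _))// [`|_ - y|]distrC; lra.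
Qed.

(** The difference of two weak gradients is orthogonal to all test functions. *)
Lemma weak_grad_unique om u G G' : open om -> is_weak_grad om u G -> is_weak_grad om u G' ->
  {ae mu, forall x, om x -> G x = G' x}.
Proof.
move=> oom [_ lG hG] [_ lG' hG']; have mom := open_rV_measurable oom.
have H k : {ae mu, forall x, om x -> G x ord0 k - G' x ord0 k = 0}.
  apply: (@ae_eq0_test om (fun x => G x ord0 k - G' x ord0 k)) => //.
  - by apply: measurable_funB; [case: (lG k)|case: (lG' k)].
  - move=> K Kom cK; have mK : measurable K.
      rewrite -[K]setCK; apply: measurableC; apply: open_rV_measurable.
      by apply: closed_openC; apply: compact_closed => //; exact: norm_hausdorff.
    exact: (integrableB mK ((lG k).2 K Kom cK) ((lG' k).2 K Kom cK)).
  move=> phi tp.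
  have e1 := hG phi k tp; have e2 := hG' phi k tp.
  have cK : compact (closure [set x | phi x != 0]) by case: tp.
  set K := closure _ in cK.
  have KU : K `<=` om by case: tp.
  have mK : measurable K.
    rewrite -[K]setCK; apply: measurableC; apply: open_rV_measurable.
    by apply: closed_openC; apply: compact_closed => //; exact: norm_hausdorff.
  have pK x : ~ K x -> phi x = 0.
    move=> nK; apply/eqP; apply: contra_notT nK => px.
    by apply: (@subset_closure _ [set x | phi x != 0]).
  have [M _ hM] := cutoffable_bounded (test_fun_cutoffable tp).
  have mp : measurable_fun setT phi by apply: smooth_meas; case: tp.
  have toK f : \int[mu]_(x in om) (f x * phi x) = \int[mu]_x ((f \_ K) x * phi x).
    rewrite RintI; last by move=> x; exact: (test_fun_out tp).
    by rewrite -RintP RintI.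
  have IG (GG : E -> E) : Defs.locally_integrable om (fun x => GG x ord0 k) ->
      intg (fun x => (((fun x => GG x ord0 k) \_ K) x * phi x)).
    move=> [_ iG]; apply: (intgM_bounded _ mp hM); apply: intg_restrict => //.
    exact: iG.
  rewrite toK.
  under eq_Rintegral => x _.
    rewrite (_ : _ * phi x = ((fun x => G x ord0 k) \_ K) x * phi x - ((fun x => G' x ord0 k) \_ K) x * phi x); first over.
    by rewrite !patchE; case: (x \in K) => /=; rewrite ?mulrBl// !mul0r subr0.
  rewrite RintB; [|exact: IG|exact: IG].
  rewrite -!toK; apply/eqP; rewrite subr_eq0; apply/eqP.
  by apply: oppr_inj; rewrite -e1 -e2.
have : {ae mu, forall x, forall k, om x -> G x ord0 k - G' x ord0 k = 0}.
  by apply: filter_forall => k; exact: H.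
move=> h; apply: filterS h => x hx omx; apply/rowP => k.
by apply/eqP; rewrite -subr_eq0; apply/eqP; exact: (hx k omx).
Qed.

End sobolev_bridge.

(** * The Poincare inequality on convex sets *)

Section poincare.
Context {R : realType} {d : nat}.
Local Notation E := 'rV[R]_d.
Local Notation mu := (lebesgue_rV R d).
Implicit Types (f h w u v phi psi chi : E -> R) (U K S om : set E) (g gam : 'I_d -> E -> R).

Lemma sqnorm_shift f (z : E) : L12 f -> sqnorm (fun x => f (x + z)) = sqnorm f.
Proof.
by move=> [_ /intg_meas m2]; exact: (Rintegral_rV_shift z (f := fun x => f x ^+ 2)).
Qed.

Lemma L12_shift f (z : E) : L12 f -> L12 (fun x => f (x + z)).
Proof. by move=> [I1 I2]; split; [exact: intg_shift|exact: (intg_shift z I2)]. Qed.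

Lemma sq_sum_le n (F : 'I_n -> R) : (\sum_j F j) ^+ 2 <= n%:R * \sum_j F j ^+ 2.
Proof.
elim: n F => [|n IH] F; first by rewrite !big_ord0 expr0n mulr0.
case: n IH F => [|n] IH F; first by rewrite !big_ord_recl !big_ord0 !addr0 mul1r.
rewrite big_ord_recl [X in _ <= _ * X]big_ord_recl -subr_ge0.
set s := \sum_(i < n.+1) F _; set q := \sum_(i < n.+1) _.
have hq : s ^+ 2 <= n.+1%:R * q := IH _.
have n1 : 0 < n.+1%:R :> R by rewrite ltr0n.
have k0 : 0 <= (F ord0 * n.+1%:R - s) ^+ 2 by exact: sqr_ge0.
rewrite -(@pmulr_rge0 _ n.+1%:R)// -[n.+2%:R]natr1; move: n1 hq k0.
set r := n.+1%:R; set a := F ord0 => n1 hq k0.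
have -> : r * ((r + 1) * (a ^+ 2 + q) - (a + s) ^+ 2) =
  (a * r - s) ^+ 2 + (r + 1) * (r * q - s ^+ 2) by ring.
by rewrite addr_ge0// mulr_ge0 ?subr_ge0// addr_ge0// ltW.
Qed.

Definition convex_set S := forall x y (t : R), S x -> S y -> 0 <= t <= 1 -> S (x + t *: (y - x)).

(** For x in this set and S convex, the whole segment from x to x + z lies in
    S. *)
Definition overlap S (z : E) : set E := [set x | S x /\ S (x + z)].

Lemma measurable_overlap S z : measurable S -> measurable (overlap S z).
Proof.
move=> mS; apply: measurableI => //.
by rewrite -[X in measurable X]setTI; exact: measurable_rV_shift.
Qed.

(** Passing to the limit in bounds with an error of order 1/n^2, as produced
    by telescope_step. *)
Lemma le_of_inv_sq (a b c : R) : 0 <= c -> (forall n, (0 < n)%N -> a <= b + c / n%:R ^+ 2) -> a <= b.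
Proof.
move=> c0 h; apply/ler_addgt0Pr => e e0.
set n := (Num.bound (c / e)).+1.
have n0 : 0 < n%:R :> R by rewrite ltr0n.
have n1 : 1 <= n%:R :> R by rewrite ler1n.
apply: (le_trans (h n isT)); rewrite lerD2l ler_pdivrMr ?exprn_gt0//.
have : c / e <= n%:R.
  have ce : 0 <= c / e by rewrite divr_ge0// ltW.
  by apply: ltW; apply: (lt_trans (archi_boundP ce)); rewrite ltr_nat.
rewrite ler_pdivrMr// => hc; apply: (le_trans hc); rewrite mulrC ler_wpM2l ?(ltW e0)//.
by rewrite expr2 ler_peMl // ltW.
Qed.

(** The increment of w is split along n equal parts of the segment and each
    part is replaced by its first-order term. The total error is n times
    1/n^2, squared; only the Taylor bound is needed and no integral along the
    segment. *)
Lemma telescope_step w (M : R) (x z : E) (n : nat) : (0 < n)%N -> smooth w ->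
  (forall k j x, `|partial j (partial k w) x| <= M) ->
  (w (x + z) - w x) ^+ 2 <=
    (2 * d%:R * `|z| ^+ 2 / n%:R) * (\sum_(j < n) \sum_k partial k w (x + (j%:R / n%:R) *: z) ^+ 2) +
    2 * (d%:R * (d%:R * M) * `|z| ^+ 2) ^+ 2 / n%:R ^+ 2.
Proof.
move=> n0 sw hM; have nR : 0 < n%:R :> R by rewrite ltr0n.
pose y (j : nat) := x + (j%:R / n%:R) *: z.
pose p (j : nat) := \sum_k (n%:R^-1 *: z : E) ord0 k * partial k w (y j).
have tel : w (x + z) - w x = \sum_(j < n) (w (y j.+1) - w (y j)).
  rewrite -(big_mkord xpredT (fun j => w (y j.+1) - w (y j))) telescope_sumr//.
  by rewrite /y divff ?gt_eqF// scale1r mul0r scale0r addr0.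
set C := d%:R * (d%:R * M).
have rem (j : nat) : `|w (y j.+1) - w (y j) - p j| <= C * `|z| ^+ 2 / n%:R ^+ 2.
  have := rV_taylor (y j) (n%:R^-1 *: z) sw hM.
  rewrite (_ : y j + _ = y j.+1); last first.
    by rewrite /y -addrA -scalerDl -[X in _ / _ + X]mul1r -mulrDl natr1.
  rewrite normrZ (gtr0_norm (x := n%:R^-1)) ?invr_gt0// exprMn exprVn => h.
  by apply: (le_trans h); rewrite -/C mulrCA mulrC.
rewrite tel (_ : \sum_(j < n) (w (y j.+1) - w (y j)) = \sum_(j < n) p j + \sum_(j < n) (w (y j.+1) - w (y j) - p j)); last first.
  by rewrite -big_split/=; apply: eq_bigr => j _; rewrite addrC subrK.
apply: (le_trans (sqrD_le _ _)); apply: lerD; last first.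
  rewrite -mulrA ler_wpM2l//; apply: (le_trans (sq_sum_le _)).
  apply: (@le_trans _ _ (n%:R * \sum_(j < n) (C * `|z| ^+ 2 / n%:R ^+ 2) ^+ 2)).
    rewrite ler_wpM2l//; apply: ler_sum => j _.
    by rewrite -real_normK ?num_real// lerXn2r ?nnegrE ?rem// (le_trans _ (rem j)).
  rewrite sumr_const card_ord -[X in _ * X]mulr_natl; set a := C * _.
  by rewrite le_eqVlt; apply/orP; left; apply/eqP; field; rewrite gt_eqF.
rewrite (_ : 2 * d%:R * `|z| ^+ 2 / n%:R = 2 * (n%:R * (d%:R * (`|z| / n%:R) ^+ 2))); last first.
  by field; rewrite gt_eqF.
rewrite -(mulrA 2) -(mulrA n%:R) -(mulrA d%:R) ler_wpM2l//; apply: (le_trans (sq_sum_le _)).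
rewrite ler_wpM2l// !mulr_sumr; apply: ler_sum => j _.
apply: (le_trans (sq_sum_le _)); rewrite ler_wpM2l// mulr_sumr; apply: ler_sum => k _.
rewrite exprMn ler_wpM2r ?sqr_ge0// -[leLHS]real_normK ?num_real//.
rewrite lerXn2r ?nnegrE ?divr_ge0//.
rewrite mxE normrM (gtr0_norm (x := n%:R^-1)) ?invr_gt0// mulrC ler_wpM2r//.
exact: rV_norm_coord.
Qed.

Lemma sqnorm_patchD S f h : measurable S -> L12 f -> L12 h ->
  sqnorm ((fun x => f x + h x) \_ S) <= 2 * sqnorm (f \_ S) + 2 * sqnorm (h \_ S).
Proof.
move=> mS Lf Lh; rewrite (_ : _ \_ S = fun x => (f \_ S) x + (h \_ S) x).
  by apply: sqnormD_le; exact: L12_restrict.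
by apply/funext => x; rewrite !patchE; case: ifP => // _; rewrite addr0.
Qed.

Lemma sqnorm_patch_le S f : measurable S -> L12 f -> sqnorm (f \_ S) <= sqnorm f.
Proof.
move=> mS Lf; apply: le_sqnorm => //; first exact: L12_restrict.
by move=> x; rewrite patchE; case: ifP => // _; rewrite normr0.
Qed.

Lemma sqnorm_patch_sub S K f : measurable S -> measurable K -> L12 f -> S `<=` K ->
  sqnorm (f \_ S) <= sqnorm (f \_ K).
Proof.
move=> mS mK Lf SK; apply: le_sqnorm; [exact: L12_restrict..|].
move=> x; rewrite !patchE; case: ifPn => [/set_mem/SK/mem_set->//|_].
by rewrite normr0.
Qed.

(** Integrate telescope_step over the overlap, where by convexity all the
    intermediate points lie in S, use translation invariance for each of them,
    and let n tend to infinity. *)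
Lemma transl_smooth S w (M : R) (z : E) : measurable S -> (mu S < +oo)%E -> convex_set S ->
  smooth w -> L12 w -> (forall k j x, `|partial j (partial k w) x| <= M) ->
  (forall k, L12 ((partial k w) \_ S)) ->
  sqnorm ((fun x => w (x + z) - w x) \_ (overlap S z)) <=
    2 * d%:R * `|z| ^+ 2 * \sum_k sqnorm ((partial k w) \_ S).
Proof.
move=> mS fS cS sw Lw hM LS.
set c0 := 2 * (d%:R * (d%:R * M) * `|z| ^+ 2) ^+ 2.
have V0 : 0 <= \int[mu]_x (\1_S x : R) by apply: Rintegral_ge0.
apply: (@le_of_inv_sq _ _ (c0 * \int[mu]_x (\1_S x : R))).
  by rewrite mulr_ge0// /c0 mulr_ge0 ?sqr_ge0.
move=> n n0; have nR : 0 < n%:R :> R by rewrite ltr0n.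
set K := 2 * d%:R * _.
pose G x := (K / n%:R) * (\sum_(j < n) \sum_k ((partial k w) \_ S) (x + (j%:R / n%:R) *: z) ^+ 2) +
  (c0 / n%:R ^+ 2) * \1_S x.
have IS := intg_indic mS fS.
have Ik (j : 'I_n) k : intg (fun x => ((partial k w) \_ S) (x + (j%:R / n%:R) *: z) ^+ 2).
  exact: (L12_shift _ (LS k)).2.
have Ij (j : 'I_n) : intg (fun x => \sum_k ((partial k w) \_ S) (x + (j%:R / n%:R) *: z) ^+ 2).
  exact: intg_sum.
have I0 : intg (fun x => \sum_(j < n) \sum_k ((partial k w) \_ S) (x + (j%:R / n%:R) *: z) ^+ 2).
  exact: intg_sum.
have -> : K * \sum_k sqnorm ((partial k w) \_ S) + c0 * \int[mu]_x \1_S x / n%:R ^+ 2 =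
  \int[mu]_x G x.
  rewrite /G RintD ?RintZ//; [|exact: intgZ..].
  rewrite Rint_sum//; under [in RHS]eq_bigr => j _.
    rewrite Rint_sum//; under eq_bigr => k _ do rewrite -/(sqnorm (fun x => ((partial k w) \_ S) (x + (j%:R / n%:R) *: z))) sqnorm_shift//.
    over.
  rewrite sumr_const card_ord; congr (_ + _); last by rewrite mulrAC.
  by move: (\sum_k sqnorm _) => s; rewrite -(mulr_natl s n) mulrA divfK// gt_eqF.
have mT := measurable_overlap z mS.
have LD : L12 (fun x => w (x + z) - w x) by apply: L12B => //; exact: L12_shift.
apply: le_Rint; first exact: (L12_restrict mT LD).2.
  by apply: intgD; exact: intgZ.
move=> x; rewrite patchE; case: ifPn => [/set_mem[Sx Sxz]|_]; last first.
  rewrite expr0n/= addr_ge0// mulr_ge0 ?divr_ge0 ?exprn_ge0//.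
  - by rewrite /K !mulr_ge0// exprn_ge0.
  - by apply: sumr_ge0 => j _; apply: sumr_ge0 => k _; exact: sqr_ge0.
  - by rewrite /c0 mulr_ge0// sqr_ge0.
apply: (le_trans (telescope_step x z n0 sw hM)).
rewrite /G indicE mem_set// mulr1 le_eqVlt; apply/orP; left; apply/eqP; congr (_ * _ + _).
apply: eq_bigr => j _; apply: eq_bigr => k _; rewrite patchE mem_set//.
have := cS x (x + z) (j%:R / n%:R) Sx Sxz.
rewrite [x + z - x]addrC addKr; apply.
by rewrite divr_ge0//= ler_pdivrMr// mul1r ler_nat ltnW.
Qed.

Lemma conv_bounded f w (M : R) x : intg f -> cutoffable w -> (forall y, `|w y| <= M) ->
  `|conv f w x| <= M * \int[mu]_y `|f y|.
Proof.
move=> If cw hM; rewrite -RintZ; last exact: intg_norm.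
apply: le_norm_Rint => [||y]; first exact: intg_meas (conv_intg x If cw).
  by apply: intgZ; exact: intg_norm.
by rewrite normrM mulrC ler_wpM2r.
Qed.

Lemma sqnorm_transl f (z : E) : L12 f -> sqnorm (fun x => f (x + z) - f x) <= 4 * sqnorm f.
Proof.
move=> Lf; have := sqnormD_le (L12_shift z Lf) (L12N Lf); rewrite sqnormN (sqnorm_shift z Lf).
by move: (sqnorm f) (sqnorm _) => a b; lra.
Qed.

(** The mollification of u at a scale below the margin r is smooth with
    gradient the mollification of g on S; apply transl_smooth to it and let
    the scale tend to 0. *)
Lemma transl_wg U S u g (z : E) (r : R) : measurable S -> (mu S < +oo)%E -> convex_set S ->
  0 < r -> (forall x y, S x -> `|y - x| <= r -> U y) ->
  L12 u -> (forall k, L12 (g k)) -> wg U u g ->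
  sqnorm ((fun x => u (x + z) - u x) \_ (overlap S z)) <=
    8 * d%:R * `|z| ^+ 2 * \sum_k sqnorm (g k \_ S).
Proof.
move=> mS fS cS r0 SU Lu Lg wu.
have mT := measurable_overlap z mS.
(* The total error is at most B e. *)
set B := 8 * d%:R * d%:R * `|z| ^+ 2 + 8.
have B0 : 0 < B by rewrite ltr_wpDl// !mulr_ge0// exprn_ge0.
apply/ler_addgt0Pr => e' e'0; set e := e' / B.
have e0 : 0 < e by rewrite divr_gt0.
have [s s0 hs] := conv_moll_L2_fam Lu Lg e0.
pose eps := Num.min s r / 2.
have eps0 : 0 < eps by rewrite divr_gt0// lt_min s0.
have epss : eps < s.
  by rewrite /eps ltr_pdivrMr// (le_lt_trans (_ : _ <= s))// ?ge_min ?lexx// mulr_natr mulr2n ltrDl.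
have epsr : eps <= r.
  by rewrite /eps ler_pdivrMr// (@le_trans _ _ r)// ?ge_min ?lexx ?orbT// mulr_natr mulr2n lerDl ltW.
have [|Lw nw ng] := hs eps; first by rewrite eps0.
set w := conv u (moll eps) in Lw nw.
have cm := @cutoffable_moll R d _ eps0.
have pw k x : S x -> partial k w x = conv (g k) (moll eps) x.
  by move=> Sx; apply: (partial_conv_wg (U := U)) => //; [case: Lu|move=> y hy; apply: (SU x) => //; apply: le_trans epsr].
have pwS k : (partial k w) \_ S = (conv (g k) (moll eps)) \_ S.
  by apply/funext => x; rewrite !patchE; case: ifPn => // /set_mem; exact: pw.
have /choice[M hM] : forall kj : 'I_d * 'I_d, exists M, forall x, `|partial kj.2 (partial kj.1 w) x| <= M.
  move=> [k j] /=; have ck := cutoffable_partial k cm.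
  have [M M0 hM] := cutoffable_bounded (cutoffable_partial j ck).
  have Iu : intg u by case: Lu.
  exists (M * \int[mu]_y `|u y|) => x; rewrite /w partial_conv//.
  rewrite (_ : (fun x => - conv u (partial k (moll eps)) x) = - (conv u (partial k (moll eps))))//.
  rewrite /partial deriveN; last by apply: diff_derivable; case: (conv_diff x Iu ck).
  rewrite -/(partial j (conv u (partial k (moll eps))) x) partial_conv// opprK.
  exact: (conv_bounded _ Iu (cutoffable_partial j ck)).
pose Mx := \sum_kj `|M kj|.
have hMx k j x : `|partial j (partial k w) x| <= Mx.
  apply: (le_trans (hM (k, j) x)); apply: (le_trans (ler_norm _)).
  by rewrite /Mx (bigD1 (k, j))//= lerDl sumr_ge0.
have sw : smooth w by apply: smooth_conv => //; case: Lu.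
have hk k : sqnorm ((partial k w) \_ S) <= 2 * sqnorm (g k \_ S) + 2 * e.
  have [Lc nc] := ng k.
  rewrite pwS (_ : conv (g k) (moll eps) = fun x => g k x + (conv (g k) (moll eps) x - g k x)); last first.
    by apply/funext => x; rewrite addrC subrK.
  have LB := L12B Lc (Lg k).
  apply: (le_trans (sqnorm_patchD mS (Lg k) LB)); rewrite lerD2l ler_wpM2l//.
  exact: (le_trans (sqnorm_patch_le mS LB)).
have LSk k : L12 ((partial k w) \_ S).
  by rewrite pwS; apply: L12_restrict => //; case: (ng k).
have hw := transl_smooth z mS fS cS sw Lw hMx LSk.
pose q x := u x - w x.
have Lq : L12 q by exact: L12B.
have nq : sqnorm q <= e.
  by apply: le_trans nw; rewrite -sqnormN; apply: le_sqnorm; [exact: L12N|exact: L12B|move=> x; rewrite /q opprB].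
have -> : (fun x => u (x + z) - u x) = (fun x => (w (x + z) - w x) + (q (x + z) - q x)).
  apply/funext => x; rewrite /q; move: (u (x + z)) (u x) (w (x + z)) (w x) => a b c b'.
  by clear; ring.
have Lqz := L12_shift z Lq.
apply: (le_trans (sqnorm_patchD mT (L12B (L12_shift z Lw) Lw) (L12B Lqz Lq))).
have h1 : sqnorm ((fun x => q (x + z) - q x) \_ (overlap S z)) <= 4 * e.
  apply: (le_trans (sqnorm_patch_le mT (L12B Lqz Lq))).
  by apply: (le_trans (sqnorm_transl z Lq)); rewrite ler_wpM2l.
have h2 : \sum_k sqnorm ((partial k w) \_ S) <= 2 * (\sum_k sqnorm (g k \_ S)) + 2 * (d%:R * e).
  apply: (@le_trans _ _ (\sum_k (2 * sqnorm (g k \_ S) + 2 * e))); first exact: ler_sum.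
  by rewrite big_split/= -mulr_sumr sumr_const card_ord -(mulr_natl (2 * e)) mulrCA.
have h3 : 2 * d%:R * `|z| ^+ 2 * \sum_k sqnorm ((partial k w) \_ S) <=
   2 * d%:R * `|z| ^+ 2 * (2 * (\sum_k sqnorm (g k \_ S)) + 2 * (d%:R * e)).
  by rewrite ler_wpM2l// !mulr_ge0// exprn_ge0.
have e'E : e' = B * e by rewrite /e mulrC divfK// gt_eqF.
rewrite e'E /B; move: hw h1 h3; clearbody q w; clear => hw h1 h3.
move: (sqnorm _) hw (sqnorm _) h1 h3 => a1 hw a2 h1.
move: (`|z| ^+ 2) (\sum_k sqnorm (g k \_ S)) (\sum_k _) hw => z2 s1 s2 hw h3; lra.
Qed.

(** As u has mean zero on S, V u(x)^2 is at most the integral over y in S of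
    (u(x) - u(y))^2. Integrating over x in S, substituting y = x + z and
    exchanging the integrals, the inner integral is bounded by transl_wg, and
    only |z| < D contributes. *)
Lemma poincare_convex U S u g (D r V : R) : measurable S -> mu S = V%:E -> convex_set S ->
  (forall x y, S x -> S y -> `|y - x| < D) -> 0 < D ->
  0 < r -> (forall x y, S x -> `|y - x| <= r -> U y) ->
  L12 u -> (forall k, L12 (g k)) -> wg U u g -> \int[mu]_x (u \_ S) x = 0 ->
  V * sqnorm (u \_ S) <= 8 * d%:R * (2 * D) ^+ d * D ^+ 2 * \sum_k sqnorm (g k \_ S).
Proof.
move=> mS mSV cS SD D0 r0 SU Lu Lg wu u0.
have fS : (mu S < +oo)%E by rewrite mSV ltry.
have LuS : L12 (u \_ S) by exact: L12_restrict.
have IS := intg_indic mS fS.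
have VE : \int[mu]_x (\1_S x : R) = V.
  by rewrite /Rintegral integral_indic// setIT mSV.
pose F (p : E * E) : R := \1_S p.1 * \1_S p.2 * (u p.2 - u p.1) ^+ 2.
have mu1 : measurable_fun setT u by exact: L12_meas.
have mF : measurable_fun setT F.
  have m1 (i : E * E -> E) : measurable_fun setT i -> measurable_fun setT (fun p => \1_S (i p) : R).
    move=> mi; have mI : measurable_fun setT (\1_S : E -> R) by exact: measurable_indic.
    exact: (measurableT_comp mI mi).
  have mu' (i : E * E -> E) : measurable_fun setT i -> measurable_fun setT (fun p => u (i p)).
    by move=> mi; exact: measurableT_comp.
  apply: measurable_funM; first by apply: measurable_funM; apply: m1.
  by apply: measurable_funX; apply: measurable_funB; apply: mu'.
have F0 p : 0 <= F p by rewrite /F mulr_ge0 ?sqr_ge0// mulr_ge0.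
have mFE : measurable_fun setT (EFin \o F) by exact/measurable_EFinP.
have F0E p : (0 <= (EFin \o F) p)%E by rewrite lee_fin.
(* Expanding the square, the mixed term drops out because u has mean zero on
   S. *)
have stepA : ((V * sqnorm (u \_ S))%R%:E <= \int[mu]_x \int[mu]_y (EFin \o F) (x, y))%E.
  rewrite /sqnorm -RintZ; last exact: LuS.2.
  rewrite intg_EFin; [|by apply: intgZ; exact: LuS.2|].
    apply: ge0_le_integral => //.
    - by move=> x _; rewrite lee_fin mulr_ge0 ?sqr_ge0// -VE; exact: Rintegral_ge0.
    - by apply/measurable_EFinP; apply: measurable_funM => //; apply: measurable_funX; exact: L12_meas.
    - exact: (measurable_fun_fubini_tonelli_F (m2 := @lebS R d) _ mFE F0E).
    move=> x _; rewrite patchE; case: ifPn => [xS|_]; last first.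
      by rewrite expr0n mulr0; apply: integral_ge0 => y _.
    have L1 : intg (fun y => (u \_ S) y ^+ 2) := LuS.2.
    have L2' : intg (fun y => (- 2 * u x) * (u \_ S) y) by apply: intgZ; case: LuS.
    have L3 : intg (fun y => u x ^+ 2 * \1_S y) by exact: intgZ.
    have FE : (fun y => F (x, y)) = fun y => (u \_ S) y ^+ 2 + (- 2 * u x) * (u \_ S) y + u x ^+ 2 * \1_S y.
      apply/funext => y; rewrite /F /= indicE xS patchE indicE; case: ifP => _ /=; last by rewrite !mulr0 mul0r expr0n !addr0.
      move: (u x) (u y) => a b; ring.
    rewrite -(@intg_EFin R d (fun y => F (x, y))) //; last by rewrite FE; do ?apply: intgD.
    rewrite lee_fin FE !RintD//; last exact: intgD.
    rewrite RintZ// (RintZ (-2 * u x)); last by case: LuS.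
    by rewrite u0 mulr0 addr0 VE mulrC lerDr; exact: sqnorm_ge0.
  by move=> x; rewrite mulr_ge0 ?sqr_ge0// -VE; exact: Rintegral_ge0.
pose G (p : E * E) : R := F (p.1, p.2 + p.1).
have mG : measurable_fun setT (EFin \o G).
  apply/measurable_EFinP; apply: (measurableT_comp mF).
  have h := measurable_rV_add (@measurable_snd _ _ E E) (@measurable_fst _ _ E E).
  exact: (measurable_fun_pair (@measurable_fst _ _ E E) h).
have G0 p : (0 <= (EFin \o G) p)%E by rewrite lee_fin; exact: F0.
(* The substitution y = z + x. *)
have stepB : (\int[mu]_x \int[mu]_y (EFin \o F) (x, y) = \int[mu]_z \int[mu]_x (EFin \o G) (x, z))%E.
  rewrite -(lebesgue_rV_tonelli2 mG G0); apply: eq_integral => x _.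
  rewrite -(ge0_integral_rV_shift x (f := fun y => (EFin \o F) (x, y)))//.
  by apply/measurable_EFinP; apply: (measurableT_comp mF); exact: measurable_pair1.
set A := \sum_k _.
have A0 : 0 <= A by apply: sumr_ge0 => k _; exact: sqnorm_ge0.
have [W WE W0] : exists2 W, W = 8 * d%:R * D ^+ 2 * A & 0 <= W.
  by exists (8 * d%:R * D ^+ 2 * A) => //; rewrite !mulr_ge0// ltW.
(* For |z| >= D the overlap is empty, since S has diameter at most D. *)
have stepC : (\int[mu]_z \int[mu]_x (EFin \o G) (x, z) <= (W * (2 * D) ^+ d)%R%:E)%E.
  apply: (@le_trans _ _ (\int[mu]_z (W * \1_(ball (0 : E) D) z)%R%:E)%E).
    apply: ge0_le_integral => //.
    - by move=> z _; apply: integral_ge0.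
    - exact: (measurable_fun_fubini_tonelli_G (m1 := @lebS R d) _ mG G0).
    - apply/measurable_EFinP; apply: measurable_funM => //.
      by apply: measurable_indic; exact: measurable_rV_ball.
    move=> z _.
    have LD : L12 (fun x => u (x + z) - u x) by apply: L12B => //; exact: L12_shift.
    have mT := measurable_overlap z mS.
    have LT := L12_restrict mT LD.
    have GE : (fun x => (EFin \o G) (x, z)) = fun x => ((((fun x => u (x + z) - u x) \_ (overlap S z)) x) ^+ 2)%:E.
      apply/funext => x; rewrite /G /F /= [z + x]addrC patchE !indicE; congr EFin.
      have [xT|xT] := boolP (x \in overlap S z).
        by have [Sx Sxz] := set_mem xT; rewrite !mem_set// !mul1r.
      rewrite expr0n/=; have [xS|] := boolP (x \in S); last by rewrite !mul0r.
      have [xzS|] := boolP (x + z \in S); last by rewrite mulr0 mul0r.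
      by case/negP: xT; apply: mem_set; split; exact: set_mem.
    rewrite GE -intg_EFin; [|exact: LT.2|by move=> x; exact: sqr_ge0].
    rewrite lee_fin -/(sqnorm _).
    have [zD|zD] := ltP `|z| D.
      rewrite indicE mem_set; last by rewrite -ball_normE /ball_ /= sub0r normrN.
      rewrite mulr1; apply: (le_trans (transl_wg z mS fS cS r0 SU Lu Lg wu)).
      by rewrite WE ler_wpM2r// ler_wpM2l ?mulr_ge0// lerXn2r ?nnegrE ?(ltW D0) ?(ltW zD).
    rewrite (_ : overlap S z = set0); last first.
      apply/seteqP; split => // x [Sx Sxz]; have := SD _ _ Sx Sxz.
      by rewrite addrAC subrr add0r ltNge zD.
    rewrite (_ : sqnorm _ = 0); first by rewrite mulr_ge0.
    by rewrite /sqnorm -[RHS](@Rint0 R d); apply: eq_Rintegral => x _; rewrite patch_set0 expr0n.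
  under eq_integral do rewrite EFinM.
  rewrite ge0_integralZl_EFin//; last first.
    by apply/measurable_EFinP; apply: measurable_indic; exact: measurable_rV_ball.
  rewrite integral_indic//; last exact: measurable_rV_ball.
  by rewrite setIT lebesgue_rV_ball// -EFinM lee_fin mulr_natl.
rewrite -lee_fin; apply: (le_trans stepA); rewrite stepB; apply: (le_trans stepC).
by rewrite lee_fin le_eqVlt; apply/orP; left; apply/eqP; rewrite WE; clear; ring.
Qed.

End poincare.

(** * The Caccioppoli inequality *)

Section caccioppoli.
Context {R : realType} {d : nat}.
Local Notation E := 'rV[R]_d.
Local Notation mu := (lebesgue_rV R d).
Implicit Types (f h w u v phi psi chi : E -> R) (U K S om W Z : set E) (g gam : 'I_d -> E -> R).

(** The mollified indicator function of W. The last two conditions say where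
    it is constant, together with the vanishing of its gradient there. *)
Lemma cutoff_exists : exists2 C : R, 0 < C & forall W (e : R), measurable W -> (mu W < +oo)%E -> 0 < e ->
  exists eta : E -> R, [/\ smooth eta, (forall x, 0 <= eta x <= 1),
    (forall k x, `|partial k eta x| <= C / e),
    (forall x, (forall z, `|z| <= e -> W (x + z)) -> eta x = 1 /\ forall k, partial k eta x = 0) &
    (forall x, (forall z, `|z| <= e -> ~ W (x + z)) -> eta x = 0 /\ forall k, partial k eta x = 0)].
Proof.
have [C C0 hC] := @partial_moll_bound R d.
exists (C * 4 ^+ d); first by rewrite mulr_gt0// exprn_gt0.
move=> W e mW fW e0; have IW := intg_indic mW fW.
have cm := @cutoffable_moll R d _ e0.
have pE k x : partial k (conv (\1_W) (moll e)) x = - conv (\1_W) (partial k (moll e)) x.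
  by rewrite partial_conv.
(* Where the indicator function is constant at the scale e, so is its
   mollification, and the gradient vanishes because the derivative of the
   kernel has integral 0. *)
have near x c : (forall z, `|z| <= e -> \1_W (x + z) = c :> R) ->
    conv (\1_W) (moll e) x = c /\ forall k, partial k (conv (\1_W) (moll e)) x = 0.
  move=> hx; split.
    apply/eqP; rewrite -subr_eq0 -normr_le0; apply: conv_moll_near => // z ze.
    by rewrite hx ?subrr ?normr0// ltW.
  move=> k; have ck := cutoffable_partial k cm.
  rewrite pE convE// (_ : (fun z => _) = fun z => c * partial k (moll e) z).
    by rewrite RintZ ?int_partial ?mulr0 ?oppr0//; exact: cutoffable_intg.
  apply/funext => z; have [ze|ze] := leP `|z| e; first by rewrite hx.
  by rewrite (vanish_out_partial _ (moll_vanish e0)) ?mulr0.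
exists (conv (\1_W) (moll e)); split.
- exact: smooth_conv.
- move=> x; rewrite convE//; apply/andP; split.
    by apply: Rintegral_ge0 => z _; rewrite mulr_ge0// moll_ge0.
  rewrite -[leRHS](@moll_int R d _ e0); apply: le_Rint.
  + have := intg_shift x (conv_intg x IW cm); congr intg; apply/funext => z /=.
    by rewrite addrK [z + x]addrC.
  + exact: cutoffable_intg.
  + move=> z; rewrite ler_piMl ?moll_ge0// indicE; by case: (_ \in _).
- move=> k x; rewrite pE normrN /conv.
  have ck := cutoffable_partial k cm.
  pose B : set E := ball x (2 * e); have mB : measurable B by exact: measurable_rV_ball.
  have e2 : 0 < 2 * e by rewrite mulr_gt0.
  have muB : mu B = ((2 * e *+ 2) ^+ d)%:E by exact: lebesgue_rV_ball.
  have IB : intg (\1_B : E -> R) by apply: intg_indic => //; rewrite muB ltry.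
  apply: (@le_trans _ _ (\int[mu]_y (C / (e * e ^+ d) * \1_B y))).
    apply: le_norm_Rint.
    + exact: intg_meas (conv_intg x IW ck).
    + exact: intgZ.
    have D0 : 0 <= C / (e * e ^+ d) by rewrite divr_ge0 ?(ltW C0)// mulr_ge0 ?exprn_ge0 ?(ltW e0).
    move=> y; have [yB|yB] := boolP (y \in B); last first.
      rewrite (_ : partial k (moll e) (y - x) = 0); first by rewrite mulr0 normr0 mulr_ge0.
      apply: (vanish_out_partial _ (moll_vanish e0)); move: yB; rewrite notin_setE /B -ball_normE /ball_ /=.
      by rewrite -[`|x - y|]normrN opprB => /negP; rewrite -leNgt; apply: lt_le_trans; rewrite mulr_natl mulr2n ltrDl.
    rewrite [\1_B y]indicE yB mulr1 normrM; apply: le_trans (hC e (y - x) k e0).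
    by rewrite ler_piMl// indicE; case: (_ \in _); rewrite ?normr1 ?normr0.
  rewrite RintZ// /Rintegral integral_indic// setIT muB /= le_eqVlt; apply/orP; left; apply/eqP.
  rewrite -mulr_natl mulrA -natrM exprMn; field.
  by rewrite gt_eqF// expf_neq0// gt_eqF.
- by move=> x hx; apply: near => z ze; rewrite indicE mem_set//; exact: hx.
- by move=> x hx; apply: near => z ze; rewrite indicE memNset//; exact: hx.
Qed.

Definition nbhd Z (r : R) : set E := [set x | exists2 y, Z y & `|x - y| < r].

Lemma open_nbhd Z r : open (nbhd Z r).
Proof.
rewrite (_ : nbhd Z r = \bigcup_(y in Z) ball y r); first by apply: bigcup_open => y _; exact: ball_open.
by apply/seteqP; split => x [y Zy]; rewrite -?ball_normE /ball_ /= => h; exists y => //; rewrite -?ball_normE /ball_ /= distrC.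
Qed.

Lemma measurable_nbhd Z r : measurable (nbhd Z r).
Proof. by apply: open_rV_measurable; exact: open_nbhd. Qed.

Lemma nbhd_le Z (r s : R) : r <= s -> nbhd Z r `<=` nbhd Z s.
Proof. by move=> rs x [y Zy h]; exists y => //; exact: lt_le_trans rs. Qed.

Lemma nbhd_add Z (r s : R) (x y : E) : nbhd Z r x -> `|y - x| <= s -> nbhd Z (r + s) y.
Proof.
move=> [z Zz h] g'; exists z => //; rewrite -[y - z](subrKA x) addrC.
by apply: (le_lt_trans (ler_normD _ _)); exact: ltr_leD.
Qed.

Lemma dotE (x y : E) : dot x y = (x *m y^T) ord0 ord0.
Proof. by rewrite /dot mxE; apply: eq_bigr => k _; rewrite mxE. Qed.

Lemma dotC (x y : E) : dot x y = dot y x.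
Proof. by rewrite /dot; apply: eq_bigr => k _; rewrite mulrC. Qed.

Lemma dotDl (x y z : E) : dot (x + y) z = dot x z + dot y z.
Proof. by rewrite !dotE mulmxDl mxE. Qed.

Lemma dotZl a (x z : E) : dot (a *: x) z = a * dot x z.
Proof. by rewrite !dotE -scalemxAl mxE. Qed.

Lemma dotDr (x y z : E) : dot x (y + z) = dot x y + dot x z.
Proof. by rewrite ![dot x _]dotC dotDl. Qed.

Lemma dotZr a (x z : E) : dot x (a *: z) = a * dot x z.
Proof. by rewrite ![dot x _]dotC dotZl. Qed.

Lemma dot_ge0 (x : E) : 0 <= dot x x.
Proof. by apply: sumr_ge0 => k _; rewrite -expr2 sqr_ge0. Qed.

Lemma enorm2 (x : E) : enorm x ^+ 2 = dot x x.
Proof. by rewrite /enorm sqr_sqrtr// dot_ge0. Qed.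

Lemma dot_delta (M : 'M[R]_d) k l :
  dot ((delta_mx ord0 k : E) *m M^T) (delta_mx ord0 l) = M l k.
Proof.
rewrite dotE -rowE /row; rewrite mxE (bigD1 l)//= big1 ?addr0.
  by rewrite !mxE !eqxx mulr1.
by move=> i il; rewrite !mxE (negbTE il) andbF mulr0.
Qed.

Section coeff.
Variables (om : set E) (A : E -> 'M[R]_d) (alpha beta : R).
Hypothesis mA : forall k l, measurable_fun om (fun x => A x k l).
Hypothesis symA : forall x, om x -> (A x)^T = A x.
Hypothesis ellA : forall x xi : E, om x ->
  alpha * enorm xi ^+ 2 <= dot (xi *m (A x)^T) xi <= beta * enorm xi ^+ 2.
Hypothesis alpha0 : 0 < alpha.
Hypothesis beta0 : 0 <= beta.
Hypothesis oom : open om.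
Hypothesis fom : (mu om < +oo)%E.

Let a x (xi zeta : E) : R := dot (xi *m (A x)^T) zeta.

Lemma aformC x xi zeta : om x -> a x xi zeta = a x zeta xi.
Proof.
move=> ox; rewrite /a [RHS]dotC !dotE trmx_mul trmxK mulmxA.
by rewrite (symA ox).
Qed.

Lemma aform_expand x xi zeta (t : R) : om x ->
  a x (xi + t *: zeta) (xi + t *: zeta) = a x xi xi + 2 * t * a x xi zeta + t ^+ 2 * a x zeta zeta.
Proof.
move=> ox; have := aformC xi zeta ox; rewrite /a mulmxDl -scalemxAl !dotDl !dotDr !dotZl !dotZr => ->.
ring.
Qed.

Lemma aform_ge0 x xi : om x -> 0 <= a x xi xi.
Proof.
by move=> ox; have /andP[h _] := ellA xi ox; apply: le_trans h; rewrite mulr_ge0 ?sqr_ge0// ltW.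
Qed.

(** Polarisation: the form is nonnegative at the sum and the difference of two
    coordinate vectors, on each of which it is at most beta. *)
Lemma coeff_bound x k l : om x -> `|A x k l| <= beta.
Proof.
move=> ox; pose e k : E := delta_mx ord0 k.
have q1 k' : a x (e k') (e k') <= beta.
  have /andP[_ h] := ellA (e k') ox; apply: (le_trans h).
  by have := dot_delta 1%:M k' k'; rewrite trmx1 mulmx1 enorm2 => ->; rewrite mxE eqxx mulr1.
have h1 := aform_ge0 (e l + 1 *: e k) ox.
have h2 := aform_ge0 (e l + (-1) *: e k) ox.
rewrite aform_expand// in h1; rewrite aform_expand// in h2.
have hk := q1 k; have hl := q1 l.
have aE : a x (e l) (e k) = A x k l by exact: dot_delta.
rewrite aE in h1 h2; rewrite ler_norml; apply/andP; split; lra.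
Qed.

(** Extension by zero, so that products with globally defined gradients are
    globally defined. *)
Definition coeff_ext (l k : 'I_d) : E -> R := (fun x => A x l k) \_ om.

(** The components of the vector A g. *)
Definition flux g (l : 'I_d) (x : E) : R := \sum_k g k x * coeff_ext l k x.

Lemma mom : measurable om. Proof. exact: open_rV_measurable. Qed.

Lemma coeff_ext_meas l k : measurable_fun setT (coeff_ext l k).
Proof. by apply/(measurable_restrictT _ mom). Qed.

Lemma coeff_ext_bound l k x : `|coeff_ext l k x| <= beta.
Proof.
by rewrite /coeff_ext patchE; case: ifPn => [/set_mem/coeff_bound->//|_]; rewrite normr0.
Qed.

Lemma flux_L12 g l : (forall k, L12 (g k)) -> L12 (flux g l).
Proof.
move=> Lg; apply: L12_sum => k; apply: (L12M_bounded (Lg k) (coeff_ext_meas l k)).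
exact: coeff_ext_bound.
Qed.

Lemma flux_in g l x : om x -> flux g l x = ((vec g x) *m (A x)^T) ord0 l.
Proof.
by move=> ox; rewrite /flux mxE; apply: eq_bigr => k _; rewrite !mxE /coeff_ext patchE mem_set.
Qed.

Lemma flux_out g l x : ~ om x -> flux g l x = 0.
Proof.
by move=> ox; rewrite /flux big1// => k _; rewrite /coeff_ext patchE memNset// mulr0.
Qed.

(** The integrand A g . g of the energy form. *)
Definition fluxdot g g' x : R := \sum_l flux g l x * g' l x.

Lemma fluxdot_in g g' x : om x -> fluxdot g g' x = a x (vec g x) (vec g' x).
Proof.
by move=> ox; rewrite /fluxdot /a /dot; apply: eq_bigr => l _; rewrite flux_in// [vec g' x _ _]mxE.
Qed.

Lemma fluxdot_out g g' x : ~ om x -> fluxdot g g' x = 0.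
Proof. by move=> ox; rewrite /fluxdot big1// => l _; rewrite flux_out// mul0r. Qed.

Lemma fluxdot_intg g g' : (forall k, L12 (g k)) -> (forall k, L12 (g' k)) -> intg (fluxdot g g').
Proof. by move=> Lg Lh; apply: intg_sum => l; apply: L12_intgM => //; exact: flux_L12. Qed.

(** The equation is tested with smooth functions only; harm_test extends this
    to Sobolev functions with compact support. *)
Definition harm u g := [/\ L12 u, (forall k, L12 (g k)), wg om u g &
  forall phi, test_fun om phi -> \int[mu]_x fluxdot g (fun l => partial l phi) x = 0].

(** Sobolev functions with compact support are limits of test functions, and
    the flux is square integrable. *)
Lemma harm_test u g v g' K : harm u g -> compact K -> K `<=` om ->
  (forall x, ~ K x -> v x = 0) -> (forall k x, ~ K x -> g' k x = 0) ->
  L12 v -> (forall k, L12 (g' k)) -> wg om v g' -> \int[mu]_x fluxdot g g' x = 0.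
Proof.
move=> [Lu Lg wu hu] cK Kom vK hK Lv Lh wv.
apply: (@small_eq0 R _ (d%:R * \sum_l sqnorm (flux g l))) => e e0.
have [phi [tphi _ hphi]] := compact_support_approx oom cK Kom vK hK Lv Lh wv e0.
have Lp l : L12 (partial l phi).
  by apply: cutoffable_L12; apply: cutoffable_partial; exact: test_fun_cutoffable tphi.
have Lhp l : L12 (fun x => g' l x - partial l phi x) by exact: L12B.
have -> : \int[mu]_x fluxdot g g' x = \sum_l \int[mu]_x (flux g l x * (g' l x - partial l phi x)).
  rewrite -[LHS]subr0 -[X in _ - X](hu phi tphi) -RintB; [|exact: fluxdot_intg..].
  rewrite -Rint_sum; last by move=> l; apply: L12_intgM => //; exact: flux_L12.
  apply: eq_Rintegral => x _; rewrite /fluxdot -sumrB; apply: eq_bigr => l _.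
  by rewrite mulrBr.
apply: (le_trans (sq_sum_le _)); rewrite mulrCA ler_wpM2l// mulr_sumr; apply: ler_sum => l _.
apply: (le_trans (cauchy_schwarz (flux_L12 l Lg) (Lhp l))).
rewrite mulrC ler_wpM2r ?sqnorm_ge0//; apply: le_trans (hphi l).
apply: le_sqnorm => //; first exact: L12B.
by move=> x; rewrite -normrN opprB.
Qed.

Lemma sum_sq_vec g x : dot (vec g x) (vec g x) = \sum_k g k x ^+ 2.
Proof. by rewrite /dot; apply: eq_bigr => k _; rewrite mxE expr2. Qed.

(** Young inequality in disguise: expand the nonnegative form at eta g + 2 u p
    and use the ellipticity bounds. Here p stands for the gradient of eta. *)
Lemma caccioppoli_pointwise g (eta : E -> R) (u1 : R) (p : 'I_d -> E -> R) x : om x ->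
  alpha / 2 * (eta x ^+ 2 * \sum_k g k x ^+ 2) <=
  fluxdot g (fun k x => eta x ^+ 2 * g k x + 2 * eta x * u1 * p k x) x +
  2 * beta * u1 ^+ 2 * \sum_k p k x ^+ 2.
Proof.
move=> ox; rewrite fluxdot_in//.
have -> : vec (fun k x => eta x ^+ 2 * g k x + 2 * eta x * u1 * p k x) x =
    (eta x ^+ 2) *: vec g x + (2 * eta x * u1) *: vec p x.
  by apply/rowP => k; rewrite !mxE.
rewrite /a dotDr !dotZr -/(a x (vec g x) (vec g x)) -/(a x (vec g x) (vec p x)).
have := aform_ge0 (eta x *: vec g x + (2 * u1) *: vec p x) ox.
rewrite aform_expand// /a -!scalemxAl !dotZl !dotZr -/(a x (vec g x) (vec g x)) -/(a x (vec g x) (vec p x)).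
rewrite -/(a x (vec p x) (vec p x)).
have /andP[hg _] := ellA (vec g x) ox; have /andP[_ hp] := ellA (vec p x) ox.
rewrite enorm2 sum_sq_vec -/(a x _ _) in hg; rewrite enorm2 sum_sq_vec -/(a x _ _) in hp.
have e2 : 0 <= eta x ^+ 2 by exact: sqr_ge0.
have u2 : 0 <= u1 ^+ 2 by exact: sqr_ge0.
have {}hg := ler_wpM2l e2 hg; have {}hp := ler_wpM2l u2 hp.
move: hg hp; clear.
move: (a x _ _) (a x _ _) (a x _ _) (\sum_k _) (\sum_k _) (eta x) => agg agp app sg sp e; nra.
Qed.

(** The equation is tested with eta^2 u, where eta is 1 on the
    r-neighbourhood, 0 outside the (r + delta)-neighbourhood and has gradient
    of order 1/delta; caccioppoli_pointwise is then integrated. *)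
Lemma caccioppoli : exists2 C : R, 0 < C & forall u g Z (r delta : R) K,
  harm u g -> compact K -> K `<=` om -> 0 < delta -> nbhd Z (r + delta) `<=` K ->
  \sum_k sqnorm (g k \_ (nbhd Z r)) <= C / delta ^+ 2 * sqnorm (u \_ (nbhd Z (r + delta))).
Proof.
have [C C0 hC] := cutoff_exists.
exists (64 * beta * d%:R * C ^+ 2 / alpha + 1).
  by rewrite ltr_wpDl// divr_ge0 ?(ltW alpha0)// !mulr_ge0// ltW.
move=> u g Z r delta K hu cK Kom d0 NK; have [Lu Lg wu tu] := hu.
set N1 := nbhd Z r; set N2 := nbhd Z (r + delta) in NK *.
have mN1 : measurable N1 by exact: measurable_nbhd.
have mN2 : measurable N2 by exact: measurable_nbhd.
have N12 : N1 `<=` N2 by apply: nbhd_le; rewrite lerDl ltW.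
(* Mollifying at the scale delta / 4 the indicator function of the
   neighbourhood of radius r + delta / 2 leaves room on both sides. *)
pose W := nbhd Z (r + delta / 2); have mW : measurable W by exact: measurable_nbhd.
have fW : (mu W < +oo)%E.
  apply: le_lt_trans fom; apply: le_measure; rewrite ?inE//; first exact: mom.
  apply: subset_trans (Kom); apply: subset_trans NK; apply: nbhd_le; lra.
have d4 : 0 < delta / 4 by rewrite divr_gt0.
have [eta [seta eta01 deta eta1 eta0]] := hC W _ mW fW d4.
have eta_in x : N1 x -> eta x = 1.
  move=> Nx; apply: (eta1 x _).1 => z hz; have := nbhd_add Nx (y := x + z) (s := delta / 4).
  rewrite addrAC subrr add0r => /(_ hz); apply: nbhd_le; lra.
have eta_out x : ~ N2 x -> eta x = 0 /\ forall k, partial k eta x = 0.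
  move=> Nx; apply: eta0 => z hz Wx; apply: Nx.
  have := nbhd_add Wx (y := x) (s := delta / 4); rewrite opprD addrA subrr add0r normrN => /(_ hz).
  apply: nbhd_le; lra.
pose chi x := eta x * eta x.
have schi : smooth chi by exact: smoothM.
have dE k : partial k chi = fun x => 2 * eta x * partial k eta x.
  rewrite partialM; [|by move=> x; exact: smooth_diff..].
  by apply/funext => x; move: (eta x) (partial k eta x) => b c; ring.
pose M := 1 + 2 * (C / (delta / 4)).
have hM0 : 0 <= C / (delta / 4) by rewrite divr_ge0 ?(ltW C0) ?(ltW d4).
have chi1 x : `|chi x| <= M.
  have /andP[e0 e1] := eta01 x; rewrite ger0_norm ?mulr_ge0// /chi.
  by apply: (@le_trans _ _ 1); [exact: mulr_ile1|rewrite lerDl mulr_ge0].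
have dchi k x : `|partial k chi x| <= M.
  have /andP[e0 e1] := eta01 x; rewrite dE !normrM ger0_norm// (ger0_norm e0).
  apply: (@le_trans _ _ (2 * (C / (delta / 4)))); last by rewrite lerDr.
  by rewrite -mulrA ler_wpM2l// -[leRHS]mul1r ler_pM.
pose v x := chi x * u x.
pose g' k x := chi x * g k x + partial k chi x * u x.
have wv : wg om v g'.
  by apply: (@wg_mul _ _ om chi (fun k => partial k chi) u g M) => //;
    [exact: smooth_meas|move=> k; apply: smooth_meas; exact: smooth_partial|exact: wg_smooth].
have mchi : measurable_fun setT chi by exact: smooth_meas.
have mdchi k : measurable_fun setT (partial k chi) by apply: smooth_meas; exact: smooth_partial.
have Lv : L12 v.
  by rewrite /v; under eq_fun do rewrite mulrC; exact: (L12M_bounded Lu mchi chi1).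
have Lg' k : L12 (g' k).
  apply: L12D.
    by under eq_fun do rewrite mulrC; exact: (L12M_bounded (Lg k) mchi chi1).
  by under eq_fun do rewrite mulrC; exact: (L12M_bounded Lu (mdchi k) (dchi k)).
(* The equation, tested with eta^2 u. *)
have i0 : \int[mu]_x fluxdot g g' x = 0.
  apply: (harm_test hu cK Kom (v := v)) => //.
    move=> x Kx; rewrite /v /chi; have [->] : eta x = 0 /\ forall k, partial k eta x = 0.
      by apply: eta_out => /NK.
    by rewrite !mul0r.
  move=> k x Kx; rewrite /g' dE /chi; have [->] : eta x = 0 /\ forall k, partial k eta x = 0.
    by apply: eta_out => /NK.
  by move=> _; rewrite !(mulr0, mul0r) addr0.
set B := 2 * beta * (d%:R * (C / (delta / 4)) ^+ 2).
have B0 : 0 <= B by apply: mulr_ge0; [exact: mulr_ge0|apply: mulr_ge0 => //; exact: sqr_ge0].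
have Bs (t : R) : 0 <= B * t ^+ 2 by apply: mulr_ge0 => //; exact: sqr_ge0.
have LgN k : L12 (g k \_ N1) by exact: L12_restrict.
have LuN : L12 (u \_ N2) by exact: L12_restrict.
have main : alpha / 2 * \sum_k sqnorm (g k \_ N1) <= B * sqnorm (u \_ N2).
  rewrite -[leRHS]add0r -[X in _ <= X + _]i0 -Rint_sum; last by move=> k; exact: (LgN k).2.
  have Is : intg (fun x => \sum_k (g k \_ N1) x ^+ 2) by apply: intg_sum => k; exact: (LgN k).2.
  have Iu : intg (fun x => (u \_ N2) x ^+ 2) by exact: LuN.2.
  rewrite -RintZ// -RintZ// -RintD; [|exact: fluxdot_intg|exact: intgZ].
  apply: le_Rint; [exact: intgZ|by apply: intgD; [exact: fluxdot_intg|exact: intgZ]|].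
  move=> x; have [ox|ox] := pselect (om x); last first.
    rewrite fluxdot_out// add0r (_ : \sum_k _ = 0); first by rewrite mulr0 Bs.
    rewrite big1// => k _; rewrite patchE memNset ?expr0n// => /N12/NK/Kom; exact: ox.
  have := caccioppoli_pointwise g eta (u x) (fun k => partial k eta) ox.
  have -> : fluxdot g (fun k x0 => eta x0 ^+ 2 * g k x0 + 2 * eta x0 * u x * partial k eta x0) x =
     fluxdot g g' x.
    rewrite /fluxdot; apply: eq_bigr => l _; congr (_ * _); rewrite /g' dE /chi.
    by rewrite expr2; congr (_ + _); rewrite mulrAC.
  move=> h; apply: (@le_trans _ _ (alpha / 2 * (eta x ^+ 2 * \sum_k g k x ^+ 2))).
    rewrite ler_wpM2l ?divr_ge0 ?(ltW alpha0)//; have [Nx|Nx] := boolP (x \in N1).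
      rewrite eta_in ?expr1n ?mul1r; last exact: set_mem.
      by apply: ler_sum => k _; rewrite patchE Nx.
    rewrite big1; last by move=> k _; rewrite patchE (negbTE Nx) expr0n.
    by apply: mulr_ge0; [exact: sqr_ge0|apply: sumr_ge0 => k _; exact: sqr_ge0].
  apply: (le_trans h); rewrite lerD2l; have [Nx|Nx] := boolP (x \in N2); last first.
    rewrite big1; first by rewrite mulr0 Bs.
    move=> k _; have [_ ->] : eta x = 0 /\ forall k, partial k eta x = 0 by apply: eta_out; move: Nx; rewrite notin_setE.
    by rewrite expr0n.
  rewrite patchE Nx /B [leRHS]mulrAC; apply: ler_wpM2l; first by apply: mulr_ge0; [exact: mulr_ge0|exact: sqr_ge0].
  apply: (@le_trans _ _ (\sum_(k < d) (C / (delta / 4)) ^+ 2)).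
    apply: ler_sum => k _; rewrite -[leLHS]real_normK ?num_real// lerXn2r ?nnegrE//.
  by move: (_ ^+ 2) => t; rewrite sumr_const card_ord mulr_natl.
have n0 := sqnorm_ge0 (u \_ N2).
rewrite -(@ler_pM2l _ (alpha / 2)) ?divr_gt0//; apply: (le_trans main).
rewrite mulrA ler_wpM2r// /B [leRHS]mulrA.
have -> : alpha / 2 * (64 * beta * d%:R * C ^+ 2 / alpha + 1) / delta ^+ 2 =
  2 * beta * (d%:R * (C / (delta / 4)) ^+ 2) + alpha / 2 / delta ^+ 2.
  by field; rewrite !gt_eqF.
by rewrite lerDl divr_ge0 ?exprn_ge0 ?divr_ge0 ?(ltW alpha0) ?(ltW d0).
Qed.

End coeff.

End caccioppoli.

(** * Grids of cells and exponential decay of the energy *)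

Section cells.
Context {R : realType} {d : nat}.
Local Notation E := 'rV[R]_d.
Local Notation mu := (lebesgue_rV R d).
Implicit Types (f h w u v phi psi chi : E -> R) (U K S om W Z : set E) (g gam : 'I_d -> E -> R).

Section grid.
Variables (b : E) (s : R) (M : nat).
Hypothesis s0 : 0 < s.

(** Half-open boxes, so that they are disjoint and cover without exceptional
    sets. *)
Definition cell (j : {ffun 'I_d -> 'I_M}) : set E :=
  rbox (fun k => `[b ord0 k + s * (j k)%:R, b ord0 k + s * (j k).+1%:R[%classic).

Lemma cellP j x : cell j x <->
  forall k, b ord0 k + s * (j k)%:R <= x ord0 k < b ord0 k + s * (j k).+1%:R.
Proof. by split => h k; have := h k; rewrite /= in_itv. Qed.

Lemma measurable_cell j : measurable (cell j).
Proof. by apply: measurable_rbox => k; exact: measurable_itv. Qed.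

Lemma mu_cell j : mu (cell j) = (s ^+ d)%:E.
Proof.
rewrite (@lebesgue_rV_rbox R d _ (fun=> s)).
- by rewrite prodr_const card_ord.
- by move=> k; exact: measurable_itv.
move=> k; rewrite lebesgue_measure_itv/= lte_fin ltrD2l ltr_pM2l// ltr_nat ltnSn.
by rewrite -EFinD -(natr1 (j k)); congr EFin; ring.
Qed.

Lemma cell_convex j : convex_set (cell j).
Proof.
move=> x y t /cellP cx /cellP cy /andP[t0 t1]; apply/cellP => k.
have /andP[x1 x2] := cx k; have /andP[y1 y2] := cy k; rewrite !mxE.
move: (b ord0 k + _) (b ord0 k + _) (x ord0 k) (y ord0 k) x1 x2 y1 y2 => q p a c x1 x2 y1 y2.
have -> : a + t * (c - a) = (1 - t) * a + t * c by ring.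
apply/andP; split.
  have := ler_wpM2l t0 y1; have := ler_wpM2l (_ : 0 <= 1 - t) x1; rewrite subr_ge0 => /(_ t1).
  nra.
have [->|tn] := eqVneq t 0; first by rewrite mul0r addr0 subr0 mul1r.
have tp : 0 < t by rewrite lt_neqAle eq_sym tn.
have t1' : 0 <= 1 - t by rewrite subr_ge0.
have := ler_wpM2l t1' (ltW x2); have : t * c < t * q by rewrite ltr_pM2l.
nra.
Qed.

Lemma cell_diam j x y : cell j x -> cell j y -> `|y - x| < s.
Proof.
move=> /cellP cx /cellP cy; apply/rV_norm_ltP => // k; rewrite !mxE ltr_norml.
have /andP[x1 x2] := cx k; have /andP[y1 y2] := cy k; move: x1 x2 y1 y2.
rewrite -(natr1 (j k)) mulrDr mulr1; move: (s * _) => p; lra.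
Qed.

Lemma cell_inj i j x : cell i x -> cell j x -> i = j.
Proof.
move=> /cellP ci /cellP cj; apply/ffunP => k; apply/val_inj => /=.
have /andP[x1 x2] := ci k; have /andP[y1 y2] := cj k.
have h1 := le_lt_trans x1 y2; have h2 := le_lt_trans y1 x2.
move: h1 h2; rewrite !ltrD2l !ltr_pM2l// !ltr_nat !ltnS => h1 h2.
by apply/eqP; rewrite eqn_leq h1.
Qed.

Lemma cell_cover (x : E) : (forall k, b ord0 k <= x ord0 k < b ord0 k + s * M%:R) -> exists j, cell j x.
Proof.
move=> hx; pose n k := Num.truncn ((x ord0 k - b ord0 k) / s).
have t0 k : 0 <= (x ord0 k - b ord0 k) / s.
  by rewrite divr_ge0 ?(ltW s0)// subr_ge0; case/andP: (hx k).
have nM k : (n k < M)%N.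
  rewrite -(ltr_nat R); apply: (le_lt_trans (y := (x ord0 k - b ord0 k) / s)); first by have /andP[] := truncn_itv (t0 k).
  by rewrite ltr_pdivrMr// mulrC ltrBlDl; case/andP: (hx k).
exists [ffun k => Ordinal (nM k)]; apply/cellP => k; rewrite ffunE /=.
have := truncn_itv (t0 k); rewrite -/(n k) => /andP[h1 h2].
move: h1 h2; rewrite ler_pdivlMr// ltr_pdivrMr// -lerBrDl -ltrBlDl => h1 h2.
by rewrite mulrC h1 mulrC.
Qed.

Lemma cells_sum_le f V (P : pred {ffun 'I_d -> 'I_M}) : measurable V -> L12 f ->
  (forall j, P j -> cell j `<=` V) -> \sum_(j | P j) sqnorm (f \_ (cell j)) <= sqnorm (f \_ V).
Proof.
move=> mV Lf PV; rewrite big_mkcond /=.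
have LC j : L12 (f \_ (cell j)) by apply: L12_restrict => //; exact: measurable_cell.
have LV : L12 (f \_ V) by exact: L12_restrict.
pose F j x := if P j then (f \_ (cell j)) x ^+ 2 else 0.
have IF j : intg (F j) by rewrite /F; case: (P j); [exact: (LC j).2|exact: intg0].
rewrite (eq_bigr (fun j => \int[mu]_x F j x)); last first.
  by move=> j _; rewrite /F; case: (P j) => //; rewrite Rint0.
rewrite -Rint_sum//; apply: le_Rint; [exact: intg_sum|exact: LV.2|].
move=> x; have [[j [Pj cj]]|nj] := pselect (exists j, P j /\ cell j x).
  rewrite (bigD1 j)//= big1 ?addr0.
    rewrite /F Pj !patchE !mem_set//; exact: (PV j).
  move=> i ij; rewrite /F; case: ifP => // Pi; rewrite patchE memNset ?expr0n// => ci.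
  by move/eqP: ij; apply; exact: cell_inj ci cj.
rewrite big1 ?sqr_ge0// => i _; rewrite /F; case: ifP => // Pi.
by rewrite patchE memNset ?expr0n// => ci; apply: nj; exists i.
Qed.

Lemma cells_sum_ge f W (P : pred {ffun 'I_d -> 'I_M}) : measurable W -> L12 f ->
  (forall x, W x -> exists2 j, P j & cell j x) ->
  sqnorm (f \_ W) <= \sum_(j | P j) sqnorm (f \_ (cell j)).
Proof.
move=> mW Lf WP; rewrite big_mkcond /=.
have LC j : L12 (f \_ (cell j)) by apply: L12_restrict => //; exact: measurable_cell.
have LW : L12 (f \_ W) by exact: L12_restrict.
pose F j x := if P j then (f \_ (cell j)) x ^+ 2 else 0.
have F0 j x : 0 <= F j x by rewrite /F; case: ifP => // _; exact: sqr_ge0.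
have IF j : intg (F j) by rewrite /F; case: (P j); [exact: (LC j).2|exact: intg0].
rewrite (eq_bigr (fun j => \int[mu]_x F j x)); last first.
  by move=> j _; rewrite /F; case: (P j) => //; rewrite Rint0.
rewrite -Rint_sum//; apply: le_Rint; [exact: LW.2|exact: intg_sum|].
move=> x; rewrite patchE; case: ifPn => [/set_mem/WP[j Pj cj]|_]; last first.
  by rewrite expr0n sumr_ge0.
by rewrite (bigD1 j)//= {1}/F Pj patchE mem_set// lerDl sumr_ge0.
Qed.

End grid.

(** The constant of poincare_convex for a cube of side s, divided by s^2. *)
Definition poincare_cst : R := 8 * d%:R * 2 ^+ d.

(** Poincare on each cell that meets the r-neighbourhood; these cells cover
    it, and they stay in the (r + delta)-neighbourhood since s <= delta. *)
Lemma poincare_cells om K Z (r delta : R) u g (b : E) (s : R) (M : nat) : open om -> compact K -> K `<=` om ->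
  L12 u -> (forall k, L12 (g k)) -> wg om u g -> 0 < s -> s <= delta ->
  nbhd Z (r + delta) `<=` K ->
  (forall x : E, nbhd Z r x -> forall k, b ord0 k <= x ord0 k < b ord0 k + s * M%:R) ->
  (forall j : {ffun 'I_d -> 'I_M}, cell b s j `<=` nbhd Z (r + delta) -> \int[mu]_x (u \_ (cell b s j)) x = 0) ->
  sqnorm (u \_ (nbhd Z r)) <= poincare_cst * s ^+ 2 * \sum_k sqnorm (g k \_ (nbhd Z (r + delta))).
Proof.
move=> oom cK Kom Lu Lg wu s0 sd NK box avg.
have [m m0 hm] := compact_margin cK oom Kom.
(* The cells that meet the r-neighbourhood. *)
pose P (j : {ffun 'I_d -> 'I_M}) := `[< exists2 x, cell b s j x & nbhd Z r x >].
have PV j : P j -> cell b s j `<=` nbhd Z (r + delta).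
  move=> /asboolP[x cx Nx] y cy; apply: (nbhd_add Nx); apply: le_trans sd.
  exact/ltW/(cell_diam s0 cx cy).
have mN r' : measurable (nbhd Z r') by exact: measurable_nbhd.
apply: (@le_trans _ _ (\sum_(j | P j) sqnorm (u \_ (cell b s j)))).
  apply: cells_sum_ge => // x Nx; have [j cj] := cell_cover s0 (box x Nx).
  by exists j => //; apply/asboolP; exists x.
apply: (@le_trans _ _ (\sum_(j | P j) poincare_cst * s ^+ 2 * \sum_k sqnorm (g k \_ (cell b s j)))).
  apply: ler_sum => j Pj.
  have := @poincare_convex R d om (cell b s j) u g s m (s ^+ d) (measurable_cell b s j)
    (mu_cell b s0 j) (@cell_convex _ _ _ j) (@cell_diam _ _ _ s0 j) s0 m0.
  move=> /(_ (fun x y cx => hm x y (NK x (PV j Pj x cx))) Lu Lg wu (avg j (PV j Pj))).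
  have sdp : 0 < s ^+ d by rewrite exprn_gt0.
  rewrite exprMn => h; rewrite -(ler_pM2l sdp); apply: (le_trans h).
  rewrite le_eqVlt; apply/orP; left; apply/eqP; rewrite /poincare_cst; move: (s ^+ d) (2 ^+ d) (\sum_k _) => p q t; ring.
rewrite -mulr_sumr ler_wpM2l ?mulr_ge0 ?exprn_ge0 ?(ltW s0)//.
rewrite exchange_big/=; apply: ler_sum => k _; exact: cells_sum_le.
Qed.

Section decay.
Variables (om : set E) (A : E -> 'M[R]_d) (alpha beta : R).
Hypothesis mA : forall k l, measurable_fun om (fun x => A x k l).
Hypothesis symA : forall x, om x -> (A x)^T = A x.
Hypothesis ellA : forall x xi : E, om x ->
  alpha * enorm xi ^+ 2 <= dot (xi *m (A x)^T) xi <= beta * enorm xi ^+ 2.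
Hypothesis alpha0 : 0 < alpha.
Hypothesis beta0 : 0 <= beta.
Hypothesis oom : open om.
Hypothesis fom : (mu om < +oo)%E.

Lemma poincare_cst_ge0 : 0 <= poincare_cst. Proof. by rewrite /poincare_cst !mulr_ge0. Qed.

(** One step alternates poincare_cells and caccioppoli, each with half of the
    width delta, and gains the factor C (s / delta)^2; there are N steps
    between the delta-neighbourhood and the (N+1) delta-neighbourhood of Z.
    The second conclusion converts the energy into the L^2 norm on Z itself. *)
Lemma energy_decay : exists2 C : R, 0 < C & forall u g Z K (delta s : R) (b : E) (M N : nat),
  harm om A u g -> measurable Z -> compact K -> K `<=` om ->
  0 < delta -> 0 < s -> s <= delta / 2 ->
  nbhd Z (N.+1%:R * delta) `<=` K ->
  (forall x : E, nbhd Z (N.+1%:R * delta) x -> forall k, b ord0 k <= x ord0 k < b ord0 k + s * M%:R) ->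
  (forall j : {ffun 'I_d -> 'I_M}, cell b s j `<=` nbhd Z (N.+1%:R * delta) ->
     \int[mu]_x (u \_ (cell b s j)) x = 0) ->
  \sum_k sqnorm (g k \_ (nbhd Z delta)) <= (C * (s / delta) ^+ 2) ^+ N * \sum_k sqnorm (g k) /\
  sqnorm (u \_ Z) <= poincare_cst * s ^+ 2 * \sum_k sqnorm (g k \_ (nbhd Z delta)).
Proof.
have [C C0 hC] := caccioppoli mA symA ellA alpha0 beta0 oom fom.
have c0 := poincare_cst_ge0.
exists (4 * C * poincare_cst + 1); first by rewrite ltr_wpDl// !mulr_ge0// ltW.
move=> u g Z K delta s b M N hu mZ cK Kom d0 s0 sd NK box avg.
have [Lu Lg wu _] := hu.
have step (r : R) : r + delta <= N.+1%:R * delta ->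
  sqnorm (u \_ (nbhd Z (r + delta / 2))) <= poincare_cst * s ^+ 2 * \sum_k sqnorm (g k \_ (nbhd Z (r + delta))).
  move=> rN; have rE : r + delta = r + delta / 2 + delta / 2 by lra.
  rewrite rE in rN; rewrite rE.
  apply: (poincare_cells (om := om) (K := K) (b := b) (M := M)) => //.
  - by apply: subset_trans NK; apply: nbhd_le.
  - move=> x Nx; apply: box; apply: nbhd_le Nx; apply: le_trans rN; lra.
  - by move=> j jN; apply: avg; apply: subset_trans jN _; apply: nbhd_le.
have en0 r : 0 <= \sum_k sqnorm (g k \_ (nbhd Z r)) by apply: sumr_ge0 => k _; exact: sqnorm_ge0.
split; last first.
  apply: (@le_trans _ _ (sqnorm (u \_ (nbhd Z (0 + delta / 2))))).
    apply: sqnorm_patch_sub => //; first exact: measurable_nbhd.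
    by move=> x Zx; exists x; rewrite // subrr normr0 add0r divr_gt0.
  have := step 0; rewrite add0r; apply; rewrite -[leLHS]mul1r ler_wpM2r ?(ltW d0)//.
  by rewrite ler1n.
set q := (4 * C * poincare_cst + 1) * _.
have q0 : 0 <= q by rewrite mulr_ge0 ?sqr_ge0// addr_ge0// !mulr_ge0// ltW.
have dec n : (n < N.+1)%N -> \sum_k sqnorm (g k \_ (nbhd Z delta)) <=
    q ^+ n * \sum_k sqnorm (g k \_ (nbhd Z (n.+1%:R * delta))).
  elim: n => [_|n IH nN]; first by rewrite expr0 !mul1r.
  apply: (le_trans (IH (ltnW nN))); rewrite exprSr -mulrA ler_wpM2l ?exprn_ge0//.
  have nE : n.+2%:R * delta = n.+1%:R * delta + delta by rewrite -[n.+2%:R]natr1 mulrDl mul1r.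
  have hN : n.+1%:R * delta + delta <= N.+1%:R * delta.
    by rewrite -nE ler_wpM2r ?(ltW d0)// ler_nat.
  have d2 : 0 < delta / 2 by rewrite divr_gt0.
  have NK' : nbhd Z (n.+1%:R * delta + delta / 2) `<=` K.
    by apply: subset_trans NK; apply: nbhd_le; apply: le_trans hN; lra.
  apply: (le_trans (hC u g Z (n.+1%:R * delta) (delta / 2) K hu cK Kom d2 NK')).
  have hs := step _ hN; rewrite -nE in hs.
  apply: (@le_trans _ _ (C / (delta / 2) ^+ 2 * (poincare_cst * s ^+ 2 * \sum_k sqnorm (g k \_ (nbhd Z (n.+2%:R * delta)))))).
    by rewrite ler_wpM2l// divr_ge0 ?(ltW C0) ?sqr_ge0.
  rewrite mulrA ler_wpM2r// /q.
  have -> : C / (delta / 2) ^+ 2 * (poincare_cst * s ^+ 2) = 4 * C * poincare_cst * (s / delta) ^+ 2.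
    by field; rewrite gt_eqF.
  by rewrite ler_wpM2r ?sqr_ge0// lerDl.
apply: (le_trans (dec N (ltnSn N))); rewrite ler_wpM2l ?exprn_ge0//.
by apply: ler_sum => k _; apply: sqnorm_patch_le => //; exact: measurable_nbhd.
Qed.

End decay.

End cells.

(** * Almost orthogonal complements and subspaces of exact dimension *)

Section linear_algebra.
Context {R : realType}.

Section gelfand.
Variables (V : lmodType R) (B : V -> V -> R).
Implicit Types (X : set V) (f : V -> R).

(** A linear subspace, as a predicate, because the solutions of interest are a
    subset of a large function space. *)
Definition subm X := X 0 /\ forall a u v, X u -> X v -> X (a *: u + v).
Definition linear_in X f := forall a u v, X u -> X v -> f (a *: u + v) = a * f u + f v.
Definition semi_inner X := [/\ forall w, X w -> linear_in X (B^~ w),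
  forall u v, X u -> X v -> B u v = B v u & forall u, X u -> 0 <= B u u].

Lemma linear_in0 X f : subm X -> linear_in X f -> f 0 = 0.
Proof.
by move=> [X0 _] lf; have := lf (-1) 0 0 X0 X0; rewrite scaler0 addr0 mulN1r addNr.
Qed.

Lemma semi_inner_expand X t u v : subm X -> semi_inner X -> X u -> X v ->
  B (t *: u + v) (t *: u + v) = t ^+ 2 * B u u + 2 * t * B u v + B v v.
Proof.
move=> [X0 XD] [lB sB _] Xu Xv; have Xuv := XD t u v Xu Xv.
rewrite lB// (sB u)// (sB v)// !lB// (sB v u)//; ring.
Qed.

(** If f were represented by a vector w, the complement of w would be the
    kernel of f and kappa = 1 would do. Without completeness, a vector w of
    norm at most 1 that nearly maximises |f| takes this role: adding to w a
    vector v of the kernel does not change f, so it cannot shorten w by much,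
    and this bounds B w v. *)
Lemma near_orthogonal X f (K kappa : R) : subm X -> semi_inner X -> linear_in X f ->
  (forall u, X u -> f u ^+ 2 <= K * B u u) -> 1 < kappa ->
  exists2 w, X w & forall u, X u -> exists c, f (u - c *: w) = 0 /\
    B (u - c *: w) (u - c *: w) <= kappa * B u u.
Proof.
move=> sX iB lf fK k1; have [X0 XD] := sX; have [lB sB B0] := iB.
have f0 := linear_in0 sX lf.
have XZ a u : X u -> X (a *: u) by move=> Xu; rewrite -[_ *: _]addr0; exact: XD.
have fZ a u : X u -> f (a *: u) = a * f u.
  by move=> Xu; rewrite -[a *: u]addr0 lf// f0 addr0.
have B00 : B 0 0 = 0 by apply: (linear_in0 sX (lB 0 X0)).
have BZ a u : X u -> B (a *: u) (a *: u) = a ^+ 2 * B u u.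
  move=> Xu; rewrite -[a *: u]addr0 (semi_inner_expand a sX iB)// B00.
  by rewrite (sB u 0)// (linear_in0 sX (lB u Xu)) mulr0 !addr0.
(* If f vanishes on X, there is nothing to remove. *)
have [fz|] := pselect (forall u, X u -> f u = 0).
  exists 0 => // u Xu; exists 0; rewrite scaler0 subr0; split; first exact: fz.
  by rewrite ler_peMl ?B0// ltW.
move=> /existsNP[u0 /not_implyP[Xu0 fu0]].
(* The supremum s of this set is the square of the norm of f. *)
pose S : set R := [set r | exists u, [/\ X u, B u u <= 1 & r = f u ^+ 2]].
have Sub : ubound S `|K|.
  move=> _ [u [Xu Bu ->]]; apply: (le_trans (fK u Xu)); apply: (@le_trans _ _ (`|K| * B u u)).
    by rewrite ler_wpM2r ?B0// ler_norm.
  by rewrite ler_piMr.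
have Bpos u : X u -> f u != 0 -> 0 < B u u.
  move=> Xu fu; rewrite lt_neqAle B0// andbT; apply: contra fu => /eqP e.
  by have := fK u Xu; rewrite -e mulr0 => h; rewrite -sqrf_eq0 eq_le h sqr_ge0.
have hS : has_sup S.
  split; last by exists `|K|.
  by exists (f 0 ^+ 2), 0; split => //; rewrite B00.
set s := sup S.
have fs u : X u -> f u ^+ 2 <= s * B u u.
  move=> Xu; have [->|fu] := eqVneq (f u) 0.
    rewrite expr0n mulr_ge0 ?B0//; apply: ub_le_sup; first by exists `|K|.
    by exists 0; split => //; rewrite ?B00 ?f0 ?expr0n.
  have Bu := Bpos u Xu fu; rewrite -ler_pdivrMr//; apply: ub_le_sup; first by exists `|K|.
  exists ((Num.sqrt (B u u))^-1 *: u); split; first exact: XZ.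
    by rewrite BZ// exprVn sqr_sqrtr ?(ltW Bu)// mulVf// gt_eqF.
  by rewrite fZ// exprMn exprVn sqr_sqrtr ?(ltW Bu)// mulrC.
have s0 : 0 < s.
  have fu : f u0 != 0 by exact/eqP.
  have Bu := Bpos u0 Xu0 fu; rewrite -(pmulr_lgt0 _ Bu); apply: lt_le_trans (fs _ Xu0).
  by rewrite lt_neqAle sqr_ge0 andbT eq_sym sqrf_eq0.
have kp : 0 < kappa by apply: lt_trans k1.
(* The tolerance for which 1 / (1 - 2 e) = kappa. *)
pose e := (kappa - 1) / (2 * kappa).
have e0 : 0 < e by rewrite divr_gt0 ?subr_gt0// mulr_gt0.
have ke : kappa * (1 - 2 * e) = 1 by rewrite /e; field; rewrite gt_eqF.
have e12 : 0 < 1 - 2 * e by rewrite -(pmulr_rgt0 _ kp) ke.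
have [_ [w [Xw Bw ->]] hw] := sup_adherent (mulr_gt0 e0 s0) hS.
have {}hw : (1 - e) * s < f w ^+ 2 by rewrite mulrBl mul1r.
have fw : f w != 0.
  apply: contraTneq hw => ->; rewrite expr0n -leNgt mulr_ge0 ?(ltW s0)//; lra.
exists w => // u Xu; exists (f u / f w); set c := f u / f w; set v := u - c *: w.
have vE : v = (- c) *: w + u by rewrite /v scaleNr addrC.
have Xv : X v by rewrite vE; exact: XD.
have fv : f v = 0 by rewrite vE lf// mulNr /c divfK// addNr.
split=> //.
have uE : u = c *: w + v by rewrite /v addrC subrK.
set b := B w v.
(* f takes the same value at w and at t v + w, so the latter cannot be much
   shorter than a unit vector. *)
have disc t : 1 - e <= t ^+ 2 * B v v + 2 * t * b + 1.
  have Xt : X (t *: v + w) by exact: XD.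
  have := fs _ Xt; rewrite lf// fv mulr0 add0r (semi_inner_expand t sX iB)// (sB v w)//.
  move=> h; rewrite -(ler_pM2r s0); apply: (le_trans (ltW hw)); apply: (le_trans h).
  by rewrite mulrC ler_wpM2r ?(ltW s0)// lerD2l.
have Bv := B0 v Xv.
(* The quadratic in t is nonnegative: its discriminant. *)
have be : b ^+ 2 <= e * B v v.
  have [Bv0|Bvn] := eqVneq (B v v) 0.
    have [->|bn] := eqVneq b 0; first by rewrite expr0n mulr_ge0// ltW.
    have := disc (- e / b); rewrite Bv0 mulr0 add0r.
    by rewrite -mulrA divfK// => h; exfalso; lra.
  have Bvp : 0 < B v v by rewrite lt_neqAle eq_sym Bvn.
  have := disc (- b / B v v).
  have -> : (- b / B v v) ^+ 2 * B v v + 2 * (- b / B v v) * b + 1 = 1 - b ^+ 2 / B v v.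
    by field; rewrite gt_eqF.
  by rewrite lerD2l lerN2 ler_pdivrMr.
have Bw' : 1 - e <= B w w.
  by rewrite -(ler_pM2r s0); apply: (le_trans (ltW hw)); rewrite mulrC; exact: fs.
have -> : B u u = c ^+ 2 * B w w + 2 * c * b + B v v.
  by rewrite [in LHS]uE (semi_inner_expand c sX iB).
have e1 : 0 < 1 - e by lra.
move: (B v v) (B w w) Bv be Bw' Bw {disc} => q p q0 be p1 p2.
(* Completing the square in c, after multiplication by 1 - e. *)
have h1 : (1 - e) * (c ^+ 2 * p + 2 * c * b + q) >= (1 - 2 * e) * q.
  have h2 : 0 <= ((1 - e) * c + b) ^+ 2 by exact: sqr_ge0.
  have h3 : (1 - e) * (c ^+ 2 * (1 - e)) <= (1 - e) * (c ^+ 2 * p).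
    by rewrite ler_wpM2l ?(ltW e1)// ler_wpM2l ?sqr_ge0.
  move: be h2 h3; clear; nra.
have h2 : q <= kappa * ((1 - e) * (c ^+ 2 * p + 2 * c * b + q)).
  by apply: le_trans (ler_wpM2l (ltW kp) h1); rewrite mulrA ke mul1r.
have T0 : 0 <= c ^+ 2 * p + 2 * c * b + q.
  by rewrite -(pmulr_rge0 _ e1); apply: le_trans h1; rewrite mulr_ge0// ltW.
apply: (le_trans h2); rewrite ler_wpM2l ?(ltW kp)// ler_piMl//; lra.
Qed.

(** One functional at a time, on the kernel of the previous ones. Taking the
    square root of kappa in each step leaves room for the remaining
    functionals. *)
Lemma gelfand_complement m : forall X (f : 'I_m -> V -> R) (K kappa : R), subm X -> semi_inner X ->
  (forall j, linear_in X (f j)) ->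
  (forall j u, X u -> f j u ^+ 2 <= K * B u u) -> 1 < kappa ->
  exists2 w : 'I_m -> V, (forall j, X (w j)) & forall u, X u -> exists c : 'I_m -> R,
    let v := u - \sum_j c j *: w j in
    [/\ X v, forall j, f j v = 0 & B v v <= kappa * B u u].
Proof.
elim: m => [|m IH] X f K kappa sX iB lf fK k1; have [X0 XD] := sX.
  exists (fun=> 0) => // u Xu; exists (fun=> 0) => /=; rewrite big_ord0 subr0; split => //.
    by case.
  by have [_ _ B0] := iB; rewrite ler_peMl ?B0// ltW.
have kp : 0 < kappa by apply: lt_trans k1.
set k' := Num.sqrt kappa.
have k'2 : k' * k' = kappa by rewrite -expr2 sqr_sqrtr// ltW.
have k'1 : 1 < k' by rewrite /k' -[X in X < _]sqrtr1 ltr_sqrt.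
have [w0 Xw0 hw0] := near_orthogonal sX iB (lf ord0) (fK ord0) k'1.
pose X' : set V := [set u | X u /\ f ord0 u = 0].
have sX' : subm X'.
  split; first by split => //; exact: linear_in0 sX (lf ord0).
  move=> a u v [Xu fu] [Xv fv]; split; first exact: XD.
  by rewrite lf// fu fv mulr0 addr0.
have iB' : semi_inner X'.
  have [h1 h2 h3] := iB; split.
  - by move=> w [Xw _] a u v [Xu _] [Xv _]; exact: h1.
  - by move=> u v [Xu _] [Xv _]; exact: h2.
  - by move=> u [Xu _]; exact: h3.
have lf' j : linear_in X' (f (lift ord0 j)) by move=> a u v [Xu _] [Xv _]; exact: lf.
have fK' j u : X' u -> f (lift ord0 j) u ^+ 2 <= K * B u u by move=> [Xu _]; exact: fK.
have [w Xw hw] := IH X' _ K k' sX' iB' lf' fK' k'1.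
exists (fun j => oapp w w0 (unlift ord0 j)).
  by move=> j; case: unliftP => [i _|_] /=; [case: (Xw i)|].
move=> u Xu; have [c0 [fu1 Bu1]] := hw0 u Xu.
have X'u1 : X' (u - c0 *: w0).
  by split => //; rewrite addrC -scaleNr; exact: XD.
have [c [[Xv fv0] fv Bv]] := hw _ X'u1.
exists (fun j => oapp c c0 (unlift ord0 j)) => /=.
have -> : u - \sum_(j < m.+1) oapp c c0 (unlift ord0 j) *: oapp w w0 (unlift ord0 j) =
   u - c0 *: w0 - \sum_j c j *: w j.
  rewrite big_ord_recl unlift_none /= opprD addrA; congr (_ - _).
  by apply: eq_bigr => j _; rewrite liftK.
split => //.
  by move=> j; case: (unliftP ord0 j) => [i ->|->].
apply: (le_trans Bv); rewrite -k'2 -mulrA ler_wpM2l//; by apply: ltW; apply: lt_trans k'1.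
Qed.

End gelfand.

(** The quotient by Z is never formed: independence and span are understood
    modulo Z. In the application Z consists of the functions that vanish
    almost everywhere. *)
Section basis.
Variables (W : lmodType R) (Z : set W) (P : W -> Prop).
Hypothesis sZ : subm Z.

Definition indep n (e : 'I_n -> W) := forall c : 'I_n -> R,
  Z (\sum_k c k *: e k) -> forall k, c k = 0.
Definition inspan n (e : 'I_n -> W) x := exists c : 'I_n -> R, Z (x - \sum_k c k *: e k).
Definition fcons n (e : 'I_n -> W) x (k : 'I_n.+1) : W := oapp e x (unlift ord0 k).

Let ZZ a u : Z u -> Z (a *: u).
Proof. by case: sZ => Z0 ZD Zu; rewrite -[_ *: _]addr0; exact: ZD. Qed.
Let ZA u v : Z u -> Z v -> Z (u + v).
Proof. by case: sZ => Z0 ZD Zu Zv; rewrite -[u]scale1r; exact: ZD. Qed.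

Lemma sum_fcons n (e : 'I_n -> W) x (c : 'I_n.+1 -> R) :
  \sum_k c k *: fcons e x k = c ord0 *: x + \sum_k c (lift ord0 k) *: e k.
Proof.
rewrite big_ord_recl /fcons unlift_none /=; congr (_ + _).
by apply: eq_bigr => k _; rewrite liftK.
Qed.

Lemma inspan_fcons n (e : 'I_n -> W) x y : inspan e y -> inspan (fcons e x) y.
Proof.
move=> [c hc]; exists (fun k => oapp c 0 (unlift ord0 k)).
rewrite sum_fcons unlift_none /= scale0r add0r.
by under eq_bigr do rewrite liftK.
Qed.

Lemma inspan_head n (e : 'I_n -> W) x : inspan (fcons e x) x.
Proof.
exists (fun k => oapp (fun=> 0) 1 (unlift ord0 k)).
rewrite sum_fcons unlift_none /= scale1r.
under eq_bigr do rewrite liftK /= scale0r.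
by rewrite big1// addr0 subrr; case: sZ.
Qed.

Lemma indep_fcons n (e : 'I_n -> W) x : indep e -> ~ inspan e x -> indep (fcons e x).
Proof.
move=> ie nx c; rewrite sum_fcons => hc.
have [c0|c0] := eqVneq (c ord0) 0.
  move: hc; rewrite c0 scale0r add0r => /ie h k.
  by case: (unliftP ord0 k) => [j ->|->//]; exact: h.
exfalso; apply: nx; exists (fun k => - (c ord0)^-1 * c (lift ord0 k)).
have := ZZ (c ord0)^-1 hc; rewrite scalerDr scalerA mulVf// scale1r scaler_sumr; congr Z.
rewrite -sumrN; congr (_ + _); apply: eq_bigr => k _.
by rewrite scalerA mulNr scaleNr opprK.
Qed.

Lemma P_fcons n (e : 'I_n -> W) x : (forall k, P (e k)) -> P x -> forall k, P (fcons e x k).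
Proof. by move=> Pe Px k; rewrite /fcons; case: (unlift ord0 k). Qed.

Lemma basis_extract m (y : 'I_m -> W) : (forall j, P (y j)) ->
  exists2 n, (n <= m)%N & exists e : 'I_n -> W,
    [/\ forall k, P (e k), indep e & forall j, inspan e (y j)].
Proof.
elim: m y => [|m IH] y Py.
  by exists 0%N => //; exists y; split => //; [move=> c _ []|case].
have [n nm [e [Pe ie se]]] := IH _ (fun j => Py (lift ord0 j)).
have [h|h] := pselect (inspan e (y ord0)).
  exists n; first exact: leqW.
  by exists e; split => // j; case: (unliftP ord0 j) => [i ->|->].
exists n.+1 => //; exists (fcons e (y ord0)); split.
- exact: P_fcons.
- exact: indep_fcons.
- move=> j; case: (unliftP ord0 j) => [i ->|->]; last exact: inspan_head.
  exact: inspan_fcons.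
Qed.

(** More vectors than n in the span of n vectors are dependent, by the kernel
    of the coefficient matrix. *)
Lemma exchange n (e : 'I_n -> W) (p : nat -> W) :
  (forall N, indep (fun i : 'I_N => p i)) -> exists i, ~ inspan e (p i).
Proof.
move=> ip; apply: contrapT => /forallNP h.
have /choice[C hC] : forall i, exists c : 'I_n -> R, Z (p i - \sum_k c k *: e k).
  by move=> i; have := h i; move/contrapT.
pose M : 'M[R]_(n.+1, n) := \matrix_(i, k) C i k.
have [r rk r0] : exists2 r : 'rV[R]_n.+1, r *m M = 0 & r != 0.
  have : kermx M != 0.
    rewrite -mxrank_eq0 mxrank_ker -lt0n subn_gt0 ltnS; exact: rank_leq_col.
  by move=> /rowV0Pn[r /sub_kermxP rM r0]; exists r.
move/negP: r0; apply; apply/eqP/rowP => i; rewrite mxE.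
apply: (ip n.+1 (fun i => r ord0 i)).
have -> : \sum_(i < n.+1) r ord0 i *: p i = \sum_(i < n.+1) r ord0 i *: (p i - \sum_k C i k *: e k).
  under [RHS]eq_bigr do rewrite scalerBr scaler_sumr.
  rewrite sumrB exchange_big /= [X in _ - X]big1 ?subr0// => k _.
  have := congr1 (fun A : 'rV[R]_n => A ord0 k) rk; rewrite !mxE => h0.
  rewrite -[RHS](scale0r (e k)) -h0 scaler_suml; apply: eq_bigr => j _.
  by rewrite mxE scalerA.
apply: (big_ind Z); [by case: sZ|exact: ZA|by move=> j _; exact: ZZ].
Qed.

(** The span of y may have smaller dimension than asked for; it is padded with
    members of an infinite independent family. *)
Lemma basis_exact m n (y : 'I_m -> W) (p : nat -> W) : (m <= n)%N -> (forall j, P (y j)) ->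
  (forall i, P (p i)) -> (forall N, indep (fun i : 'I_N => p i)) ->
  exists e : 'I_n -> W, [/\ forall k, P (e k), indep e & forall j, inspan e (y j)].
Proof.
move=> mn Py Pp ip; have [k km [e [Pe ie se]]] := basis_extract Py.
have kn := leq_trans km mn; rewrite -(subnK kn); elim: (n - k)%N => [|l [e' [Pe' ie' se']]].
  by exists e.
have [i hi] := exchange e' ip.
exists (fcons e' (p i)); split; [exact: P_fcons|exact: indep_fcons|].
by move=> j; exact: inspan_fcons.
Qed.

End basis.
End linear_algebra.

(** * Energy forms and Sobolev norms in terms of any weak gradient *)

Section sobolev_norms.
Context {R : realType} {d : nat}.
Local Notation E := 'rV[R]_d.
Local Notation mu := (lebesgue_rV R d).
Implicit Types (f h w u v phi psi chi : E -> R) (U K S om W Z : set E) (g gam : 'I_d -> E -> R).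

(** The chosen gradient of the energy form agrees with any weak gradient that
    is at hand. *)
Lemma grad_ae om u G : open om -> is_weak_grad om u G ->
  is_weak_grad om u (grad om u) /\ {ae mu, forall x, om x -> grad om u x = G x}.
Proof.
move=> oom hG; have hg : is_weak_grad om u (grad om u).
  by rewrite /grad; exact: (@xgetPex _ (fun=> 0) [set g | is_weak_grad om u g] (ex_intro _ G hG)).
by split => //; exact: weak_grad_unique hG.
Qed.

Lemma ae_Rint om (f h : E -> R) : measurable om -> measurable_fun om f -> measurable_fun om h ->
  {ae mu, forall x, om x -> f x = h x} -> \int[mu]_(x in om) f x = \int[mu]_(x in om) h x.
Proof.
move=> mom mf mh fh; rewrite /Rintegral; congr fine; apply: ae_eq_integral => //.
- exact/measurable_EFinP.
- exact/measurable_EFinP.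
by apply: filterS fh => x fh ox; rewrite fh.
Qed.

Lemma measurable_fun_dot om (F G : E -> E) : measurable om ->
  (forall k, measurable_fun om (fun x => F x ord0 k)) ->
  (forall k, measurable_fun om (fun x => G x ord0 k)) ->
  measurable_fun om (fun x => dot (F x) (G x)).
Proof. by move=> mom mF mG; apply: measurable_sum => k; exact: measurable_funM. Qed.

Lemma weak_grad_meas om u G k : is_weak_grad om u G -> measurable_fun om (fun x => G x ord0 k).
Proof. by case=> _ /(_ k)[]. Qed.

Lemma aform_wg om (A : E -> 'M[R]_d) u v (F G : E -> E) : open om -> (forall k l, measurable_fun om (fun x => A x k l)) ->
  is_weak_grad om u F -> is_weak_grad om v G ->
  aform A om u v = \int[mu]_(x in om) dot (F x *m (A x)^T) (G x).
Proof.
move=> oom mA hF hG; have mom := open_rV_measurable oom.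
have [hu uF] := grad_ae oom hF; have [hv vG] := grad_ae oom hG.
have mM (f : E -> E) : (forall k, measurable_fun om (fun x => f x ord0 k)) ->
    forall k, measurable_fun om (fun x => (f x *m (A x)^T) ord0 k).
  move=> mf k; under eq_fun do rewrite mxE.
  apply: measurable_sum => l; apply: measurable_funM => //.
  by rewrite (_ : (fun x => (A x)^T l k) = fun x => A x k l) //; apply/funext => x; rewrite mxE.
apply: ae_Rint => //.
- apply: measurable_fun_dot => //; last by move=> k; exact: weak_grad_meas hv.
  by apply: mM => k; exact: weak_grad_meas hu.
- apply: measurable_fun_dot => //; last by move=> k; exact: weak_grad_meas hG.
  by apply: mM => k; exact: weak_grad_meas hF.
by apply: filterS2 uF vG => x h1 h2 ox; rewrite h1// h2.
Qed.

Lemma wg_restrict om u g : wg om u g -> wg om u (fun k => g k \_ om).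
Proof.
move=> wu phi k tp; rewrite wu//; congr (- _).
by rewrite -RintP RintI// => x; exact: test_fun_out tp.
Qed.

Lemma Rint_in_le om f : measurable om -> intg f -> (forall x, 0 <= f x) ->
  \int[mu]_(x in om) f x <= \int[mu]_x f x.
Proof.
move=> mom If f0; rewrite Rintegral_mkcond; apply: le_Rint => //; first exact: intg_restrictT.
by move=> x; rewrite patchE; case: ifP.
Qed.

(** The bound needs no identification of the chosen gradient, only one weak
    gradient. *)
Lemma H1norm_le om u g : open om -> L12 u -> (forall k, L12 (g k)) -> wg om u g ->
  H1norm om u <= Num.sqrt (sqnorm u + \sum_k sqnorm (g k)).
Proof.
move=> oom Lu Lg wu; have mom := open_rV_measurable oom.
have hw := wg_weak_grad oom (@subset_refl _ om) Lu Lg wu.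
have [hg ge] := grad_ae oom hw.
rewrite ler_wsqrtr// lerD//; first by apply: Rint_in_le => //; [exact: Lu.2|move=> x; exact: sqr_ge0].
rewrite (_ : \int[mu]_(x in om) _ = \int[mu]_(x in om) dot (vec g x) (vec g x)); last first.
  under eq_Rintegral do rewrite enorm2.
  apply: ae_Rint => //.
  - by apply: measurable_fun_dot => // k; exact: weak_grad_meas hg.
  - by apply: measurable_fun_dot => // k; exact: weak_grad_meas hw.
  by apply: filterS ge => x h ox; rewrite h.
under eq_Rintegral do rewrite sum_sq_vec.
rewrite -Rint_sum; last by move=> k; exact: (Lg k).2.
apply: Rint_in_le => //; first by apply: intg_sum => k; exact: (Lg k).2.
by move=> x; apply: sumr_ge0 => k _; exact: sqr_ge0.
Qed.

Lemma H10_approx om v g : open om -> L12 v -> (forall k, L12 (g k)) -> wg om v g ->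
  (forall e : R, 0 < e -> exists phi, [/\ test_fun om phi,
     sqnorm (fun x => phi x - v x) <= e & forall k, sqnorm (fun x => partial k phi x - g k x) <= e]) ->
  H10 om v.
Proof.
move=> oom Lv Lg wv happ; split; first exact: (wg_H1 oom (@subset_refl _ om) Lv Lg wv).
(* The d + 1 terms of the norm, each at most e n, add up to (1/(n+1))^2. *)
pose e n : R := (n.+1%:R^-1) ^+ 2 / d.+1%:R.
have e0 n : 0 < e n by rewrite divr_gt0// exprn_gt0// invr_gt0.
have /choice[phi hphi] := fun n => happ (e n) (e0 n).
exists phi; first by move=> n; case: (hphi n).
apply: (@squeeze_cvgr _ _ _ _ (fun=> 0) (@harmonic R)); [|exact: cvg_cst|exact: cvg_harmonic].
near=> n; rewrite sqrtr_ge0 /=; have [tp h1 h2] := hphi n.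
have Lp : L12 (phi n) by apply: cutoffable_L12; exact: test_fun_cutoffable tp.
have Ldp k : L12 (partial k (phi n)).
  by apply: cutoffable_L12; apply: cutoffable_partial; exact: test_fun_cutoffable tp.
have sp : smooth (phi n) by case: tp.
have w1 : wg om (fun x => - 1 * phi n x) (fun k x => - 1 * partial k (phi n) x).
  by apply: wgZ => //; exact: wg_smooth.
have LZ f : L12 f -> L12 (fun x => - 1 * f x) by exact: L12Z.
have w2 := wgD Lv (LZ _ Lp) Lg (fun k => LZ _ (Ldp k)) wv w1.
have vE : v \- phi n = fun x => v x + -1 * phi n x by apply/funext => x /=; rewrite mulN1r.
have L1 := L12D Lv (LZ _ Lp).
have L2' k := L12D (Lg k) (LZ _ (Ldp k)).
rewrite vE; apply: (le_trans (H1norm_le oom L1 L2' w2)).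
have n1 : 0 <= n.+1%:R^-1 :> R by rewrite invr_ge0.
rewrite /harmonic /= -[leRHS]ger0_norm// -sqrtr_sqr ler_wsqrtr//.
have sw f h : L12 f -> L12 h -> sqnorm (fun x => h x + -1 * f x) = sqnorm (fun x => f x - h x).
  by move=> _ _; rewrite -sqnormN; apply: eq_Rintegral => x _; congr (_ ^+ 2); ring.
rewrite sw//; under eq_bigr do rewrite sw//.
apply: (@le_trans _ _ (e n + \sum_(k < d) e n)); first by rewrite lerD// ler_sum.
rewrite sumr_const card_ord -mulrS -(mulr_natl (e n)) /e mulrC divfK//.
Unshelve. all: by end_near.
Qed.

End sobolev_norms.

(** * Rotated cubes and the partition function near their boundary *)

Section rotated_cube.
Context {R : realType} {d : nat}.
Local Notation E := 'rV[R]_d.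
Local Notation mu := (lebesgue_rV R d).
Variables (x0 : E) (Q : 'M[R]_d).
Hypothesis hQ : orthogonal_mx Q.

Lemma orthogonal_tr : orthogonal_mx Q^T.
Proof. by rewrite /orthogonal_mx trmxK; exact: mulmx1C. Qed.

Lemma orthogonal_norm (P : 'M[R]_d) (z : E) : orthogonal_mx P -> `|z *m P| <= d%:R * `|z|.
Proof.
move=> hP; apply/rV_norm_leP; first by rewrite mulr_ge0.
have P1 i k : `|P i k| <= 1.
  have hP' : P^T *m P = 1%:M by exact: mulmx1C.
  have := congr1 (fun M : 'M[R]_d => M k k) hP'; rewrite !mxE eqxx => h.
  rewrite -(@ler_pXn2r _ 2)// ?nnegrE// expr1n real_normK ?num_real//.
  rewrite -[leRHS]h (bigD1 i)//= !mxE -expr2 lerDl sumr_ge0// => j _.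
  by rewrite !mxE -expr2 sqr_ge0.
move=> k; rewrite mxE; apply: (le_trans (ler_norm_sum _ _ _)).
apply: (@le_trans _ _ (\sum_(i < d) `|z|)); last by rewrite sumr_const card_ord mulr_natl.
apply: ler_sum => i _; rewrite normrM -[leRHS]mulr1 ler_pM//; exact: rV_norm_coord.
Qed.

(** The sup norm in the rotated coordinates, so that a cube of side r about x0
    is the set where rad x < r / 2. *)
Definition rad (x : E) : R := `|(x - x0) *m Q^T|.

(** The factor d is a crude bound for the operator norm of a rotation with
    respect to the sup norm. *)
Lemma rad_lip (x y : E) : rad y <= rad x + d%:R * `|y - x|.
Proof.
rewrite /rad (_ : y - x0 = (x - x0) + (y - x)); last by rewrite [RHS]addrC subrKA.
rewrite mulmxDl; apply: (le_trans (ler_normD _ _)); rewrite lerD2l.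
by apply: orthogonal_norm; exact: orthogonal_tr.
Qed.

Lemma rad_dist x : `|x - x0| <= d%:R * rad x.
Proof.
have -> : x - x0 = ((x - x0) *m Q^T) *m Q.
  by rewrite -mulmxA (mulmx1C hQ) mulmx1.
exact: orthogonal_norm.
Qed.

Lemma cube_rad (r : R) x : 0 < r -> cube x0 Q r x <-> rad x < r / 2.
Proof.
move=> r0; have r2 : 0 < r / 2 by rewrite divr_gt0.
split=> [[y hy ->]|h].
  rewrite /rad addrAC subrr add0r -mulmxA hQ mulmx1; exact/rV_norm_ltP.
exists ((x - x0) *m Q^T); first exact/rV_norm_ltP.
by rewrite -mulmxA (mulmx1C hQ) mulmx1 addrC subrK.
Qed.

Lemma rad_line (t : R) x : rad (x0 + t *: (x - x0)) = `|t| * rad x.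
Proof. by rewrite /rad addrAC subrr add0r -scalemxAl normrZ. Qed.

Lemma rad_ge0 x : 0 <= rad x. Proof. exact: normr_ge0. Qed.

Lemma rad_cont : continuous rad.
Proof.
move=> x A /nbhs_ballP[e /= e0 eA]; apply/nbhs_ballP.
have e0' : 0 < e / d.+1%:R by rewrite divr_gt0.
exists (e / d.+1%:R) => //= y xy; apply: eA.
have {}xy : `|y - x| < e / d.+1%:R by move: xy; rewrite -ball_normE /ball_ /= -normrN opprB.
have de : d%:R * `|y - x| < e.
  apply: (@le_lt_trans _ _ (d.+1%:R * `|y - x|)); first by rewrite ler_wpM2r// ler_nat.
  by rewrite mulrC -ltr_pdivlMr.
have := rad_lip x y; have := rad_lip y x; rewrite -[`|x - y|]normrN opprB.
rewrite /ball /= ltr_norml; move: de; move: (_ * _) => p; lra.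
Qed.

Lemma open_rad (r : R) : open [set x | rad x < r].
Proof. by apply: (@open_comp _ _ rad [set t | t < r]); [move=> x _; exact: rad_cont|exact: open_lt]. Qed.

Lemma compact_rad (r : R) : compact [set x | rad x <= r].
Proof.
apply: bounded_closed_compact.
  exists (d%:R * `|r| + `|x0|); split; first exact: num_real.
  move=> M rM x /= xr; apply: le_trans (ltW rM).
  rewrite -[x](subrK x0); apply: (le_trans (ler_normD _ _)); rewrite lerD2r.
  apply: (le_trans (rad_dist x)); rewrite ler_wpM2l//; apply: (le_trans xr); exact: ler_norm.
by apply: (@closed_comp _ _ rad [set t | t <= r]); [move=> x _; exact: rad_cont|exact: closed_le].
Qed.

Lemma rad_convex (r : R) : convex_set [set x | rad x < r].
Proof.
move=> x y t /= xr yr /andP[t0 t1].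
have -> : rad (x + t *: (y - x)) = `|(1 - t) *: ((x - x0) *m Q^T) + t *: ((y - x0) *m Q^T)|.
  rewrite /rad !scalemxAl -mulmxDl; congr (`|_ *m _|).
  apply/rowP => k; rewrite !mxE; ring.
apply: (le_lt_trans (ler_normD _ _)); rewrite !normrZ (ger0_norm t0) ger0_norm ?subr_ge0//.
rewrite -/(rad x) -/(rad y); move: (rad x) (rad y) xr yr => a b ar br.
have [->|tn] := eqVneq t 0; first by rewrite subr0 mul1r mul0r addr0.
have tp : 0 < t by rewrite lt_neqAle eq_sym tn.
have : t * b < t * r by rewrite ltr_pM2l.
have : (1 - t) * a <= (1 - t) * r by rewrite ler_wpM2l ?subr_ge0// ltW.
nra.
Qed.

Lemma rad_norm (r : R) x : rad x < r -> `|x - x0| < d.+1%:R * r.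
Proof.
move=> xr; have r0 : 0 < r by apply: le_lt_trans xr; exact: rad_ge0.
apply: (le_lt_trans (rad_dist x)); apply: (@le_lt_trans _ _ (d%:R * r)).
  by rewrite ler_wpM2l// ltW.
by rewrite ltr_pM2r// ltr_nat.
Qed.

Lemma mu_rad (r : R) : (mu [set x | (rad x < r)%R] < +oo)%E.
Proof.
have [r0|r0] := ltP 0 r; last first.
  rewrite (_ : [set x | _] = set0) ?measure0// -subset0 => x /=.
  by move=> /lt_le_trans/(_ r0); rewrite ltNge rad_ge0.
have dr : 0 < d.+1%:R * r by rewrite mulr_gt0.
apply: (@le_lt_trans _ _ (mu (ball x0 (d.+1%:R * r)))); last by rewrite lebesgue_rV_ball// ltry.
apply: le_measure; [apply/mem_set; apply: open_rV_measurable; exact: open_rad|apply/mem_set; exact: measurable_rV_ball|].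
by move=> x /= /rad_norm; rewrite -ball_normE /ball_ /= -[`|x0 - x|]normrN opprB.
Qed.

Section boundary_cutoff.
Implicit Types (f h w u v phi psi chi : E -> R) (g gam : 'I_d -> E -> R).
Variables (H Hs : R).
Hypothesis H0 : 0 < H.
Hypothesis HHs : H < Hs.
Let om : set E := [set x | rad x < H / 2].
Let oms : set E := [set x | rad x < Hs / 2].
Variables (chi : E -> R) (gam : 'I_d -> E -> R) (G : R).
Hypothesis Lchi : L12 chi.
Hypothesis chi01 : forall x, 0 <= chi x <= 1.
Hypothesis Lgam : forall k, L12 (gam k).
Hypothesis gamG : forall k x, `|gam k x| <= G.
Hypothesis wchi : wg oms chi gam.
Hypothesis chi0 : forall x, ~ om x -> chi x = 0.
Hypothesis chic : forall x, om x -> {for x, continuous chi}.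

(** The width of the layer in which chi is compared with the distance to the
    boundary: at most H / 4 to stay away from the centre, and at most (Hs - H)
    / 8 so that the reflected points remain in the larger cube. *)
Definition depth0 : R := Num.min (H / 4) ((Hs - H) / 8).

Lemma depth0_gt0 : 0 < depth0.
Proof. by rewrite lt_min !divr_gt0// subr_gt0. Qed.

(** A point x at depth s below the boundary is compared with the point x + h
    on the same ray from the centre at height s above it, where chi vanishes.
    A mollification of chi has gradient at most G between the two, so its
    value at x is at most a multiple of s; continuity of chi at x transfers
    this to chi. *)
Lemma chi_boundary x : om x -> H / 2 - rad x <= depth0 ->
  chi x <= 4 * d%:R ^+ 2 * G * (H / 2 - rad x).
Proof.
rewrite /om /=; set s := H / 2 - rad x => ox; rewrite le_min => /andP[s1 s2].
have s0 : 0 < s by rewrite subr_gt0.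
have radE : rad x = H / 2 - s by rewrite /s; lra.
clearbody s.
have r4 : H / 4 <= rad x by rewrite radE; lra.
have rp : 0 < rad x by apply: lt_le_trans r4; rewrite divr_gt0.
have rn : rad x != 0 by rewrite gt_eqF.
(* x + h = x0 + t (x - x0) lies at radius H / 2 + s. *)
set t := (H / 2 + s) / rad x.
have t1 : t - 1 = 2 * s / rad x.
  apply: (mulIf rn); rewrite mulrBl mul1r /t !divfK// radE; lra.
have t1p : 0 <= t - 1 by rewrite t1 divr_ge0 ?(ltW rp)// mulr_ge0// ltW.
pose h := (t - 1) *: (x - x0).
have hn : `|h| <= 4 * d%:R * s.
  rewrite /h normrZ ger0_norm// t1.
  apply: (@le_trans _ _ (2 * s / rad x * (d%:R * rad x))).
    by rewrite ler_wpM2l ?rad_dist// divr_ge0 ?(ltW rp)// mulr_ge0// ltW.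
  rewrite mulrCA divfK// -mulrA [leRHS]mulrCA ler_wpM2l//; lra.
have d0 : 0 <= G * d%:R.
  have [->|dn] := posnP d; first by rewrite mulr0.
  by rewrite mulr_ge0//; apply: le_trans (gamG (Ordinal dn) x).
apply/ler_addgt0Pr => e e0.
have [r r0 hr] : exists2 r : R, 0 < r & forall y, `|y - x| < r -> `|chi y - chi x| <= e.
  have /(_ (ball (chi x) e)) := chic ox; rewrite nbhs_ballP.
  have nb : nbhs (chi x) (ball (chi x) e) by exact: nbhsx_ballx.
  move=> /(_ nb)/nbhs_ballP[r /= r0 hr]; exists r => // y yx.
  have : ball x r y by rewrite -ball_normE /ball_ /= -normrN opprB.
  by move=> /hr; rewrite /= -ball_normE /ball_ /= -normrN opprB => /ltW.
pose m := Num.min s ((Hs - H) / 8).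
have m0 : 0 < m by rewrite lt_min s0 divr_gt0// subr_gt0.
(* Small enough for continuity at x, for the kernel at x + h not to reach the
   cube, and for the kernel along the segment to stay in the large cube. *)
pose eps := Num.min r (m / d.+1%:R).
have eps0 : 0 < eps by rewrite lt_min r0 divr_gt0.
have deps (z : E) : `|z| <= eps -> d%:R * `|z| <= m.
  move=> ze; apply: (@le_trans _ _ (d.+1%:R * `|z|)); first by rewrite ler_wpM2r// ler_nat.
  rewrite mulrC -ler_pdivlMr//; apply: (le_trans ze); by rewrite /eps ge_min lexx orbT.
have ms : m <= s by rewrite /m ge_min lexx.
have mHs : m <= (Hs - H) / 8 by rewrite /m ge_min lexx orbT.
have cm := @cutoffable_moll R d _ eps0.
have Ichi : intg chi by case: Lchi.
pose w := conv chi (moll eps).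
have sw : smooth w by exact: smooth_conv.
have wx : `|w x - chi x| <= e.
  apply: conv_moll_near => // z ze; apply: hr; rewrite addrAC subrr add0r.
  by apply: lt_le_trans ze _; rewrite /eps ge_min lexx.
have radxh : rad (x + h) = H / 2 + s.
  rewrite (_ : x + h = x0 + t *: (x - x0)); last first.
    by apply/rowP => k; rewrite !mxE; ring.
  rewrite rad_line ger0_norm; last by lra.
  by rewrite /t divfK// gt_eqF.
have wy : w (x + h) = 0.
  apply/eqP; rewrite -normr_le0 -[w _]subr0; apply: conv_moll_near => // z ze.
  rewrite chi0 ?subrr ?normr0// /om /=; apply/negP; rewrite -leNgt.
  have := rad_lip (x + h + z) (x + h); rewrite opprD addrA subrr add0r normrN radxh.
  have := deps z (ltW ze); move: (d%:R * _) (rad _) => p q; lra.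
have dw k y : rad y <= H / 2 + s -> `|partial k w y| <= G.
  move=> ry; rewrite /w (partial_conv_wg (U := oms) (g := gam))//.
    rewrite -[conv _ _ _]subr0; apply: conv_moll_near => //; first by case: (Lgam k).
    by move=> z _; rewrite subr0.
  move=> z hz; rewrite /oms /=; apply: (le_lt_trans (rad_lip y z)).
  have := deps _ hz; move: ry; move: (d%:R * _) (rad _) => p q; lra.
have [tau /andP[tau0 tau1] hv] := rV_MVT x h (fun y => smooth_diff y sw).
have rtau : rad (tau *: h + x) <= H / 2 + s.
  rewrite (_ : tau *: h + x = x0 + (1 + tau * (t - 1)) *: (x - x0)); last first.
    by apply/rowP => k; rewrite !mxE; ring.
  rewrite rad_line ger0_norm; last by rewrite addr_ge0// mulr_ge0// ltW.
  apply: (@le_trans _ _ (t * rad x)); last by rewrite /t divfK// gt_eqF.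
  rewrite ler_wpM2r ?(ltW rp)// -lerBrDl; rewrite -[leRHS]mul1r ler_wpM2r// ltW//.
have wdiff : `|w (x + h) - w x| <= d%:R * (`|h| * G).
  rewrite hv; apply: (le_trans (ler_norm_sum _ _ _)).
  apply: (@le_trans _ _ (\sum_(k < d) (`|h| * G))); last by rewrite sumr_const card_ord mulr_natl.
  by apply: ler_sum => k _; rewrite normrM ler_pM// ?rV_norm_coord// dw.
rewrite wy add0r normrN in wdiff.
have wdiff' : `|w x| <= 4 * d%:R ^+ 2 * G * s.
  apply: (le_trans wdiff); rewrite mulrCA [d%:R * G]mulrC; apply: (le_trans (ler_wpM2r d0 hn)).
  by rewrite le_eqVlt; apply/orP; left; apply/eqP; ring.
move: wx; rewrite ler_norml => /andP[+ _]; rewrite lerBrDl lerBlDr => h1.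
by apply: (le_trans h1); rewrite lerD2r; apply: le_trans wdiff'; exact: ler_norm.
Qed.

Let oom : open om. Proof. exact: open_rad. Qed.
Let mom : measurable om. Proof. exact: open_rV_measurable. Qed.
Let om_oms : om `<=` oms.
Proof. by move=> x; rewrite /om /oms /= => /lt_trans; apply; rewrite ltr_pM2r. Qed.

(** The product rule, extended by zero outside the inner cube. *)
Definition chi_grad u g k : E -> R := (fun x => chi x * g k x + gam k x * u x) \_ om.

Lemma chi_norm x : `|chi x| <= 1.
Proof. by have /andP[c0 c1] := chi01 x; rewrite ger0_norm. Qed.

Lemma gam_meas k : measurable_fun setT (gam k). Proof. exact: L12_meas. Qed.

Lemma chiM_L12 u : L12 u -> L12 (fun x => chi x * u x).
Proof.
by move=> Lu; under eq_fun do rewrite mulrC; exact: (L12M_bounded Lu (L12_meas Lchi) chi_norm).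
Qed.

Lemma chi_grad_L12 u g k : L12 u -> L12 (g k) -> L12 (chi_grad u g k).
Proof.
move=> Lu Lg; apply: L12_restrict => //; apply: L12D; first exact: chiM_L12.
by under eq_fun do rewrite mulrC; exact: (L12M_bounded Lu (gam_meas k) (gamG k)).
Qed.

Lemma chi_wg u g : L12 u -> (forall k, L12 (g k)) -> wg oms u g ->
  wg om (fun x => chi x * u x) (chi_grad u g).
Proof.
move=> Lu Lg wu; apply: wg_restrict.
apply: (wg_mul (M := Num.max 1 G)) => //.
- exact: L12_meas.
- by move=> x; rewrite le_max chi_norm.
- exact: gam_meas.
- by move=> k x; rewrite le_max gamG orbT.
- exact: wgS wchi.
- exact: wgS wu.
Qed.

(** Cut off chi u by smooth functions th n that vanish in a layer of width del
    n at the boundary. The derivative of th n is of order 1 / del n on a layer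
    where chi is of order del n, so that the new term in the gradient is
    dominated by a multiple of u, and it tends to 0 pointwise. The truncated
    functions have compact support, and compact_support_approx applies to
    them. *)
Lemma chi_H10 u g : L12 u -> (forall k, L12 (g k)) -> wg oms u g ->
  H10 om (fun x => chi x * u x).
Proof.
move=> Lu Lg wu; pose v x := chi x * u x; pose h := chi_grad u g.
have Lv : L12 v by exact: chiM_L12.
have Lh k : L12 (h k) by exact: chi_grad_L12.
have wv : wg om v h by exact: chi_wg.
have v_out x : ~ om x -> v x = 0 by move=> ox; rewrite /v chi0// mul0r.
have h_out k x : ~ om x -> h k x = 0 by move=> ox; rewrite /h /chi_grad patchE memNset.
apply: (H10_approx oom Lv Lh wv) => e e0.
have [C C0 hC] := @cutoff_exists R d.
have dp := depth0_gt0.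
pose del n : R := depth0 / 3 / n.+1%:R.
have del0 n : 0 < del n by rewrite !divr_gt0.
have del1 n : 3 * del n <= depth0.
  rewrite /del mulrA [3 * _]mulrC divfK// ler_pdivrMr// ler_peMr ?(ltW dp)//.
  by rewrite ler1n.
(* The cutoff is the mollified indicator function of W n; it is 1 at depth at
   least 3 del n below the boundary and 0 at depth at most del n. *)
pose W n : set E := [set x | rad x < H / 2 - 2 * del n].
have mW n : measurable (W n) by apply: open_rV_measurable; exact: open_rad.
have ee0 n : 0 < del n / d.+1%:R by rewrite divr_gt0.
have /choice[th hth] := fun n => hC (W n) _ (mW n) (mu_rad _) (ee0 n).
have dz n (z : E) : `|z| <= del n / d.+1%:R -> d%:R * `|z| < del n.
  move=> ze; have [->|zn] := eqVneq z 0; first by rewrite normr0 mulr0.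
  apply: (@lt_le_trans _ _ (d.+1%:R * `|z|)); first by rewrite ltr_pM2r ?normr_gt0// ltr_nat.
  by rewrite mulrC -ler_pdivlMr.
have th_in n x : rad x <= H / 2 - 3 * del n -> th n x = 1 /\ forall k, partial k (th n) x = 0.
  move=> rx; have [_ _ _ h1 _] := hth n; apply: h1 => z /dz hz; rewrite /W /=.
  have := rad_lip x (x + z); rewrite addrAC subrr add0r.
  move: hz rx; move: (d%:R * _) (rad x) (rad (x + z)) (del n) => p q r s; lra.
have th_out n x : H / 2 - del n <= rad x -> th n x = 0 /\ forall k, partial k (th n) x = 0.
  move=> rx; have [_ _ _ _ h1] := hth n; apply: h1 => z /dz hz; rewrite /W /=; apply/negP; rewrite -leNgt.
  have := rad_lip (x + z) x; rewrite opprD addrA subrr add0r normrN.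
  move: hz rx; move: (d%:R * _) (rad x) (rad (x + z)) (del n) => p q r s; lra.
(* The product of the bound of order 3 del n on chi and of that of order 1 /
   del n on the gradient of th n. *)
pose C' := C * d.+1%:R * (4 * d%:R ^+ 2 * `|G| * 3).
have C'0 : 0 <= C' by rewrite !mulr_ge0// ltW.
have chith n k x : `|chi x * partial k (th n) x| <= C'.
  have [ox|ox] := pselect (om x); last by rewrite chi0// mul0r normr0.
  have [rx|rx] := leP (rad x) (H / 2 - 3 * del n).
    by have [_ ->] := th_in n x rx; rewrite mulr0 normr0.
  have sx : H / 2 - rad x <= 3 * del n by lra.
  have sx0 : 0 <= H / 2 - rad x by rewrite subr_ge0 ltW.
  have hc := chi_boundary ox (le_trans sx (del1 n)).
  have [_ _ h1 _ _] := hth n.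
  rewrite normrM ger0_norm; last by case/andP: (chi01 x).
  have hc' : chi x <= 4 * d%:R ^+ 2 * `|G| * (3 * del n).
    apply: (le_trans hc); apply: (@le_trans _ _ (4 * d%:R ^+ 2 * `|G| * (H / 2 - rad x))).
      by rewrite ler_wpM2r// ler_wpM2l ?ler_norm// mulr_ge0// exprn_ge0.
    by rewrite ler_wpM2l// !mulr_ge0// exprn_ge0.
  apply: (@le_trans _ _ (4 * d%:R ^+ 2 * `|G| * (3 * del n) * (C / (del n / d.+1%:R)))).
    by rewrite ler_pM//; case/andP: (chi01 x).
  rewrite le_eqVlt; apply/orP; left; apply/eqP; rewrite /C'; move: (del n) (del0 n) => s s0.
  by field; rewrite !gt_eqF//= ltr0n.
have th01 n x : 0 <= th n x <= 1 by case: (hth n).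
have sth n : smooth (th n) by case: (hth n).
have dth n k x : `|partial k (th n) x| <= C / (del n / d.+1%:R) by case: (hth n).
have mth n : measurable_fun setT (th n) by exact: smooth_meas.
have mdth n k : measurable_fun setT (partial k (th n)) by apply: smooth_meas; exact: smooth_partial.
have thn n x : `|th n x| <= 1 by have /andP[t0 t1] := th01 n x; rewrite ger0_norm.
pose vn n x := th n x * v x.
pose hn n k x := th n x * h k x + partial k (th n) x * v x.
have Lvn n : L12 (vn n).
  by rewrite /vn; under eq_fun do rewrite mulrC; exact: (L12M_bounded Lv (mth n) (thn n)).
have Lhn n k : L12 (hn n k).
  apply: L12D.
    by under eq_fun do rewrite mulrC; exact: (L12M_bounded (Lh k) (mth n) (thn n)).
  by under eq_fun do rewrite mulrC; exact: (L12M_bounded Lv (mdth n k) (dth n k)).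
have wvn n : wg om (vn n) (hn n).
  apply: (@wg_mul _ _ om (th n) (fun k => partial k (th n)) v h (Num.max 1 (C / (del n / d.+1%:R)))) => //.
  - by move=> x; rewrite le_max thn.
  - by move=> k x; rewrite le_max dth orbT.
  - exact: wg_smooth.
pose F n x := (vn n x - v x) ^+ 2 + \sum_k (hn n k x - h k x) ^+ 2.
have IF n : intg (F n).
  apply: intgD; first by have [] := L12B (Lvn n) Lv.
  by apply: intg_sum => k; have [] := L12B (Lhn n k) (Lh k).
have F0 n x : 0 <= F n x by rewrite addr_ge0 ?sqr_ge0// sumr_ge0// => k _; exact: sqr_ge0.
(* The dominating function. *)
pose D x := v x ^+ 2 + \sum_k (2 * h k x ^+ 2 + 2 * (C' ^+ 2 * u x ^+ 2)).
have ID : intg D.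
  apply: intgD; first exact: Lv.2.
  apply: intg_sum => k; apply: intgD; first by apply: intgZ; exact: (Lh k).2.
  by apply: intgZ; apply: intgZ; exact: Lu.2.
have th1 n x : (th n x - 1) ^+ 2 <= 1.
  rewrite -[leRHS](expr1n _ 2) -[leLHS]real_normK ?num_real// lerXn2r ?nnegrE//.
  by have /andP[t0 t1] := th01 n x; rewrite ler_norml; apply/andP; split; lra.
have FD n x : `|F n x| <= D x.
  rewrite ger0_norm// lerD//.
    rewrite (_ : vn n x - v x = (th n x - 1) * v x); last by rewrite mulrBl mul1r.
    by rewrite exprMn ler_piMl ?sqr_ge0.
  apply: ler_sum => k _.
  rewrite (_ : hn n k x - h k x = (th n x - 1) * h k x + (chi x * partial k (th n) x) * u x); last first.
    by rewrite /hn /v; move: (th n x) (h k x) (partial k (th n) x) (chi x) (u x); clear; move=> a b c a' b'; ring.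
  apply: (le_trans (sqrD_le _ _)); apply: lerD; rewrite ler_wpM2l// exprMn.
    by rewrite ler_piMl ?sqr_ge0.
  rewrite ler_wpM2r ?sqr_ge0// -[leLHS]real_normK ?num_real// lerXn2r ?nnegrE//; exact: chith.
have Fcvg x : F ^~ x @ \oo --> (0 : R).
  apply: cvg_near_cst; have [ox|ox] := pselect (om x); last first.
    near=> n; rewrite /F /vn /hn v_out// big1 ?mulr0 ?subr0 ?expr0n ?addr0// => k _.
    by rewrite h_out// !mulr0 addr0 subr0 expr0n.
  have sx0 : 0 < H / 2 - rad x by rewrite subr_gt0.
  pose N := Num.bound (depth0 / (H / 2 - rad x)).
  near=> n; have nN : (N <= n)%N by near: n; exists N.
  have rx : rad x <= H / 2 - 3 * del n.
    have q0 : 0 <= depth0 / (H / 2 - rad x) by rewrite divr_ge0 ?(ltW dp) ?(ltW sx0).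
    have hN := archi_boundP q0; rewrite -/N in hN.
    have hn1 : depth0 / (H / 2 - rad x) <= n.+1%:R.
      by apply/ltW/(lt_le_trans hN); rewrite ler_nat; exact: leqW.
    move: hn1; rewrite ler_pdivrMr// => hn1.
    have : 3 * del n <= H / 2 - rad x.
      by rewrite /del mulrA [3 * _]mulrC divfK// ler_pdivrMr// mulrC.
    by rewrite lerBrDl -lerBrDr.
  have [t1 dt] := th_in n x rx.
  rewrite /F /vn /hn t1 mul1r subrr expr0n add0r big1// => k _.
  by rewrite dt mul0r addr0 mul1r subrr expr0n.
have e40 : 0 < e / 4 by rewrite divr_gt0.
have Dfin : (\int[mu]_(x in setT) (D x)%:E < +oo)%E.
  rewrite -intg_EFin ?ltry// => x; exact: le_trans (normr_ge0 _) (FD 0%N x).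
have [N hN] := @dominated_small _ _ R mu setT F D (e / 4) measurableT (fun n => intg_meas (IF n))
   (intg_meas ID) e40 (fun x _ => Fcvg x) (fun n x _ => FD n x) Dfin.
have {}hN : \int[mu]_x F N x <= e / 4.
  rewrite -lee_fin intg_EFin//; apply: le_trans (hN N (leqnn N)).
  by under [leRHS]eq_integral do rewrite ger0_norm//.
have hv : sqnorm (fun x => vn N x - v x) <= e / 4.
  apply: le_trans hN; apply: le_Rint => //; first by have [] := L12B (Lvn N) Lv.
  by move=> x; rewrite lerDl sumr_ge0// => k _; exact: sqr_ge0.
have hh k : sqnorm (fun x => hn N k x - h k x) <= e / 4.
  apply: le_trans hN; apply: le_Rint => //; first by have [] := L12B (Lhn N k) (Lh k).
  move=> x; rewrite /F (bigD1 k)//= addrCA lerDl addr_ge0 ?sqr_ge0// sumr_ge0// => j _; exact: sqr_ge0.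
have cK := @compact_rad (H / 2 - del N).
set K := [set x | _] in cK.
have Kom : K `<=` om by move=> x; rewrite /K /om /= => /le_lt_trans; apply; rewrite ltrBlDr ltrDl.
have thK x : ~ K x -> th N x = 0 /\ forall k, partial k (th N) x = 0.
  by move=> Kx; apply: th_out; apply: ltW; rewrite ltNge; apply/negP.
have vK x : ~ K x -> vn N x = 0 by move=> /thK[t0 _]; rewrite /vn t0 mul0r.
have hK k x : ~ K x -> hn N k x = 0 by move=> /thK[t0 dt]; rewrite /hn t0 dt !mul0r addr0.
have [phi [tp p1 p2]] := compact_support_approx oom cK Kom vK hK (Lvn N) (Lhn N) (wvn N) e40.
have Lp : L12 phi by apply: cutoffable_L12; exact: test_fun_cutoffable tp.
have Ldp k : L12 (partial k phi).
  by apply: cutoffable_L12; apply: cutoffable_partial; exact: test_fun_cutoffable tp.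
have tri (a b c : E -> R) : L12 a -> L12 b -> L12 c -> sqnorm (fun x => a x - b x) <= e / 4 ->
    sqnorm (fun x => b x - c x) <= e / 4 -> sqnorm (fun x => a x - c x) <= e.
  move=> La Lb Lc h1 h2; have := sqnormD_le (L12B La Lb) (L12B Lb Lc).
  under eq_fun do rewrite subrKA.
  move=> hle; apply: (le_trans hle); apply: (@le_trans _ _ (2 * (e / 4) + 2 * (e / 4))).
    by rewrite lerD// ler_wpM2l.
  by rewrite le_eqVlt; apply/orP; left; apply/eqP; field.
exists phi; split => //; first exact: tri p1 hv.
by move=> k; exact: tri (p2 k) (hh k).
Unshelve. all: by end_near.
Qed.

End boundary_cutoff.

End rotated_cube.

(** * Solutions of the equation as pairs of a function and a gradient *)

Section ae_transfer.
Context {R : realType} {d : nat}.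
Local Notation E := 'rV[R]_d.
Local Notation mu := (lebesgue_rV R d).
Implicit Types (f h w u v phi psi chi : E -> R) (U K S om W Z : set E) (g gam : 'I_d -> E -> R).

Lemma ae_sub U K (f h : E -> R) : U `<=` K -> {ae mu, forall x, K x -> f x = h x} ->
  {ae mu, forall x, U x -> f x = h x}.
Proof. by move=> UK; apply: filterS => x hx /UK; exact: hx. Qed.

Lemma wg_ae U u g g' : open U -> (forall k, measurable_fun U (g k)) -> (forall k, measurable_fun U (g' k)) ->
  (forall k, {ae mu, forall x, U x -> g k x = g' k x}) -> wg U u g -> wg U u g'.
Proof.
move=> oU mg mg' gg wu phi k tp; have mU := open_rV_measurable oU.
have p0 x : ~ U x -> phi x = 0 by exact: test_fun_out tp.
have mp : measurable_fun U phi.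
  by apply: measurable_funTS; apply: smooth_meas; case: tp.
rewrite wu// -!(RintI _ p0); congr (- _); apply: ae_Rint => //; try exact: measurable_funM.
by apply: filterS (gg k) => x hx Ux; rewrite hx.
Qed.

Lemma integrable_ae (D : set E) (f h : E -> R) : measurable D -> measurable_fun D h ->
  {ae mu, forall x, D x -> f x = h x} -> mu.-integrable D (EFin \o f) -> mu.-integrable D (EFin \o h).
Proof.
move=> mD mh fh /integrableP[mf fi]; apply/integrableP; split; first exact/measurable_EFinP.
rewrite (_ : (\int[mu]_(x in D) `|(EFin \o h) x|)%E = (\int[mu]_(x in D) `|(EFin \o f) x|)%E)//.
apply: ae_eq_integral => //.
- by apply: measurableT_comp => //; exact/measurable_EFinP.
- exact: measurableT_comp.
- by apply: filterS fh => x hx Dx /=; rewrite hx.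
Qed.

(** Needed because the approximation of chi u by a combination of basis
    functions is an identity almost everywhere only. *)
Lemma is_weak_grad_ae om u v G : open om -> measurable_fun om v ->
  {ae mu, forall x, om x -> u x = v x} -> is_weak_grad om u G -> is_weak_grad om v G.
Proof.
move=> oom mv uv [[mu' iu] lG hG]; split => //.
  split => // K Kom cK; have mK : measurable K.
    rewrite -[K]setCK; apply: measurableC; apply: open_rV_measurable.
    by apply: closed_openC; apply: compact_closed => //; exact: norm_hausdorff.
  apply: (integrable_ae mK _ (ae_sub Kom uv) (iu K Kom cK)).
  by apply: measurable_funS Kom mv; exact: open_rV_measurable.
move=> phi k tp; rewrite -hG//; have mom := open_rV_measurable oom.
have mp : measurable_fun om (partial k phi).
  by apply: measurable_funTS; apply: smooth_meas; apply: smooth_partial; case: tp.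
apply: ae_Rint => //; try exact: measurable_funM.
by apply: filterS uv => x hx ox; rewrite hx.
Qed.

Lemma test_fun_H10 om phi : open om -> test_fun om phi -> H10 om phi.
Proof.
move=> oom tp; have cp := test_fun_cutoffable tp.
have Lp : L12 phi by exact: cutoffable_L12.
have Ldp k : L12 (partial k phi) by apply: cutoffable_L12; exact: cutoffable_partial.
apply: (H10_approx oom Lp Ldp); first by apply: wg_smooth; case: tp.
have z f : sqnorm (fun x => f x - f x) = 0.
  by rewrite /sqnorm -[RHS](@Rint0 R d); apply: eq_Rintegral => x _; rewrite subrr expr0n.
by move=> e e0; exists phi; split => // [|k]; rewrite z ltW.
Qed.

Section coeff.
Variables (om : set E) (A : E -> 'M[R]_d) (alpha beta : R).
Hypothesis mA : forall k l, measurable_fun om (fun x => A x k l).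
Hypothesis symA : forall x, om x -> (A x)^T = A x.
Hypothesis ellA : forall x xi : E, om x ->
  alpha * enorm xi ^+ 2 <= dot (xi *m (A x)^T) xi <= beta * enorm xi ^+ 2.
Hypothesis alpha0 : 0 < alpha.
Hypothesis beta0 : 0 <= beta.
Hypothesis oom : open om.
Hypothesis fom : (mu om < +oo)%E.

Lemma fluxdot_Rint g g' :
  \int[mu]_(x in om) dot (vec g x *m (A x)^T) (vec g' x) = \int[mu]_x fluxdot om A g g' x.
Proof.
rewrite Rintegral_mkcond; apply: eq_Rintegral => x _; rewrite patchE.
by case: ifPn => [/set_mem ox|/negP ox]; [rewrite fluxdot_in|rewrite fluxdot_out// => /mem_set].
Qed.

Lemma fluxdot_linl a g1 g2 g' x : fluxdot om A (a *: g1 + g2) g' x =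
  a * fluxdot om A g1 g' x + fluxdot om A g2 g' x.
Proof.
rewrite /fluxdot mulr_sumr -big_split/=; apply: eq_bigr => l _.
rewrite mulrA -mulrDl; congr (_ * _); rewrite /flux mulr_sumr -big_split/=.
by apply: eq_bigr => k _; rewrite mulrA -mulrDl.
Qed.

Lemma fluxdotC g g' x : fluxdot om A g g' x = fluxdot om A g' g x.
Proof.
have [ox|ox] := pselect (om x); last by rewrite !fluxdot_out.
by rewrite !fluxdot_in//; exact: aformC symA _ _ _ ox.
Qed.

Lemma fluxdot_ge g x : (forall k, ~ om x -> g k x = 0) ->
  alpha * \sum_k g k x ^+ 2 <= fluxdot om A g g x <= beta * \sum_k g k x ^+ 2.
Proof.
move=> g0; have [ox|ox] := pselect (om x).
  by rewrite fluxdot_in// -sum_sq_vec -enorm2; exact: ellA.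
rewrite fluxdot_out// big1 ?mulr0 ?lexx// => k _; by rewrite g0// expr0n.
Qed.

Definition energy g g' : R := \int[mu]_x fluxdot om A g g' x.

Lemma energy_bounds g : (forall k, L12 (g k)) -> (forall k x, ~ om x -> g k x = 0) ->
  alpha * \sum_k sqnorm (g k) <= energy g g <= beta * \sum_k sqnorm (g k).
Proof.
move=> Lg g0; have If := fluxdot_intg mA symA ellA alpha0 beta0 oom Lg Lg.
have Is : intg (fun x => \sum_k g k x ^+ 2) by apply: intg_sum => k; exact: (Lg k).2.
rewrite -Rint_sum; last by move=> k; exact: (Lg k).2.
rewrite -!RintZ//; apply/andP; split; apply: le_Rint => //; try exact: intgZ.
all: by move=> x; have /andP[] := @fluxdot_ge g x (fun k => g0 k x).
Qed.

Lemma harm_lin a u1 g1 u2 g2 : harm om A u1 g1 -> harm om A u2 g2 ->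
  harm om A (a *: u1 + u2) (a *: g1 + g2).
Proof.
move=> [L1 G1 w1 h1] [L2' G2 w2 h2].
have LZ1 : L12 (fun x => a * u1 x) by exact: L12Z.
have LZg k : L12 (fun x => a * g1 k x) by exact: L12Z.
split.
- exact: (L12D LZ1 L2').
- by move=> k; exact: (L12D (LZg k) (G2 k)).
- exact: (wgD LZ1 L2' LZg G2 (wgZ a L1 G1 w1) w2).
move=> phi tp.
have Lp l : L12 (partial l phi).
  by apply: cutoffable_L12; apply: cutoffable_partial; exact: test_fun_cutoffable tp.
under eq_Rintegral do rewrite fluxdot_linl.
have I1 := fluxdot_intg mA symA ellA alpha0 beta0 oom G1 Lp.
have I2 := fluxdot_intg mA symA ellA alpha0 beta0 oom G2 Lp.
by rewrite RintD ?RintZ ?h1 ?h2 ?mulr0 ?addr0//; exact: intgZ.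
Qed.

Lemma harm0 : harm om A 0 0.
Proof.
split; [exact: L120|by move=> k; exact: L120|exact: wg0|].
move=> phi tp; rewrite -[RHS](@Rint0 R d); apply: eq_Rintegral => x _.
rewrite /fluxdot big1// => l _; rewrite /flux big1 ?mul0r// => k _; exact: mul0r.
Qed.

Lemma harm_const : harm om A (\1_om) 0.
Proof.
have mom' := open_rV_measurable oom.
have I1 := intg_indic mom' fom.
split.
- split => //; rewrite (_ : (fun x => _) = \1_om)//; apply/funext => x.
  by rewrite indicE; case: (_ \in _); rewrite ?expr1n ?expr0n.
- by move=> k; exact: L120.
- move=> phi k tp; have := @wg_smooth R d om (fun=> 1) (smooth_cst 1) phi k tp.
  rewrite partial_cst => h; rewrite -[RHS]h; apply: eq_Rintegral => x _.
  rewrite indicE; case: (boolP (x \in om)) => // /negP ox; rewrite mul0r.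
  by rewrite (test_fun_out (test_fun_partial k tp)) ?mulr0// => /mem_set.
- by case: harm0.
Qed.

(** Elements of H_A enter the calculus of pairs through extension by zero.
    Test functions belong to H^1_0 (test_fun_H10), so they may be used in the
    equation. *)
Lemma HA_harm u : HA A om u -> exists g, [/\ harm om A (u \_ om) g,
  (forall k x, ~ om x -> g k x = 0) & anorm A om u = Num.sqrt (energy g g)].
Proof.
have mom' := open_rV_measurable oom.
move=> [[Lu [G hG LG]] hu]; exists (fun k => (fun x => G x ord0 k) \_ om).
set g := (fun k => _ \_ om).
have Lg k : L12 (g k) by apply: L2_L12.
have wu : wg om (u \_ om) g by exact: weak_grad_wg.
have gE x : om x -> vec g x = G x.
  by move=> ox; apply/rowP => k; rewrite mxE /g patchE mem_set.
have aE v (g' : 'I_d -> E -> R) : is_weak_grad om v (vec g') ->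
    aform A om u v = \int[mu]_x fluxdot om A g g' x.
  move=> hv; rewrite (aform_wg oom mA hG hv) -fluxdot_Rint.
  by apply: eq_Rintegral => x /set_mem ox; rewrite gE.
split.
- split => //; first exact: L2_L12.
  move=> phi tp; rewrite -(aE phi); first by apply: hu; exact: test_fun_H10.
  apply: (wg_weak_grad oom (@subset_refl _ om)).
  + by apply: cutoffable_L12; exact: test_fun_cutoffable tp.
  + by move=> k; apply: cutoffable_L12; apply: cutoffable_partial; exact: test_fun_cutoffable tp.
  + by apply: wg_smooth; case: tp.
- by move=> k x ox; rewrite /g patchE memNset.
- rewrite /anorm /energy (aform_wg oom mA hG hG) -fluxdot_Rint; congr Num.sqrt.
  by apply: eq_Rintegral => x /set_mem ox; rewrite gE.
Qed.

End coeff.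
End ae_transfer.

(** * Approximation of solutions by finitely many of them *)

Lemma fst_sub_sum_scale {R : realType} (U V : lmodType R) m (p : U * V) (c : 'I_m -> R) (w : 'I_m -> U * V) :
  (p - \sum_j c j *: w j).1 = p.1 - \sum_j c j *: (w j).1.
Proof. by rewrite [LHS]/= (raddf_sum fst). Qed.

Lemma fct_sum_scale {R : realType} (T : Type) m (c : 'I_m -> R) (w : 'I_m -> T -> R) x :
  (\sum_j c j *: w j) x = \sum_j c j * w j x.
Proof. by rewrite fct_sumE. Qed.

Lemma expRN_nat {R : realType} (N : nat) : expR (- N%:R) = expR (-1) ^+ N :> R.
Proof. by rewrite -expRM_natl mulrN1. Qed.

Section approximation.
Context {R : realType} {d : nat}.
Local Notation E := 'rV[R]_d.
Local Notation mu := (lebesgue_rV R d).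
Implicit Types (f h w u v phi psi : E -> R) (U K om W Z : set E) (g gam : 'I_d -> E -> R).
Variables (x0 : E) (Q : 'M[R]_d).
Hypothesis hQ : orthogonal_mx Q.
Variables (H Hs : R).
Hypothesis H0 : 0 < H.
Hypothesis HHs : H < Hs.
Let rd := rad x0 Q.
Let om : set E := [set x | rd x < H / 2].
Let oms : set E := [set x | rd x < Hs / 2].
Variables (A : E -> 'M[R]_d) (alpha beta : R).
Hypothesis mA : forall k l, measurable_fun oms (fun x => A x k l).
Hypothesis symA : forall x, oms x -> (A x)^T = A x.
Hypothesis ellA : forall x xi : E, oms x ->
  alpha * enorm xi ^+ 2 <= dot (xi *m (A x)^T) xi <= beta * enorm xi ^+ 2.
Hypothesis alpha0 : 0 < alpha.
Hypothesis beta0 : 0 <= beta.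

Let S0 : R := (H + Hs) / 4.
Let S : set E := [set x | rd x < S0].
Let S00 : 0 < S0. Proof. by rewrite divr_gt0// addr_gt0// (lt_trans H0). Qed.
Let oom : open om. Proof. exact: open_rad. Qed.
Let ooms : open oms. Proof. exact: open_rad. Qed.
Let foms : (mu oms < +oo)%E. Proof. exact: mu_rad. Qed.
Let mS : measurable S. Proof. by apply: open_rV_measurable; exact: open_rad. Qed.
Let fS : (mu S < +oo)%E. Proof. exact: mu_rad. Qed.
Let SK : S `<=` [set x | rd x <= S0]. Proof. by move=> x /ltW. Qed.
Let Koms : [set x | rd x <= S0] `<=` oms.
Proof. by move=> x; rewrite /oms /= => /le_lt_trans; apply; have := HHs; rewrite /S0; lra. Qed.
Let Soms : S `<=` oms. Proof. exact: subset_trans SK Koms. Qed.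

Lemma mean_cube_pos : exists2 V : R, 0 < V & mu S = V%:E.
Proof.
pose r := S0 / d.+1%:R; have r0 : 0 < r by rewrite divr_gt0.
have BS : ball x0 r `<=` S.
  move=> x; rewrite -ball_normE /ball_ /= -normrN opprB => xr; rewrite /S /=.
  have := rad_lip x0 hQ x0 x; rewrite {2}/rad subrr mul0mx normr0 add0r => h.
  apply: (le_lt_trans h); apply: (@le_lt_trans _ _ (d.+1%:R * `|x - x0|)).
    by rewrite ler_wpM2r// ler_nat.
  by rewrite mulrC -ltr_pdivlMr.
have : (mu (ball x0 r) <= mu S)%E.
  by apply: le_measure => //; apply/mem_set => //; exact: measurable_rV_ball.
rewrite lebesgue_rV_ball//; move: fS; case: (mu S) => [V|//|//] _; rewrite lee_fin => h.
by exists V => //; apply: lt_le_trans h; rewrite exprn_gt0// mulr2n addr_gt0.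
Qed.

(** The normalisation modulo constants under which cell means are bounded
    functionals. The mean is taken over the intermediate cube S, which has a
    margin to the boundary of the large one, as required by poincare_convex. *)
Definition mean0_harm u g := [/\ harm oms A u g, (forall k x, ~ oms x -> g k x = 0) &
  \int[mu]_x (u \_ S) x = 0].

Lemma mean0_harm_lin (a : R) u1 g1 u2 g2 : mean0_harm u1 g1 -> mean0_harm u2 g2 ->
  mean0_harm (fun x => a * u1 x + u2 x) (fun k x => a * g1 k x + g2 k x).
Proof.
move=> [hp p0 mp] [hq q0 mq]; split.
- exact: (harm_lin mA symA ellA alpha0 beta0 ooms a hp hq).
- by move=> k x ox; rewrite p0// q0// addr0 mulr0.
have [Lp _ _ _] := hp; have [Lq _ _ _] := hq.
have LpS : L12 (u1 \_ S) by exact: L12_restrict.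
have LqS : L12 (u2 \_ S) by exact: L12_restrict.
rewrite (_ : _ \_ S = fun x => a * (u1 \_ S) x + (u2 \_ S) x); last first.
  by apply/funext => x; rewrite !patchE; case: ifP => // _; rewrite mulr0 addr0.
rewrite RintD ?RintZ ?mp ?mq ?mulr0 ?addr0//; [by case: LpS| |by case: LqS].
by apply: intgZ; case: LpS.
Qed.

Let X : set ((E -> R) * ('I_d -> E -> R))%type := [set p | mean0_harm p.1 p.2].
Let B (p q : ((E -> R) * ('I_d -> E -> R))%type) : R := energy oms A p.2 q.2.

Lemma mean0_harm_subm : subm X.
Proof.
split; last by move=> a [u1 g1] [u2 g2]; exact: mean0_harm_lin.
split => //; first exact: harm0.
by rewrite -[RHS](@Rint0 R d); apply: eq_Rintegral => x _; rewrite patchE; case: ifP.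
Qed.

Lemma energy_linl (a : R) g1 g2 g3 : (forall k, L12 (g1 k)) -> (forall k, L12 (g2 k)) ->
  (forall k, L12 (g3 k)) ->
  energy oms A (a *: g1 + g2) g3 = a * energy oms A g1 g3 + energy oms A g2 g3.
Proof.
move=> L1 L2' L3; have I1 := fluxdot_intg mA symA ellA alpha0 beta0 ooms L1 L3.
have I2 := fluxdot_intg mA symA ellA alpha0 beta0 ooms L2' L3.
rewrite /energy -RintZ// -RintD//; last exact: intgZ.
by apply: eq_Rintegral => x _; exact: fluxdot_linl.
Qed.

Lemma energy_semi_inner : semi_inner B X.
Proof.
split.
- move=> [u3 g3] [[_ Lw _ _] _ _] a [u1 g1] [u2 g2] [[_ Lp _ _] _ _] [[_ Lq _ _] _ _].
  rewrite /B; change ((a *: (u1, g1) + (u2, g2)).2) with (a *: g1 + g2).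
  rewrite energy_linl//.
- move=> p q _ _; rewrite /B /energy; apply: eq_Rintegral => x _; exact: fluxdotC.
- move=> p [[_ Lp _ _] p0 _]; rewrite /B.
  have /andP[h _] := energy_bounds mA symA ellA alpha0 beta0 ooms Lp p0.
  by apply: le_trans h; rewrite mulr_ge0 ?(ltW alpha0)// sumr_ge0// => k _; exact: sqnorm_ge0.
Qed.

(** This bound makes the cell means bounded in the energy. *)
Lemma mean_zero_poincare : exists2 K : R, 0 < K &
  forall p, X p -> sqnorm (p.1 \_ S) <= K * B p p.
Proof.
have [V V0 VE] := mean_cube_pos.
have cK := @compact_rad R d x0 Q hQ S0.
have [r r0 hr] := compact_margin cK ooms Koms.
(* A bound for the diameter of S. *)
pose D := 2 * (d.+1%:R * S0); have D0 : 0 < D by apply: mulr_gt0 => //; apply: mulr_gt0.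
have SD x y : S x -> S y -> `|y - x| < D.
  move=> Sx Sy; rewrite -(subrKA x0) -[x0 - x]opprB; apply: (le_lt_trans (ler_normB _ _)).
  have h1 := rad_norm hQ Sx; have h2 := rad_norm hQ Sy.
  by rewrite /D mulr_natl mulr2n; exact: ltrD.
pose C := 8 * d%:R * (2 * D) ^+ d * D ^+ 2.
have D1 := ltW D0; clearbody D.
have C0 : 0 <= C by rewrite /C !mulr_ge0// exprn_ge0// mulr_ge0.
exists (C / V / alpha + 1); first by rewrite ltr_wpDl// !divr_ge0// ltW.
move=> p [[Lp Lg wp _] p0 mp].
have := poincare_convex mS VE (@rad_convex R d x0 Q S0) SD D0 r0
   (fun x y Sx => hr x y (SK Sx)) Lp Lg wp mp.
rewrite -/C => h.
have /andP[hB _] := energy_bounds mA symA ellA alpha0 beta0 ooms Lg p0.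
have g0 : 0 <= \sum_k sqnorm (p.2 k) by apply: sumr_ge0 => k _; exact: sqnorm_ge0.
have B0 : 0 <= B p p by apply: le_trans hB; rewrite mulr_ge0// ltW.
have h1 : \sum_k sqnorm (p.2 k \_ S) <= B p p / alpha.
  rewrite ler_pdivlMr// mulrC; apply: le_trans hB; rewrite ler_wpM2l ?(ltW alpha0)//.
  by apply: ler_sum => k _; exact: sqnorm_patch_le.
apply: (@le_trans _ _ (C / V / alpha * B p p)); last by rewrite ler_wpM2r// lerDl.
rewrite mulrAC -mulrA mulrAC ler_pdivlMr// mulrC; apply: (le_trans h).
by rewrite ler_wpM2l.
Qed.

Lemma nbhd_cube (r : R) : nbhd om r `<=` [set x | rd x < H / 2 + d%:R * r].
Proof.
move=> x [y oy xy] /=; apply: (le_lt_trans (rad_lip x0 hQ y x)).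
by apply: ltr_leD => //; rewrite ler_wpM2l// ltW.
Qed.

(** The number of cells in each direction is q (N+1), with q fixed such that
    the decay factor C (s / delta)^2 is at most 1/e. The constant c0 removes
    the mean over S, and the w j are the complement of the cell means. *)
Theorem harmonic_approximation : exists (K : R) (q : nat), [/\ 0 < K, (0 < q)%N &
  forall N : nat, let m := #|{ffun 'I_d -> 'I_(q * N.+1)}| in
  exists2 w : 'I_m -> E -> R, (forall j, exists g, harm oms A (w j) g) &
  forall u g, harm oms A u g -> (forall k x, ~ oms x -> g k x = 0) ->
  exists (c0 : R) (c : 'I_m -> R) v gv, [/\ harm oms A v gv,
    (forall x, oms x -> u x = v x + (c0 + \sum_j c j * w j x)) &
    \sum_k sqnorm (gv k \_ om) + sqnorm (v \_ om) <= K * expR (- N%:R) * energy oms A g g]].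
Proof.
have [KP KP0 hKP] := mean_zero_poincare.
have [V V0 VE] := mean_cube_pos.
have [C C0 hdec] := energy_decay mA symA ellA alpha0 beta0 ooms foms.
have cK := @compact_rad R d x0 Q hQ S0.
(* The r0-neighbourhood of the small cube lies in S. *)
pose r0 := (Hs - H) / (4 * d.+1%:R).
have r00 : 0 < r0 by rewrite divr_gt0 ?subr_gt0// mulr_gt0.
have Nr0 : nbhd om r0 `<=` S.
  apply: (subset_trans (@nbhd_cube r0)) => x /= h; rewrite /S /=; apply: (lt_le_trans h).
  have dr : d%:R * r0 <= (Hs - H) / 4.
    have <- : d.+1%:R * r0 = (Hs - H) / 4 by rewrite /r0; field; rewrite nat1r pnatr_eq0.
    by rewrite ler_wpM2r ?(ltW r00)// ler_nat.
  by move: dr; rewrite /S0; move: (d%:R * r0) => t; lra.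
(* S lies in the box of side 2 L about x0 that carries the grid. *)
have [L LE L0] : exists2 L, L = d.+1%:R * S0 & 0 < L by exists (d.+1%:R * S0) => //; apply: mulr_gt0.
(* q makes the ratio tau = s / delta = 2 L / (q r0) so small that one step of
   energy_decay gains a factor 1/e. *)
have [q q0 hq] : exists2 q : nat, (0 < q)%N & 2 * L / (q%:R * r0) <= 1 / 2 /\
    C * (2 * L / (q%:R * r0)) ^+ 2 <= expR (-1).
  pose y := 2 * L / r0; have y0 : 0 < y by rewrite divr_gt0// mulr_gt0.
  pose th := Num.min (1 / 2) (expR (-1) / C).
  have th0 : 0 < th by rewrite lt_min !divr_gt0// expR_gt0.
  have yth : 0 <= y / th by rewrite divr_ge0 ?(ltW y0) ?(ltW th0).
  pose q := (Num.bound (y / th)).+1; exists q => //.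
  have qp : 0 < q%:R :> R by rewrite ltr0n.
  have -> : 2 * L / (q%:R * r0) = y / q%:R by rewrite /y invfM mulrA mulrAC.
  have yq : y / q%:R <= th.
    rewrite ler_pdivrMr// mulrC -ler_pdivrMr//; apply/ltW/(lt_trans (archi_boundP yth)).
    by rewrite ltr_nat.
  have yq0 : 0 <= y / q%:R by rewrite divr_ge0 ?(ltW y0) ?(ltW qp).
  have yq1 : y / q%:R <= 1 / 2 by apply: (le_trans yq); rewrite ge_min lexx.
  split => //; apply: (@le_trans _ _ (C * th)).
    rewrite ler_wpM2l ?(ltW C0)// expr2; apply: le_trans yq; rewrite ler_piMr//; lra.
  by rewrite mulrC -ler_pdivlMr// ge_min lexx orbT.
pose tau := 2 * L / (q%:R * r0).
pose K1 : R := 1 + @poincare_cst R d * (2 * L) ^+ 2.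
have CP0 := @poincare_cst_ge0 R d.
exists (2 * K1 / alpha), q; split => //.
  by rewrite divr_gt0// mulr_gt0// /K1 ltr_wpDr// mulr_ge0// sqr_ge0.
move=> N; set M := (q * N.+1)%N; move=> m.
have M0 : 0 < M%:R :> R by rewrite ltr0n muln_gt0 q0.
pose s := 2 * L / M%:R; have s0 : 0 < s by rewrite divr_gt0// mulr_gt0.
pose delta := r0 / N.+1%:R; have d0 : 0 < delta by rewrite divr_gt0.
have sd : s / delta = tau.
  by rewrite /s /delta /tau /M natrM; field; rewrite !gt_eqF//= ?ltr0n//.
have Nd : N.+1%:R * delta = r0 by rewrite mulrC divfK.
pose b : E := \row_k (x0 ord0 k - L).
have box x : S x -> forall k, b ord0 k <= x ord0 k < b ord0 k + s * M%:R.
  move=> Sx k; rewrite /s divfK ?gt_eqF// mxE; have h := rad_norm hQ Sx.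
  have := le_lt_trans (rV_norm_coord (x - x0) k) h; rewrite !mxE -LE ltr_norml.
  by move: (x ord0 k) (x0 ord0 k) => t t0; lra.
(* Cells are cut at the boundary of S, so that every functional is bounded on
   X; for the cells inside S, the only ones that matter, this changes nothing. *)
pose f (j : 'I_m) (p : ((E -> R) * ('I_d -> E -> R))%type) : R :=
  \int[mu]_x (p.1 \_ (cell b s (enum_val j) `&` S)) x.
have mcS j : measurable (cell b s (M := M) j `&` S).
  by apply: measurableI => //; exact: measurable_cell.
have fl j : linear_in X (f j).
  move=> t [u1 g1] [u2 g2] [[L1 _ _ _] _ _] [[L2' _ _ _] _ _].
  rewrite /f; change ((t *: (u1, g1) + (u2, g2)).1) with (fun x => t * u1 x + u2 x).
  have I1 : intg (u1 \_ (cell b s (enum_val j) `&` S)) by apply: intg_restrictT => //; case: L1.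
  have I2 : intg (u2 \_ (cell b s (enum_val j) `&` S)) by apply: intg_restrictT => //; case: L2'.
  rewrite -RintZ// -RintD//; last exact: intgZ.
  by apply: eq_Rintegral => x _; rewrite !patchE; case: ifP => // _; rewrite mulr0 addr0.
have fb j p : X p -> f j p ^+ 2 <= (V * KP) * B p p.
  move=> Xp; have [[Lp _ _ _] _ _] := Xp; have hp := hKP p Xp.
  have IS : L12 (\1_S : E -> R).
    have := intg_indic mS fS => I1; split => //; rewrite (_ : (fun x => _) = \1_S)//.
    by apply/funext => x; rewrite indicE; case: (_ \in _); rewrite ?expr1n ?expr0n.
  have nS : sqnorm (\1_S : E -> R) = V.
    rewrite /sqnorm (_ : (fun x => _) = \1_S); last first.
      by apply/funext => x; rewrite indicE; case: (_ \in _); rewrite ?expr1n ?expr0n.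
    by rewrite /Rintegral integral_indic// setIT VE.
  have LpS : L12 (p.1 \_ S) by exact: L12_restrict.
  have Lpc : L12 (p.1 \_ (cell b s (enum_val j) `&` S)) by exact: L12_restrict.
  have -> : f j p = \int[mu]_x (\1_S x * (p.1 \_ (cell b s (enum_val j) `&` S)) x).
    apply: eq_Rintegral => x _; rewrite patchE indicE; case: ifPn => [/set_mem[_ Sx]|_]; last by rewrite mulr0.
    by rewrite mem_set// mul1r.
  apply: (le_trans (cauchy_schwarz IS Lpc)); rewrite nS -mulrA ler_wpM2l ?(ltW V0)//.
  apply: le_trans hp; apply: sqnorm_patch_sub => //; exact: subIsetr.
have [w Xw hw] := gelfand_complement mean0_harm_subm energy_semi_inner fl fb (ltr1n R 2).
exists (fun j => (w j).1).
  by move=> j; have [hj _ _] := Xw j; exists (w j).2.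
move=> u g hu g0; have [Lu Lg wu tu] := hu.
pose c0 := (\int[mu]_x (u \_ S) x) / V.
(* u minus its mean over S. *)
pose u1 x := - c0 * \1_oms x + u x.
have h1 : harm oms A u1 g.
  have := harm_lin mA symA ellA alpha0 beta0 ooms (- c0) (harm_const A ooms foms) hu.
  by rewrite scaler0 add0r.
have X1 : X (u1, g).
  split => //=; rewrite (_ : u1 \_ S = fun x => (- c0) * \1_S x + (u \_ S) x); last first.
    apply/funext => x; rewrite !patchE !indicE; case: ifPn => [/set_mem Sx|_].
      by rewrite /u1 indicE mem_set ?mulr1//; exact: Soms.
    by rewrite mulr0 addr0.
  have IS := intg_indic mS fS; have IuS : intg (u \_ S) by apply: intg_restrictT => //; case: Lu.
  rewrite RintD//; last exact: intgZ.
  rewrite RintZ// {1}/Rintegral integral_indic// setIT VE /= mulNr divfK ?gt_eqF// addNr.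
  by [].
have [c [Xv fv Bv]] := hw _ X1.
set pv := (u1, g) - _ in Xv fv Bv.
have [hv v0 mv] := Xv; have [Lv Lgv wv _] := hv.
exists c0, c, pv.1, pv.2; split => //.
  move=> x ox; have -> : pv.1 x = u1 x - \sum_j c j * (w j).1 x.
    by rewrite /pv fst_sub_sum_scale -(fct_sum_scale c (fun j => (w j).1) x).
  by rewrite /u1 indicE mem_set// mulr1; clear; move: (\sum_j _) (u x) => t t'; ring.
have en0 : 0 <= \sum_k sqnorm (pv.2 k) by apply: sumr_ge0 => k _; exact: sqnorm_ge0.
have mom' : measurable om by exact: open_rV_measurable.
have sd2 : s <= delta / 2.
  have : s / delta <= 1 / 2 by rewrite sd; case: hq.
  rewrite ler_pdivrMr// => h; apply: (le_trans h); rewrite mul1r mulrC; exact: lexx.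
have [|||e1 e2] := hdec pv.1 pv.2 om _ delta s b M N hv mom' cK Koms d0 s0 sd2.
- by rewrite Nd; exact: subset_trans Nr0 SK.
- by move=> x; rewrite Nd => /Nr0; exact: box.
- move=> j; rewrite Nd => jN; have := fv (enum_rank j).
  rewrite /f enum_rankK (_ : cell b s j `&` S = cell b s j)//.
  by apply/setIidl; exact: subset_trans jN Nr0.
rewrite sd in e1.
set en1 := \sum_k sqnorm (pv.2 k \_ (nbhd om delta)) in e1 e2.
have h0 : \sum_k sqnorm (pv.2 k \_ om) <= en1.
  apply: ler_sum => k _; apply: sqnorm_patch_sub => //; first exact: measurable_nbhd.
  by move=> x Zx; exists x; rewrite // subrr normr0.
have sL : s <= 2 * L.
  by rewrite /s ler_pdivrMr// ler_peMr ?mulr_ge0 ?(ltW L0)// ler1n muln_gt0 q0.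
have e1' : en1 <= expR (- N%:R) * \sum_k sqnorm (pv.2 k).
  apply: (le_trans e1); rewrite ler_wpM2r//.
  rewrite expRN_nat.
  have t0 : 0 <= C * tau ^+ 2 by apply: mulr_ge0; [exact: ltW|exact: sqr_ge0].
  rewrite lerXn2r ?nnegrE ?t0 ?expR_ge0//; exact: hq.2.
have en1p : 0 <= en1 by apply: sumr_ge0 => k _; exact: sqnorm_ge0.
have h2 : \sum_k sqnorm (pv.2 k \_ om) + sqnorm (pv.1 \_ om) <= K1 * en1.
  rewrite /K1 mulrDl mul1r lerD//; apply: (le_trans e2); rewrite ler_wpM2r// ler_wpM2l//.
  have L2' : 0 <= 2 * L by rewrite mulr_ge0// ltW.
  by rewrite lerXn2r ?nnegrE ?(ltW s0)//.
have K10 : 0 <= K1 by apply: addr_ge0 => //; apply: mulr_ge0 => //; exact: sqr_ge0.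
apply: (le_trans h2); apply: (@le_trans _ _ (K1 * (expR (- N%:R) * (B pv pv / alpha)))).
  rewrite ler_wpM2l//; apply: (le_trans e1'); rewrite ler_wpM2l ?expR_ge0// ler_pdivlMr// mulrC.
  by have /andP[] := energy_bounds mA symA ellA alpha0 beta0 ooms Lgv v0.
have Bv' : B pv pv <= 2 * energy oms A g g by exact: Bv.
apply: (@le_trans _ _ (K1 * (expR (- N%:R) * (2 * energy oms A g g / alpha)))).
  by rewrite ler_wpM2l// ler_wpM2l ?expR_ge0// ler_wpM2r// invr_ge0 ltW.
rewrite le_eqVlt; apply/orP; left; apply/eqP.
move: (expR _) (energy _ _ _ _) => p1 p2; field; rewrite gt_eqF//.
Qed.

End approximation.

(** * The approximating subspace *)

Section span.
Variables (R : realType) (W : lmodType R) (Z : set W).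
Hypothesis sZ : subm Z.

Lemma inspan_sum n m (e : 'I_n -> W) (y : 'I_m -> W) (a : 'I_m -> R) :
  (forall j, inspan Z e (y j)) -> inspan Z e (\sum_j a j *: y j).
Proof.
case: sZ => Z0 ZD; elim: m y a => [|m IH] y a hy.
  by exists (fun=> 0); rewrite big_ord0 sub0r big1 ?oppr0// => k _; rewrite scale0r.
have [c hc] := hy ord0; have [b hb] := IH (fun j => y (lift ord0 j)) (fun j => a (lift ord0 j)) (fun j => hy _).
exists (fun k => a ord0 * c k + b k).
have := ZD (a ord0) _ _ hc hb; congr Z; rewrite big_ord_recl scalerBr addrACA -opprD; congr (_ - _).
rewrite scaler_sumr -big_split/=; apply: eq_bigr => k _; by rewrite scalerA scalerDl.
Qed.

End span.

Section bumps.
Context {R : realType} {d : nat}.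
Local Notation E := 'rV[R]_d.
Local Notation mu := (lebesgue_rV R d).

Lemma ae_zero_subm (om : set E) : subm (ae_zero om).
Proof.
split; first by apply: aeW => x _.
by move=> a u v hu hv; apply: filterS2 hu hv => x h1 h2 ox; rewrite /= !fctE h1// h2// scaler0 addr0.
Qed.

(** Balls are not negligible. *)
Lemma ae_pick (om : set E) (P : E -> Prop) (z : E) (r : R) : 0 < r -> ball z r `<=` om ->
  {ae mu, forall x, om x -> P x} -> exists2 x, ball z r x & P x.
Proof.
move=> r0 Bom [N [mN N0 hN]]; apply: contrapT => /forall2NP h.
have BN : ball z r `<=` N.
  by move=> x Bx; apply: hN => /= hx; case: (h x) => //; apply; exact/hx/Bom.
have : (mu (ball z r) <= mu N)%E.
  by apply: le_measure => //; apply/mem_set => //; exact: measurable_rV_ball.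
rewrite N0 lebesgue_rV_ball// lee_fin leNgt => /negP; apply.
by rewrite exprn_gt0// mulr2n addr_gt0.
Qed.

(** Bumps of radius t_i / 4 about the points x0 + t_i e_0 with t_i = r / 2 /
    4^i: their 0-th coordinates relative to x0 lie between 3/4 t_i and 5/4
    t_i, and these intervals are disjoint. *)
Lemma disjoint_bumps (om : set E) (x0 : E) (r : R) : (0 < d)%N -> 0 < r ->
  (forall x, `|x - x0| <= r -> om x) ->
  exists p : nat -> E -> R, (forall i, test_fun om (p i)) /\
    forall N, indep (ae_zero om) (fun i : 'I_N => p i).
Proof.
move=> dp r0 hom; pose k0 : 'I_d := Ordinal dp.
pose t (i : nat) : R := r / 2 / 4 ^+ i.
have t0 i : 0 < t i by rewrite !divr_gt0// exprn_gt0.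
have tS i j : (i < j)%N -> t j <= t i / 4.
  move=> ij; rewrite /t -[leRHS]mulrA -invfM -exprSr.
  apply: ler_wpM2l; first by rewrite divr_ge0 ?(ltW r0).
  rewrite lef_pV2 ?posrE ?exprn_gt0//.
  by rewrite ler_eXn2l// ltr1n.
have tr i : t i <= r / 2.
  by rewrite /t ler_pdivrMr ?exprn_gt0// ler_peMr ?divr_ge0 ?(ltW r0)// exprn_ege1// ler1n.
pose z i : E := x0 + t i *: delta_mx ord0 k0.
have zn i : `|z i - x0| <= t i.
  rewrite /z addrAC subrr add0r normrZ gtr0_norm// ler_piMr ?(ltW (t0 i))//.
  apply/rV_norm_leP => // k; rewrite mxE eqxx /=; by case: (_ == _); rewrite ?normr1 ?normr0.
pose p i (x : E) : R := bump0 ((t i / 4)^-1 *: x + (- ((t i / 4)^-1 *: z i))).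
have q0 i : 0 < t i / 4 by rewrite divr_gt0.
have pE i x : p i x = bump0 ((t i / 4)^-1 *: (x - z i)) by rewrite /p scalerBr.
have nE i x : `|(t i / 4)^-1 *: (x - z i)| = `|x - z i| / (t i / 4).
  by rewrite normrZ gtr0_norm ?invr_gt0// mulrC.
have p_out i x : t i / 4 <= `|x - z i| -> p i x = 0.
  by move=> h; rewrite pE bump0_out// nE ler_pdivlMr// mul1r.
have p_in i x : `|x - z i| < t i / 4 -> 0 < p i x.
  by move=> h; rewrite pE bump0_gt0// nE ltr_pdivrMr// mul1r.
have ball_om i x : `|x - z i| <= t i / 4 -> om x.
  move=> h; apply: hom; rewrite -(subrKA (z i)); apply: (le_trans (ler_normD _ _)).
  apply: (le_trans (lerD h (zn i))); have := tr i; have := t0 i; move: (t i) => s; lra.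
exists p; split=> [i|N c hc k].
  apply: (test_funI (K := [set y | `|y - z i| <= t i / 4])).
  - exact: smooth_affine (@smooth_bump0 R d).
  - exact: closed_rV_ball_compact.
  - by move=> x /= /negP; rewrite -ltNge => /ltW/p_out.
  - by move=> x /= /ball_om.
apply/eqP; apply: contraT => ck.
have Bom : ball (z k) (t k / 4) `<=` om.
  by move=> x; rewrite -ball_normE /ball_ /= -normrN opprB => /ltW/ball_om.
have [x Bx] := ae_pick (q0 k) Bom hc.
rewrite (fct_sum_scale c (fun i : 'I_N => p i)) (bigD1 k)//= big1 ?addr0.
  move=> /eqP; rewrite mulf_eq0 (negbTE ck)/= gt_eqF//; apply: p_in.
  by move: Bx; rewrite -ball_normE /ball_ /= -normrN opprB.
move=> i ik; rewrite p_out ?mulr0//; rewrite leNgt; apply/negP => xi.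
have xk : `|x - z k| < t k / 4 by move: Bx; rewrite -ball_normE /ball_ /= -normrN opprB.
have co j : `|x - z j| < t j / 4 -> t j * (3/4) < x ord0 k0 - x0 ord0 k0 < t j * (5/4).
  move=> h; have := le_lt_trans (rV_norm_coord (x - z j) k0) h; rewrite !mxE !eqxx mulr1 ltr_norml.
  by move: (x ord0 k0) (x0 ord0 k0) (t j) => a b s; lra.
have /andP[i1 i2] := co i xi; have /andP[k1 k2] := co k xk.
have := t0 i; have := t0 k; have [ik'|ki|e] := ltngtP i k.
- by have := tS _ _ ik'; lra.
- by have := tS _ _ ki; lra.
- by move: ik; rewrite -val_eqE /= e eqxx.
Qed.

End bumps.

Section subspace.
Context {R : realType} {d : nat}.
Local Notation E := 'rV[R]_d.
Local Notation mu := (lebesgue_rV R d).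
Implicit Types (f h w u v phi psi : E -> R) (g gam : 'I_d -> E -> R).
Hypothesis dp : (0 < d)%N.
Variables (x0 : E) (Q : 'M[R]_d).
Hypothesis hQ : orthogonal_mx Q.
Variables (H Hs : R).
Hypothesis H0 : 0 < H.
Hypothesis HHs : H < Hs.
Let om : set E := [set x | rad x0 Q x < H / 2].
Let oms : set E := [set x | rad x0 Q x < Hs / 2].
Variables (A : E -> 'M[R]_d) (alpha beta : R).
Hypothesis mA : forall k l, measurable_fun oms (fun x => A x k l).
Hypothesis symA : forall x, oms x -> (A x)^T = A x.
Hypothesis ellA : forall x xi : E, oms x ->
  alpha * enorm xi ^+ 2 <= dot (xi *m (A x)^T) xi <= beta * enorm xi ^+ 2.
Hypothesis alpha0 : 0 < alpha.
Hypothesis beta0 : 0 <= beta.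
Variables (chi : E -> R) (gam : 'I_d -> E -> R) (G : R).
Hypothesis Lchi : L12 chi.
Hypothesis chi01 : forall x, 0 <= chi x <= 1.
Hypothesis Lgam : forall k, L12 (gam k).
Hypothesis gamG : forall k x, `|gam k x| <= G.
Hypothesis wchi : wg oms chi gam.
Hypothesis chi0 : forall x, ~ om x -> chi x = 0.
Hypothesis chic : forall x, om x -> {for x, continuous chi}.

Let oom : open om. Proof. exact: open_rad. Qed.
Let ooms : open oms. Proof. exact: open_rad. Qed.
Let fom : (mu om < +oo)%E. Proof. exact: mu_rad. Qed.
Let foms : (mu oms < +oo)%E. Proof. exact: mu_rad. Qed.
Let omoms : om `<=` oms.
Proof. by move=> x; rewrite /om /oms /= => /lt_trans; apply; rewrite ltr_pM2r. Qed.
Let mom : measurable om. Proof. exact: open_rV_measurable. Qed.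
Let moms : measurable oms. Proof. exact: open_rV_measurable. Qed.

Lemma chi_harm_H10 u g : harm oms A u g -> H10 om (fun x => chi x * u x).
Proof.
move=> [Lu Lg wu _].
exact: (chi_H10 hQ H0 HHs Lchi chi01 Lgam gamG wchi chi0 chic Lu Lg wu).
Qed.

(** chi is bounded by 1 and its gradient by G. The function v' is any
    representative of chi u. *)
Lemma anorm_chi_le u g (v' : E -> R) : harm oms A u g -> measurable_fun om v' ->
  {ae mu, forall x, om x -> chi x * u x = v' x} ->
  anorm A om v' <= Num.sqrt (beta * (2 * (1 + d%:R * G ^+ 2)) *
    (\sum_k sqnorm (g k \_ om) + sqnorm (u \_ om))).
Proof.
move=> [Lu Lg wu _] mv' ae; rewrite /anorm ler_wsqrtr//.
pose h := chi_grad x0 Q H chi gam u g.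
have Lh k : L12 (h k) by exact: (chi_grad_L12 _ _ _ Lchi chi01 Lgam gamG Lu (Lg k)).
have wh : wg om (fun x => chi x * u x) h.
  exact: (chi_wg hQ HHs Lchi chi01 Lgam gamG wchi Lu Lg wu).
have Lcu : L12 (fun x => chi x * u x) by exact: (chiM_L12 Lchi chi01 Lu).
have hv' : is_weak_grad om v' (vec h).
  by apply: (is_weak_grad_ae oom mv' ae); exact: (wg_weak_grad oom (@subset_refl _ om)).
have mA' k l : measurable_fun om (fun x => A x k l) by apply: measurable_funS (mA k l).
have symA' x : om x -> (A x)^T = A x by move=> /omoms; exact: symA.
have ellA' x xi : om x ->
  alpha * enorm xi ^+ 2 <= dot (xi *m (A x)^T) xi <= beta * enorm xi ^+ 2 by move=> /omoms; exact: ellA.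
rewrite (aform_wg oom mA' hv' hv') fluxdot_Rint.
have h_out k x : ~ om x -> h k x = 0 by move=> ox; rewrite /h /chi_grad patchE memNset.
have /andP[_ he] := energy_bounds mA' symA' ellA' alpha0 beta0 oom Lh h_out.
apply: (le_trans he); rewrite -[leRHS]mulrA ler_wpM2l//.
have LgN k : L12 (g k \_ om) by exact: L12_restrict.
have LuN : L12 (u \_ om) by exact: L12_restrict.
have hk k : sqnorm (h k) <= 2 * sqnorm (g k \_ om) + 2 * G ^+ 2 * sqnorm (u \_ om).
  have I1 : intg (fun x => (g k \_ om) x ^+ 2) by exact: (LgN k).2.
  have I2 : intg (fun x => (u \_ om) x ^+ 2) by exact: LuN.2.
  rewrite /sqnorm -!RintZ// -RintD; [|exact: intgZ..].
  apply: le_Rint; [exact: (Lh k).2|by apply: intgD; exact: intgZ|].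
  move=> x; rewrite /h /chi_grad !patchE; case: ifP => _; last by rewrite expr0n !mulr0 addr0.
  apply: (le_trans (sqrD_le _ _)); apply: lerD.
    rewrite ler_wpM2l// exprMn ler_piMl ?sqr_ge0//.
    by have /andP[c0 c1] := chi01 x; rewrite exprn_ile1.
  rewrite -mulrA ler_wpM2l// exprMn ler_wpM2r ?sqr_ge0// -[leLHS]real_normK ?num_real//.
  by rewrite lerXn2r ?nnegrE// (le_trans (normr_ge0 _) (gamG k x)).
apply: (@le_trans _ _ (\sum_k (2 * sqnorm (g k \_ om) + 2 * G ^+ 2 * sqnorm (u \_ om)))).
  exact: ler_sum.
rewrite big_split/= -mulr_sumr sumr_const card_ord -(mulr_natl (2 * G ^+ 2 * _) d).
have s0 : 0 <= \sum_k sqnorm (g k \_ om) by apply: sumr_ge0 => k _; exact: sqnorm_ge0.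
have t0 := sqnorm_ge0 (u \_ om).
have D0 : 0 <= d%:R * G ^+ 2 by rewrite mulr_ge0// sqr_ge0.
move: s0 t0 D0; move: (sqnorm (u \_ om)) (\sum_k _) => t s s0 t0.
move=> D0; rewrite (_ : d%:R * (2 * G ^+ 2 * t) = 2 * (d%:R * G ^+ 2) * t); last by ring.
have Ds := mulr_ge0 D0 s0; rewrite -subr_ge0.
rewrite (_ : _ - _ = 2 * (t + d%:R * G ^+ 2 * s)); last by ring.
by rewrite mulr_ge0// addr_ge0.
Qed.

(** The family consists of chi, for the constants, and of the chi w_j;
    harmonic_approximation bounds what remains, and anorm_chi_le passes to the
    energy norm of its product with chi. *)
Theorem approximating_subspace : exists (K : R) (q : nat), [/\ 0 <= K, (0 < q)%N &
  forall N n : nat, ((q * N.+1) ^ d < n)%N -> exists V : set (E -> R),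
  subspace_of_dim om n V /\ forall u, HA A oms u -> exists2 v, V v &
  anorm A om (chi \* u \- v) <= K * expR (- (N%:R / 2)) * anorm A oms u].
Proof.
have [K [q [K0 q0 hK]]] := harmonic_approximation hQ H0 HHs mA symA ellA alpha0 beta0.
pose K2 := beta * (2 * (1 + d%:R * G ^+ 2)) * K.
have K20 : 0 <= K2.
  by rewrite !mulr_ge0 ?(ltW K0)// addr_ge0// mulr_ge0// sqr_ge0.
exists (Num.sqrt K2), q; split => //.
move=> N n; have := hK N; set m := #|_| => /= -[w hw happ] qn.
have mE : m = ((q * N.+1) ^ d)%N by rewrite /m card_ffun !card_ord.
pose y (j : 'I_m.+1) : E -> R := oapp (fun i x => chi x * w i x) chi (unlift ord0 j).
have yH j : H10 om (y j).
  rewrite /y; case: unliftP => [i _|_] /=.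
    by have [g hg] := hw i; exact: chi_harm_H10 hg.
  have := chi_harm_H10 (harm_const A ooms foms); congr (H10 om _); apply/funext => x.
  rewrite indicE; have [ox|ox] := pselect (om x); last by rewrite chi0// mul0r.
  by rewrite mem_set ?mulr1//; exact: omoms.
have [p [pt pi]] : exists p : nat -> E -> R, (forall i, test_fun om (p i)) /\
    forall N, indep (ae_zero om) (fun i : 'I_N => p i).
  pose r := H / 4 / d.+1%:R; have r0 : 0 < r by rewrite !divr_gt0.
  apply: (@disjoint_bumps _ _ om x0 r dp r0) => x xr; rewrite /om /=.
  have := rad_lip x0 hQ x0 x; rewrite {2}/rad subrr mul0mx normr0 add0r => h.
  apply: (le_lt_trans h); apply: (@le_lt_trans _ _ (d.+1%:R * r)).
    by rewrite ler_pM// ler_nat.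
  by rewrite /r mulrC divfK//; have := H0; lra.
have pH i : H10 om (p i) by exact: test_fun_H10.
have mn : (m.+1 <= n)%N by rewrite mE.
have [e [eH ie se]] := basis_exact (ae_zero_subm om) mn yH pH pi.
exists [set v | exists c : 'I_n -> R, v = fun x => \sum_k c k * e k x]; split.
  exists e; split => // c hc; apply: ie.
  by rewrite (_ : \sum_k c k *: e k = fun x => \sum_k c k * e k x)//; apply/funext => x; rewrite fct_sum_scale.
move=> u hu; have [g [hg g0 ->]] := HA_harm mA ooms foms hu.
have [c0 [c [v [gv [hv uE hen]]]]] := happ _ _ hg g0.
pose a (j : 'I_m.+1) : R := oapp c c0 (unlift ord0 j).
have [b hb] := inspan_sum (ae_zero_subm om) a se.
exists (fun x => \sum_k b k * e k x); first by exists b.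
have m_e k : measurable_fun om (e k) by have [[[]]] := eH k.
have mu' : measurable_fun om u.
  by apply: (measurable_funS (E := oms)) => //; have [[[]]] := hu.
have mv : measurable_fun om (chi \* u \- (fun x => \sum_k b k * e k x)).
  apply: measurable_funB; first by apply: measurable_funM => //; apply: measurable_funTS; exact: L12_meas.
  by apply: measurable_sum => k; exact: measurable_funM.
have ae : {ae mu, forall x, om x -> chi x * v x = (chi \* u \- (fun x => \sum_k b k * e k x)) x}.
  apply: filterS hb => x hx ox; have := hx ox.
  have -> : (\sum_j a j *: y j - \sum_k b k *: e k) x =
      (\sum_j a j * y j x) - \sum_k b k * e k x.
    by rewrite -(fct_sum_scale a y x) -(fct_sum_scale b e x).
  move/eqP; rewrite subr_eq0 => /eqP yb.
  change (chi x * v x = chi x * u x - \sum_k b k * e k x); rewrite -yb.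
  have := uE x (omoms ox); rewrite patchE mem_set; last exact: omoms.
  move=> ->; rewrite big_ord_recl /a /y unlift_none /=.
  have -> : \sum_(i < m) oapp c c0 (unlift ord0 (lift ord0 i)) *
     oapp (fun i0 x1 => chi x1 * w i0 x1) chi (unlift ord0 (lift ord0 i)) x = chi x * \sum_i c i * w i x.
    by rewrite mulr_sumr; apply: eq_bigr => i _; rewrite liftK /= mulrCA.
  by move: (\sum_i _) (chi x) (v x) => s t r; ring.
apply: (le_trans (anorm_chi_le hv mv ae)).
have D0 : 0 <= beta * (2 * (1 + d%:R * G ^+ 2)).
  by rewrite mulr_ge0// mulr_ge0// addr_ge0// mulr_ge0// sqr_ge0.
have E0 : 0 <= energy oms A g g.
  have [_ Lg _ _] := hg; have /andP[h _] := energy_bounds mA symA ellA alpha0 beta0 ooms Lg g0.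
  by apply: le_trans h; rewrite mulr_ge0 ?(ltW alpha0)// sumr_ge0// => k _; exact: sqnorm_ge0.
(* The energy norm is the square root of the energy, which halves the rate. *)
have -> : expR (- (N%:R / 2)) = Num.sqrt (expR (- N%:R)) :> R.
  have -> : expR (- N%:R) = (expR (- (N%:R / 2))) ^+ 2 :> R.
    by rewrite expr2 -expRD; congr expR; field.
  by rewrite sqrtr_sqr ger0_norm// expR_ge0.
have KE : 0 <= K2 * expR (- N%:R) by apply: mulr_ge0 => //; exact: expR_ge0.
rewrite -(sqrtrM _ K20) -(sqrtrM _ KE) ler_wsqrtr//.
by apply: (le_trans (ler_wpM2l D0 hen)); rewrite /K2 !mulrA.
Qed.

End subspace.

(** * The data of the theorem and the choice of constants *)

Section cutoff_data.
Context {R : realType} {d : nat}.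
Local Notation E := 'rV[R]_d.
Local Notation mu := (lebesgue_rV R d).
Implicit Types (f h w u v phi psi : E -> R) (g gam : 'I_d -> E -> R).

Lemma diam_ge0 (S : set E) : 0 <= diam S.
Proof.
rewrite /diam; set T := [set r | _].
have [[[r Tr] uT]|/sup_out->//] := pselect (has_sup T).
apply: (@le_trans _ _ r); last exact: ub_le_sup.
by have [x [y [_ _ ->]]] := Tr; exact: sqrtr_ge0.
Qed.

Lemma coord_le_enorm (x : E) k : `|x ord0 k| <= enorm x.
Proof.
rewrite /enorm -sqrtr_sqr ler_wsqrtr// /dot (bigD1 k)//= -expr2 lerDl.
by apply: sumr_ge0 => j _; rewrite -expr2 sqr_ge0.
Qed.

(** Truncation to [-G, G]: the gradient bound holds almost everywhere, and a
    bound everywhere is obtained by changing the gradient on a null set. *)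
Definition clip (G t : R) : R := Num.max (- G) (Num.min t G).

Lemma clip_norm G t : 0 <= G -> `|clip G t| <= G.
Proof.
move=> G0; rewrite ler_norml /clip le_max lexx/= ge_max ge_min lexx orbT andbT.
by rewrite (le_trans _ G0)// oppr_le0.
Qed.

Lemma clip_id G t : `|t| <= G -> clip G t = t.
Proof.
rewrite ler_norml /clip => /andP[h1 h2].
by rewrite (min_idPl h2); apply/max_idPr.
Qed.

(** The partition function and its gradient on the domain, extended by zero
    and modified on a null set, satisfy what approximating_subspace requires. *)
Lemma cutoff_data (Omega om oms : set E) chi (g : E -> E) (G0 : R) :
  open Omega -> open om -> open oms -> (mu oms < +oo)%E -> om `<=` oms -> oms `<=` Omega ->
  C1_on om chi -> is_weak_grad Omega chi g -> {ae mu, forall x, Omega x -> enorm (g x) <= G0} ->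
  (forall x, Omega x -> 0 <= chi x <= 1) -> (forall x, Omega x -> ~ om x -> chi x = 0) ->
  let G := Num.max 0 G0 in let chi' := chi \_ om in
  exists gam, [/\ L12 chi' /\ (forall x, om x -> {for x, continuous chi'}),
    forall x, 0 <= chi' x <= 1, forall k, L12 (gam k), forall k x, `|gam k x| <= G & wg oms chi' gam].
Proof.
move=> oO oom ooms foms omoms omsO C1 hg hG chi01 chi0 G chi'.
have G00 : 0 <= G by rewrite le_max lexx.
have mO := open_rV_measurable oO; have mom := open_rV_measurable oom.
have moms := open_rV_measurable ooms.
have omO : om `<=` Omega by exact: subset_trans omsO.
have mchi : measurable_fun om chi by case: hg => -[mc _] _ _; exact: measurable_funS mc.
have chi'E : chi' = chi \_ Omega.
  apply/funext => x; rewrite /chi' !patchE; case: ifPn => [/set_mem ox|ox].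
    by rewrite mem_set//; exact: omO.
  case: ifPn => // /set_mem Ox; rewrite chi0// => /mem_set h; by rewrite h in ox.
have c01 x : 0 <= chi' x <= 1.
  rewrite /chi' patchE; case: ifPn => [/set_mem/omO/chi01//|_]; by rewrite lexx ler01.
have Ioms := intg_indic moms foms.
have Loms : L12 (\1_oms : E -> R).
  split => //; rewrite (_ : (fun x => _) = \1_oms)//; apply/funext => x.
  by rewrite indicE; case: (_ \in _); rewrite ?expr1n ?expr0n.
have mchi' : measurable_fun setT chi' by apply/(measurable_restrictT _ mom).
have mgk k : measurable_fun setT ((fun x => g x ord0 k) \_ Omega).
  by apply/(measurable_restrictT _ mO); exact: weak_grad_meas hg.
pose gam k x := clip G (((fun x => g x ord0 k) \_ Omega) x) * \1_oms x.
have moms1 : measurable_fun setT (\1_oms : E -> R) by exact: measurable_indic.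
have mgam k : measurable_fun setT (gam k).
  apply: measurable_funM => //; apply: measurable_maxr; first exact: measurable_cst.
  by apply: measurable_minr => //; exact: measurable_cst.
have gamG k x : `|gam k x| <= G * \1_oms x.
  by rewrite /gam normrM [`|\1_oms x|]ger0_norm// ler_wpM2r// clip_norm.
exists gam; split => //.
- split; last first.
    move=> x ox; have dx := C1.1 x ox.
    have near : \forall y \near x, chi y = chi' y.
      by apply: filterS (open_nbhs_nbhs (conj oom ox)) => y oy; rewrite /chi' patchE mem_set.
    rewrite /prop_for /continuous_at /chi' patchE mem_set//.
    move=> S /(differentiable_continuous dx) nS.
    by apply: filterS2 near nS => y /= e; rewrite -/chi' -e.
  apply: (le_L12 mchi' _ Loms) => x; have /andP[c0 c1] := c01 x.
  rewrite ger0_norm// indicE; case: (boolP (x \in oms)) => // ox.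
  by rewrite /chi' patchE; case: ifPn => // /set_mem/omoms/mem_set h; rewrite h in ox.
- by move=> k; apply: (le_L12 (mgam k) (gamG k)); exact: L12Z.
- by move=> k x; apply: (le_trans (gamG k x)); rewrite ler_piMr.
rewrite chi'E; apply: (wg_ae (g := fun k => (fun x => g x ord0 k) \_ Omega)) => //.
- by move=> k; exact: measurable_funTS.
- by move=> k; exact: measurable_funTS.
- move=> k; apply: filterS hG => x hx ox; rewrite /gam indicE mem_set// mulr1 clip_id//.
  rewrite patchE mem_set; last exact: omsO.
  apply: (le_trans (coord_le_enorm _ _)); apply: (le_trans (hx (omsO _ ox))).
  by rewrite le_max lexx orbT.
- by apply: wgS omsO _; exact: weak_grad_wg.
Qed.

End cutoff_data.

Section arithmetic.
Context {R : realType}.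

(** The logarithm of s is negative. *)
Lemma hfun_le1 (s : R) : 0 < s < 1 -> hfun s <= 1.
Proof.
move=> /andP[s0 s1]; rewrite /hfun gerDl -[leLHS]opprK oppr_le0 -mulNr divr_ge0//.
  by rewrite -mulrN mulr_ge0 ?(ltW s0)// oppr_ge0; apply: ln_le0; exact: ltW.
by rewrite subr_ge0 ltW.
Qed.

(** N is the integer part of x = n^(1/(d+1)). For large n, (q (N+1))^d <= (2
    q)^d N^d < N^(d+1) <= n. The left-hand side is at most K exp(1/2)
    exp(-x/2), the right-hand side at least C1 exp(-1) exp(-x/4). *)
Lemma choice_of_level (d q : nat) (K C1 : R) : (0 < q)%N -> 0 <= K -> 0 < C1 ->
  exists2 n0 : nat, (0 < n0)%N & forall n h, (n0 < n)%N -> h <= 1 ->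
  exists2 N : nat, ((q * N.+1) ^ d < n)%N &
  K * expR (- (N%:R / 2)) <= C1 * expR (- 1) * expR (- (8^-1 * (n%:R `^ (d.+1%:R^-1))))
       * expR (- (h * 8^-1 * (n%:R `^ (d.+1%:R^-1)))).
Proof.
move=> q0 K0 C10; pose Y := 4 * K * expR (3 / 2) / C1.
have Y0 : 0 <= Y by rewrite divr_ge0 ?(ltW C10)// !mulr_ge0// expR_ge0.
(* The two summands serve the dimension count and the constant K,
   respectively. *)
pose T := ((2 * q) ^ d + Num.bound Y).+1.
exists (T ^ d.+1)%N; first by rewrite expn_gt0.
move=> n h nT h1; set x := n%:R `^ (d.+1%:R^-1).
have x0 : 0 <= x by exact: powR_ge0.
have xn : x ^+ d.+1 = n%:R.
  by rewrite -powR_mulrn// /x -powRrM mulVf ?pnatr_eq0// powRr1.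
have xT : T%:R <= x.
  by rewrite -(@ler_pXn2r _ d.+1)// ?nnegrE// xn -natrX ler_nat ltnW.
pose N := Num.truncn x.
have /andP[N1 N2] : N%:R <= x < N.+1%:R by exact: truncn_itv.
have TN : (T <= N)%N by rewrite truncn_ge_nat.
exists N.
  have Np : (0 < N)%N by apply: leq_trans TN.
  apply: (@leq_trans (N ^ d.+1)); last first.
    by rewrite -(ler_nat R) natrX -xn lerXn2r ?nnegrE.
  apply: (@leq_ltn_trans ((2 * q) ^ d * N ^ d)).
    rewrite -expnMn; case: (posnP d) => [->|dp]; first by rewrite !expn0.
    rewrite leq_exp2r// [(2 * q)%N]mulnC -mulnA leq_pmul2l// mul2n -addnn -addn1.
    by rewrite leq_add2l.
  rewrite expnS ltn_pmul2r ?expn_gt0 ?Np//; apply: leq_trans TN.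
  by rewrite /T ltnS leq_addr.
have Yx : Y <= x.
  apply: le_trans xT; apply: ltW; apply: (lt_le_trans (archi_boundP Y0)).
  by rewrite ler_nat /T leqW// leq_addl.
(* A linear lower bound for the exponential; 3/2 = 1/2 + 1, where 1/2 comes
   from N > x - 1 and 1 from the factor exp(-1) on the right. *)
have hK : K * expR (3 / 2) <= C1 * expR (x / 4).
  have : K * expR (3 / 2) <= C1 * (x / 4).
    move: Yx; rewrite /Y ler_pdivrMr//; move: (expR _) => t; lra.
  move=> h2; apply: (le_trans h2); rewrite ler_wpM2l ?(ltW C10)//.
  by apply: le_trans (expR_ge1Dx _); rewrite lerDr.
apply: (@le_trans _ _ (K * expR (3 / 2) * expR (- 1 - x / 2))).
  rewrite -mulrA -expRD ler_wpM2l// ler_expR; move: N2; rewrite -natr1; lra.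
apply: (@le_trans _ _ (C1 * expR (x / 4) * expR (- 1 - x / 2))).
  by rewrite ler_wpM2r ?expR_ge0.
rewrite -!mulrA -!expRD ler_wpM2l ?(ltW C10)// ler_expR.
have : h * (8^-1 * x) <= 8^-1 * x by rewrite ler_piMl// mulr_ge0.
lra.
Qed.

End arithmetic.

(** The chosen gradient depends only on the set of weak gradients, which is
    the same for u and v. *)
Lemma anorm_eq {R : realType} d (A : 'rV[R]_d -> 'M[R]_d) (om : set 'rV[R]_d) (u v : 'rV[R]_d -> R) :
  open om -> (forall x, om x -> u x = v x) -> anorm A om u = anorm A om v.
Proof.
move=> oom uv.
have h (f1 f2 : 'rV[R]_d -> R) G : (forall x, om x -> f1 x = f2 x) -> is_weak_grad om f1 G -> is_weak_grad om f2 G.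
  move=> e hw; have [[m1 _] _ _] := hw; apply: (is_weak_grad_ae oom _ _ hw).
    by apply: (eq_measurable_fun f1) => // x /set_mem/e.
  by apply: aeW => x ox; exact: e.
rewrite /anorm /aform (_ : grad om u = grad om v)// /grad; congr xget.
apply/seteqP; split=> G /=; first exact: h.
by apply: h => x /uv ->.
Qed.

Lemma rho_itv {R : realType} (H Hs : R) : 0 < H -> H < Hs -> 0 < H / Hs < 1.
Proof.
move=> H0 HHs; have Hs0 := lt_trans H0 HHs.
by rewrite divr_gt0//= ltr_pdivrMr// mul1r.
Qed.

Theorem theorem3p6 (R : realType) (d : nat) (hd : d = 2%N \/ d = 3%N)
  (Omega : set 'rV[R]_d) (hOmega : bounded_lipschitz_domain Omega)
  (A : 'rV[R]_d -> 'M[R]_d) (alpha beta : R)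
  (halpha : 0 < alpha) (hbeta : alpha < beta)
  (hA : elliptic_coefficient Omega A alpha beta)
  (I : finType) (O : I -> set 'rV[R]_d) (chi : I -> 'rV[R]_d -> R) (C1 : R)
  (hchi : partition_of_unity Omega O chi C1)
  (i : I) (omega omegas : set 'rV[R]_d)
  (homega : omega = O i `&` Omega) (hinterior : O i `<=` Omega)
  (x0 : 'rV[R]_d) (Q : 'M[R]_d) (hQ : orthogonal_mx Q)
  (H Hs : R) (hH : 0 < H) (hHs : H < Hs)
  (hcube : omega = cube x0 Q H) (hcubes : omegas = cube x0 Q Hs)
  (hsub : omega `<=` omegas) (hsubs : omegas `<=` Omega)
  (hden : aform A omega (chi i) (chi i) != 0) :
  let rho := H / Hs in
  exists (n0 : nat) (b : R), (0 < n0)%N /\ 0 < b /\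
    forall n : nat, (n0 < n)%N ->
      (nwidth A (chi i) omega omegas n <=
       (C1 * expR (- 1)
           * expR (- (b * (n%:R `^ (d.+1%:R^-1))))
           * expR (- (hfun rho * b * (n%:R `^ (d.+1%:R^-1)))))%:E)%E.
Proof.
move=> rho; have Hs0 : 0 < Hs by apply: lt_trans hHs.
have dp : (0 < d)%N by case: hd => ->.
have [_ oO _ _ _] := hOmega.
have [mAO _ symO ellO] := hA.
have [_ chi01 _ chi0 hC1] := hchi.
have [C1i [g hg hgb]] := hC1 i.
rewrite -homega in C1i hgb.
have omE : omega = [set x | rad x0 Q x < H / 2].
  by rewrite hcube; apply/seteqP; split=> x; rewrite /= (cube_rad x0 hQ x hH).
have omsE : omegas = [set x | rad x0 Q x < Hs / 2].
  by rewrite hcubes; apply/seteqP; split=> x; rewrite /= (cube_rad x0 hQ x Hs0).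
have oom : open omega by rewrite omE; exact: open_rad.
have ooms : open omegas by rewrite omsE; exact: open_rad.
have foms : (lebesgue_rV R d omegas < +oo)%E by rewrite omsE; exact: mu_rad.
have omO := subset_trans hsub hsubs.
have chi0' x : Omega x -> ~ omega x -> chi i x = 0.
  move=> Ox nx; apply: chi0 => // Oi; apply: nx; by rewrite homega.
have [gam [[Lchi chic] c01 Lgam gamG wchi]] := cutoff_data oO oom ooms foms hsub hsubs C1i hg hgb
  (fun x => chi01 i x) chi0'.
set chi' := chi i \_ omega in Lchi chic c01 wchi.
set G := Num.max 0 _ in gamG.
have mA k l : measurable_fun omegas (fun x => A x k l).
  by apply: measurable_funS (mAO k l) => //; exact: open_rV_measurable.
have symA x : omegas x -> (A x)^T = A x by move=> /hsubs; exact: symO.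
have ellA x xi : omegas x ->
  alpha * enorm xi ^+ 2 <= dot (xi *m (A x)^T) xi <= beta * enorm xi ^+ 2 by move=> /hsubs; exact: ellO.
have beta0 : 0 <= beta by rewrite ltW// (lt_trans halpha).
have chi'0 x : ~ omega x -> chi' x = 0 by move=> ox; rewrite /chi' patchE memNset.
(* If C1 <= 0, the gradient of chi vanishes and so does the denominator. *)
have C1p : 0 < C1.
  rewrite ltNge; apply/negP => C10; move/negP: hden; apply.
  have G0 : G = 0.
    by rewrite /G; apply/max_idPl; rewrite mulr_le0_ge0// invr_ge0 diam_ge0.
  have gam0 k x : gam k x = 0 by apply/eqP; rewrite -normr_le0 -[leRHS]G0.
  have mchi : measurable_fun omega (chi i).
    have [[mc _] _ _] := hg; apply: measurable_funS mc => //; exact: open_rV_measurable.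
  have mAo k l : measurable_fun omega (fun x => A x k l).
    by apply: measurable_funS (mA k l) => //; exact: open_rV_measurable.
  have hw : is_weak_grad omega (chi i) (vec gam).
    apply: (is_weak_grad_ae oom mchi _ (wg_weak_grad oom hsub Lchi Lgam wchi)).
    by apply: aeW => x ox; rewrite /chi' patchE mem_set.
  rewrite (aform_wg oom mAo hw hw); apply/eqP.
  rewrite Rintegral_mkcond -[RHS](@Rint0 R d).
  apply: eq_Rintegral => x _; rewrite patchE; case: ifP => // _.
  have -> : vec gam x = 0 by apply/rowP => k; rewrite !mxE gam0.
  by rewrite mul0mx /dot big1// => k _; rewrite mxE mul0r.
have [K [q [K0 q0 hK]]] : exists (K : R) (q : nat), [/\ 0 <= K, (0 < q)%N &
    forall N n : nat, ((q * N.+1) ^ d < n)%N -> exists V : set ('rV[R]_d -> R),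
    subspace_of_dim omega n V /\ forall u, HA A omegas u -> exists2 v, V v &
    anorm A omega (chi' \* u \- v) <= K * expR (- (N%:R / 2)) * anorm A omegas u].
  rewrite omE omsE in wchi chic chi'0 mA symA ellA *.
  exact: (approximating_subspace dp hQ hH hHs mA symA ellA halpha beta0 Lchi c01 Lgam gamG wchi chi'0 chic).
have [n0 n00 hn0] := choice_of_level d q0 K0 C1p.
exists n0, 8^-1; split => //; split; first by rewrite invr_gt0.
move=> n nn0; have [N qN hN] := hn0 n (hfun rho) nn0 (hfun_le1 (rho_itv hH hHs)).
have [V [sV hV]] := hK N n qN.
apply: (le_trans (ereal_inf_lbound _)); first by exists V.
apply: ge_ereal_sup => _ [u [[hu _] _] <-].
have [v Vv hv] := hV u hu.
apply: (le_trans (ereal_inf_lbound _)); first by exists v.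
rewrite lee_fin (_ : anorm A omega (chi i \* u \- v) = anorm A omega (chi' \* u \- v)); last first.
  by apply: anorm_eq => // x ox; rewrite /= /chi' patchE mem_set.
have rhs0 : 0 <= K * expR (- (N%:R / 2)) by rewrite mulr_ge0// expR_ge0.
(* If the energy norm of u is 0, the quotient is 0 by convention. *)
apply: le_trans hN; have [a0|a0] := eqVneq (anorm A omegas u) 0.
  by rewrite a0 invr0 mulr0.
by rewrite ler_pdivrMr// lt_neqAle eq_sym a0 sqrtr_ge0.
Qed.
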